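(* Let $(E,Q\equiv(\{l_k\}_{k\ge1},\rho))$ be a Lie $\infty$-algebroid over a smooth manifold $M$. Any modular cocycle is a representative of the modular class. That is: given frames $X_1,\dots,X_n$ of $TM$ and $e_1^{(i)},\dots,e_{a_i}^{(i)}$ of $E_{-i}$ ($i\ge1$) over an open subset $U\subset M$, the section of $E_{-1}^*|_U$ given by $$\omega(e)=\mathrm{div}(\rho(e))+\sum_{i\ge1}(-1)^i\,\mathrm{div}^{(i)}(e),\qquad e\in\Gamma(E_{-1}),$$ is $Q$-closed and represents (over $U$) the modular class of $(E,Q)$.
   Context: $\mathcal O=C^\infty(M)$. Graded vector bundles are of finite rank. Lie $\infty$-algebroid (negatively graded): a graded vector bundle $E=\oplus_{i\ge1}E_{-i}$ over $M$, an anchor $\rho:E_{-1}\to TM$ (extended by $0$ to $E_{-i}$, $i\ge2$), and degree $+1$ graded symmetric brackets $l_k=\{-,\dots,-\}_k$, $k\ge1$, on $\Gamma(E)$ satisfying, for all $n\ge1$, $\sum_{i+j=n+1}\sum_{\sigma\in Sh(i,j-1)}\epsilon(\sigma)l_j(l_i(x_{\sigma(1)},\dots,x_{\sigma(i)}),x_{\sigma(i+1)},\dots,x_{\sigma(n)})=0$ ($\epsilon(\sigma)$ Koszul sign, $Sh$ unshuffles), all $\mathcal O$-multilinear except $\{x,fy\}_2=f\{x,y\}_2+\rho(x)[f]y$ for $x\in\Gamma(E_{-1})$. $Q$ is the associated degree $+1$ derivation of $\mathcal E=\Gamma(S(E^* ))$ with $Q^2=0$. In degree $1$: $\mathcal E_1=\Gamma(E_{-1}^*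 )$; $\omega\in\mathcal E_1$ is $Q$-closed iff $\omega(l_1(\tilde e))=0$ and $\omega(\{e_1,e_2\}_2)-\rho(e_1)[\omega(e_2)]+\rho(e_2)[\omega(e_1)]=0$ for all $\tilde e\in\Gamma(E_{-2})$, $e_1,e_2\in\Gamma(E_{-1})$; and $Q(f)(e)=-\rho(e)[f]$ for $f\in\mathcal O$. $H^1(E,Q)$ is the quotient of closed elements of degree 1 by $\{Q(f):f\in \mathcal O\}$. Divergences in the definition of the modular cocycle: $\mathrm{div}(Y)$ is the function with $[Y,X_1\wedge\cdots\wedge X_n]=\mathrm{div}(Y)\,X_1\wedge\cdots\wedge X_n$ (Lie derivative along $Y\in\mathfrak X(M)$), and $\mathrm{div}^{(i)}(e)$ is the function with $\sum_{k=1}^{a_i}e_1^{(i)}\wedge\cdots\wedge\{e,e_k^{(i)}\}_2\wedge\cdots\wedge e_{a_i}^{(i)}=\mathrm{div}^{(i)}(e)\,e_1^{(i)}\wedge\cdots\wedge e_{a_i}^{(i)}$. Modular class. Choose $TM$-connections on the $E_{-i}$, all denoted $\nabla$. The adjoint representation $\mathrm{ad}^\nabla$ of $(E,Q)$ is a representation (up to homotopy) on the complex $\cdots\to E_{-2}\xrightarrow{l_1}E_{-1}\xrightarrow{-\rho}TM$ ($TM$ in degree $0$) whose first Taylor coefficient, for $e\in\Gamma(E_{-1})$, is the degree $0$ operator $\mathrm{ad}_e(X)=[\rho(e),X]+\rho(\nabla_Xe)$ for $X\in\mathfrak X(M)$, $\mathrm{ad}_e(e')=\{e,e'\}_2+\nabla_{\rho(e')}e$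 for $e'\in\Gamma(E)$; only this enters what follows. For a graded bundle $V$ of finite rank, $\mathrm{Ber}(V)=\bigotimes_{i\text{ even}}\wedge^{\mathrm{top}}V_i\otimes\bigotimes_{i\text{ odd}}\wedge^{\mathrm{top}}V_i^*$. For nowhere vanishing local sections $\mu_i$ of $\wedge^{\mathrm{top}}V_i$, let $\mu$ be the tensor product of the $\mu_i$ ($i$ even) and the dual sections $\mu_i^*$ ($i$ odd). A representation with first Taylor coefficient $\nabla^{(1)}$ on $V$ induces on $\mathrm{Ber}(V)$ the flat action $\nabla^{\mathrm{Ber}}_e\mu=\big(\sum_i(-1)^i\mathrm{div}_{\mu_i}(\nabla^{(1)}_e)\big)\mu$, $e\in\Gamma(E_{-1})$, where $\sum_kv_1\wedge\cdots\wedge\nabla^{(1)}_ev_k\wedge\cdots\wedge v_d=\mathrm{div}_{\mu_i}(\nabla^{(1)}_e)\,v_1\wedge\cdots\wedge v_d$ if $v_1\wedge\cdots\wedge v_d=\mu_i$. For a rank-one representation $B$ with nowhere vanishing section $b$, put $\nabla^B_eb=\omega_b(e)b$; then $\omega_b$ is $Q$-closed and $[\omega_b]\in H^1(E,Q)$ is independent of $b$: it is the characteristic class of $B$ (if $B$ is not trivial, it is defined as one half of that of $B\otimes B$). The modular class of $(E,Q)$ is the characteristic class of $\mathrm{Ber}(E\oplus TM)$ for $\mathrm{ad}^\nabla$; it does not depend on $\nabla$. *)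

(* Defs.v *)
From HB Require Import structures.
From mathcomp Require Import all_boot all_order all_algebra all_fingroup.
From mathcomp Require Import all_classical all_reals all_analysis.
From Stdlib Require List.

Set Implicit Arguments.
Unset Strict Implicit.
Unset Printing Implicit Defensive.

Import Order.TTheory GRing.Theory Num.Theory numFieldNormedType.Exports.

Local Open Scope classical_set_scope.
Local Open Scope ring_scope.

(* [Ck k V f], for V open: f is k times differentiable on V, in the Frechet
   sense at each order. *)
Fixpoint Ck (R : realType) (n k : nat) (V : set 'rV[R]_n) (f : 'rV[R]_n -> R)
    : Prop :=
  match k with
  | 0 => forall x, V x -> {for x, continuous f}
  | k'.+1 => (forall x, V x -> differentiable f x) /\
             (forall v, Ck k' V (fun x => 'D_v f x))
  end.

Definition Cinf (R : realType) (n : nat) (V : set 'rV[R]_n)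
  (f : 'rV[R]_n -> R) : Prop := forall k, Ck k V f.

(* The maps [chart i] and [param i] are total; only their values on
   [chart_dom i] and on its image are meaningful. *)
Record manifold (R : realType) (n : nat) := Manifold {
  points :> topologicalType ;
  points_hausdorff : hausdorff_space points ;
  points_second_countable : @second_countable points ;
  chart_idx : Type ;
  chart_dom : chart_idx -> set points ;
  chart : chart_idx -> points -> 'rV[R]_n ;
  param : chart_idx -> 'rV[R]_n -> points ;
  chart_dom_open : forall i, open (chart_dom i) ;
  chart_cover : forall x, exists i, chart_dom i x ;
  chart_im_open : forall i, open (chart i @` chart_dom i) ;
  chartK : forall i x, chart_dom i x -> param i (chart i x) = x ;
  chart_continuous : forall i x, chart_dom i x -> {for x, continuous (chart i)} ;
  param_continuous : forall i y, (chart i @` chart_dom i) y ->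
    {for y, continuous (param i)} ;
  chart_transition : forall i j k,
    Cinf (chart i @` (chart_dom i `&` chart_dom j))
         (fun y => chart j (param i y) 0 k) }.

(* Functions, vector fields and sections over an open set U are represented by
   total maps of which only the values on U matter. *)
Definition smooth R n (M : manifold R n) (U : set M) (f : M -> R) : Prop :=
  forall i, Cinf (chart i @` (chart_dom i `&` U)) (f \o param i).

Definition smooth_at R n (M : manifold R n) (x : M) (f : M -> R) : Prop :=
  exists2 U : set M, open U /\ U x & smooth U f.

(* Derivations at x of the algebra of functions smooth near x.  The Leibniz
   rule forces v f to depend only on the germ of f at x; the last clause fixes
   the irrelevant values, so that equality is equality of derivations. *)
Definition derivation_at R n (M : manifold R n) (x : M) :
    set ((M -> R) -> R^o) :=
  [set v | [/\ forall (a : R) f g, smooth_at x f -> smooth_at x g ->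
                 v (fun y => a * f y + g y) = a * v f + v g,
               forall f g, smooth_at x f -> smooth_at x g ->
                 v (fun y => f y * g y) = f x * v g + g x * v f &
               forall f, ~ smooth_at x f -> v f = 0 ]].

Definition derivations R n (M : manifold R n) (x : M) :
  {pred ((M -> R) -> R^o)} := fun v => `[< derivation_at x v >].

Record tangent R n (M : manifold R n) (x : M) := Tangent {
  tangent_fun :> (M -> R) -> R^o ;
  tangentP : tangent_fun \in derivations x }.

Section tangent_lmodule.
Context (R : realType) (n : nat) (M : manifold R n) (x : M).

HB.instance Definition _ := [isSub of tangent x for @tangent_fun R n M x].
HB.instance Definition _ := [Choice of tangent x by <:].

Fact derivations_submod_closed :
  submod_closed (derivations x).
Proof.
split => [|a u v]; first by apply/asboolP; split=> *; rewrite /= ?mulr0 ?addr0.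
move=> /asboolP[u1 u2 u3] /asboolP[v1 v2 v3]; apply/asboolP; split=> [b f g sf sg|f g sf sg|f nf].
- change ((a *: u + v) (fun y => b * f y + g y)) with
    (a * u (fun y => b * f y + g y) + v (fun y => b * f y + g y)).
  change ((a *: u + v) f) with (a * u f + v f).
  change ((a *: u + v) g) with (a * u g + v g).
  rewrite u1// v1// !mulrDr !mulrA [a * b]mulrC -!addrA; congr (_ + _).
  by rewrite addrCA.
- change ((a *: u + v) (fun y => f y * g y)) with
    (a * u (fun y => f y * g y) + v (fun y => f y * g y)).
  change ((a *: u + v) f) with (a * u f + v f).
  change ((a *: u + v) g) with (a * u g + v g).
  rewrite u2// v2// !mulrDr !mulrA [a * f x]mulrC [a * g x]mulrC.
  by rewrite -!addrA; congr (_ + _); rewrite addrCA.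
- change ((a *: u + v) f) with (a * u f + v f).
  by rewrite u3// v3// mulr0 addr0.
Qed.

HB.instance Definition _ := GRing.isSubmodClosed.Build R ((M -> R) -> R^o)
  (derivations x) derivations_submod_closed.
HB.instance Definition _ := [SubChoice_isSubLmodule of tangent x by <:].

End tangent_lmodule.

(* What is common to TM and to the E_{-i}: fibres, a rank, and the notion of a
   section smooth on an open set. *)
Record bundle R n (M : manifold R n) := Bundle {
  rk : nat ;
  fib : M -> lmodType R ;
  smooth_sec : set M -> (forall x, fib x) -> Prop }.

Notation sec B := (forall x, fib B x).

Definition smooth_sec_at R n (M : manifold R n) (B : bundle M) (x : M)
    (s : sec B) : Prop :=
  exists2 U : set M, open U /\ U x & smooth_sec U s.

Definition TM R n (M : manifold R n) : bundle M := {|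
  rk := n ;
  fib := fun x => tangent x : lmodType R ;
  smooth_sec := fun U X => forall V f, open V -> V `<=` U -> smooth V f ->
    smooth V (fun x => X x f) |}.

(* A vector bundle is given by its fibres and an atlas of local
   trivialisations with smooth transition matrices. *)
Record vbundle R n (M : manifold R n) := VBundle {
  vb_rk : nat ;
  vb_fib : M -> lmodType R ;
  triv_idx : Type ;
  triv_dom : triv_idx -> set M ;
  triv : triv_idx -> forall x, vb_fib x -> 'rV[R]_vb_rk ;
  triv_dom_open : forall i, open (triv_dom i) ;
  triv_cover : forall x, exists i, triv_dom i x ;
  triv_linear : forall i x, triv_dom i x -> linear (@triv i x) ;
  triv_bij : forall i x, triv_dom i x -> bijective (@triv i x) ;
  triv_transition : forall i j, exists2 g : M -> 'M[R]_vb_rk,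
    forall a b, smooth (triv_dom i `&` triv_dom j) (fun x => g x a b) &
    forall x, triv_dom i x -> triv_dom j x ->
      forall v, @triv j x v = @triv i x v *m g x }.

Definition bundle_of_vbundle R n (M : manifold R n) (B : vbundle M) :
    bundle M := {|
  rk := vb_rk B ;
  fib := @vb_fib _ _ _ B ;
  smooth_sec := fun U s => forall i k,
    smooth (triv_dom i `&` U) (fun x => triv (v := B) i (s x) 0 k) |}.
Coercion bundle_of_vbundle : vbundle >-> bundle.

Definition is_basis (R : realType) (V : lmodType R) r (b : 'I_r -> V) : Prop :=
  forall v, exists! c : 'rV[R]_r, v = \sum_k c 0 k *: b k.

Definition frame R n (M : manifold R n) (B : bundle M) (U : set M)
    (s : 'I_(rk B) -> sec B) : Prop :=
  (forall k, smooth_sec U (s k)) /\ (forall x, U x -> is_basis (s^~ x)).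

(* The covariant derivative along a tangent vector at x of a section smooth
   near x. *)
Record connection R n (M : manifold R n) (B : vbundle M) := Connection {
  nab :> forall x : M, tangent x -> sec B -> fib B x ;
  nab_linear : forall x s, smooth_sec_at x s -> linear (fun v => @nab x v s) ;
  nab_additive : forall x v s t, smooth_sec_at x s -> smooth_sec_at x t ->
    @nab x v (fun y => s y + t y) = @nab x v s + @nab x v t ;
  nab_leibniz : forall x v f s, smooth_at x f -> smooth_sec_at x s ->
    @nab x v (fun y => f y *: s y) = f x *: @nab x v s + v f *: s x ;
  nab_smooth : forall U (X : sec (TM M)) s, open U ->
    smooth_sec U X -> smooth_sec U s ->
    smooth_sec U (fun x => @nab x (X x) s) }.

(* The commutator of the vector fields X and Y, as derivations. *)
Definition lie R n (M : manifold R n) (X Y : sec (TM M)) : sec (TM M) :=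
  fun x => xget (0 : tangent x) [set v : tangent x | forall f, smooth_at x f ->
    v f = X x (fun y => Y y f) - Y x (fun y => X y f)].

Record altform (R : realType) (V : lmodType R) (r : nat) := Altform {
  altfun :> ('I_r -> V) -> R ;
  alt_linear : forall v k a u w,
    altfun [eta v with k |-> a *: u + w] =
    a * altfun [eta v with k |-> u] + altfun [eta v with k |-> w] ;
  alt_alternate : forall v i j, i != j -> v i = v j -> altfun v = 0 }.

(* v_1 /\ ... /\ v_r, in the r-th exterior power of V seen inside the dual of
   the space of alternating forms. *)
Definition wedge (R : realType) (V : lmodType R) r (v : 'I_r -> V) :
  altform V r -> R^o := fun phi => phi v.

(* The number d with
     sum_k s_1 /\ ... /\ Ds_k /\ ... /\ s_r = d s_1 /\ ... /\ s_r. *)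
Definition divergence (R : realType) (V : lmodType R) r (s Ds : 'I_r -> V) :
    R :=
  xget 0 [set d : R |
    \sum_k wedge [eta s with k |-> Ds k] = d *: wedge s].

(* Here E i stands for E_{-(i+1)}, of degree -(i+1). *)
Section graded_sections.
Context (R : realType) (n : nat) (M : manifold R n) (E : nat -> vbundle M).

Definition gsec := forall i (x : M), fib (E i) x.

Definition gsmooth (U : set M) (u : gsec) : Prop :=
  forall i, smooth_sec (b := E i) U (u i).

(* u takes values in E_{-d}; E_0 = 0 *)
Definition homog (d : nat) (u : gsec) : Prop :=
  forall i, i.+1 != d -> forall x, u i x = 0.

Definition incl (i : nat) (s : sec (E i)) : gsec :=
  dfwith (T := fun j => sec (E j)) (fun j x => 0) i s.

Definition gcomb (f : M -> R) (u v : gsec) : gsec :=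
  fun i x => f x *: u i x + v i x.

Definition gscale (f : M -> R) (u : gsec) : gsec := fun i x => f x *: u i x.

End graded_sections.

Definition unshuffle (m i : nat) (s : 'S_m) : bool :=
  [forall a : 'I_m, forall b : 'I_m,
    ((a < b) && ((b < i) || (i <= a)))%N ==> (s a < s b)%N].

Definition koszul (R : realType) m (d : 'I_m -> nat) (s : 'S_m) : R :=
  \prod_(a < m) \prod_(b < m | ((a < b) && (s b < s a))%N)
    (-1) ^+ (d (s a) * d (s b)).

(* The bracket l_k is [brk] on lists of length k >= 1; the axioms only concern
   smooth arguments. *)
Record lie_inf R n (M : manifold R n) := LieInf {
  E : nat -> vbundle M ;
  depth : nat ;
  rk_depth : forall i, (depth <= i)%N -> rk (E i) = 0 ;
  anchor : forall x, fib (E 0) x -> tangent x ;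
  anchor_linear : forall x, linear (@anchor x) ;
  anchor_smooth : forall U (e : sec (E 0)), open U -> smooth_sec U e ->
    smooth_sec (b := TM M) U (fun x => anchor (e x)) ;
  brk : seq (gsec E) -> gsec E ;
  brk_smooth : forall us, List.Forall (gsmooth setT) us ->
    gsmooth setT (brk us) ;
  brk_degree : forall ds us, (0 < size us)%N ->
    List.Forall (gsmooth setT) us -> List.Forall2 (@homog _ _ _ E) ds us ->
    homog (sumn ds).-1 (brk us) ;
  brk_symmetric : forall s1 s2 u v p q,
    List.Forall (gsmooth setT) (s1 ++ u :: v :: s2) -> homog p u -> homog q v ->
    brk (s1 ++ u :: v :: s2) =
    gscale (fun=> (-1) ^+ (p * q)) (brk (s1 ++ v :: u :: s2)) ;
  brk_linear : forall s1 s2 (a : R) u v,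
    List.Forall (gsmooth setT) (s1 ++ u :: v :: s2) ->
    brk (s1 ++ gcomb (fun=> a) u v :: s2) =
    gcomb (fun=> a) (brk (s1 ++ u :: s2)) (brk (s1 ++ v :: s2)) ;
  brk_Olinear : forall s1 s2 f u, (size s1 + size s2 != 1)%N -> smooth setT f ->
    List.Forall (gsmooth setT) (s1 ++ u :: s2) ->
    brk (s1 ++ gscale f u :: s2) = gscale f (brk (s1 ++ u :: s2)) ;
  (* [anchor (u 0 x)] is the anchor of u, extended by 0 to E_{-i}, i >= 2 *)
  brk_leibniz : forall f u v, smooth setT f ->
    gsmooth setT u -> gsmooth setT v ->
    brk [:: u; gscale f v] =
    gcomb f (brk [:: u; v]) (gscale (fun x => anchor (u 0%N x) f) v) ;
  brk_jacobi : forall m (x : 'I_m -> gsec E) (d : 'I_m -> nat), (0 < m)%N ->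
    (forall a, gsmooth setT (x a)) -> (forall a, homog (d a) (x a)) ->
    forall k (y : M),
    \sum_(i < m.+1 | (0 < i)%N) \sum_(s : 'S_m | unshuffle i s)
      koszul R d s *:
      brk (brk [seq x (s a) | a : 'I_m <- enum 'I_m & (a < i)%N]
           :: [seq x (s a) | a : 'I_m <- enum 'I_m & (i <= a)%N]) k y = 0 }.

Section modular.
Context (R : realType) (n : nat) (M : manifold R n) (A : lie_inf M).

Definition rho (e : sec (E A 0)) : sec (TM M) := fun x => anchor (e x).

(* The brackets of the restriction of (E,Q) to open subsets: the value at x on
   sections defined near x is that on global sections with the same germs. *)
Definition lbrk (us : seq (gsec (E A))) : gsec (E A) := fun i x =>
  xget (0 : fib (E A i) x) [set v | exists2 ts : seq (gsec (E A)),
    List.Forall2 (fun t u => gsmooth setT t /\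
      \forall y \near x, forall j, t j y = u j y) ts us &
    v = brk ts i x].

Definition l1 i (s : sec (E A i.+1)) : sec (E A i) :=
  lbrk [:: incl s] i.

Definition br2 i (e : sec (E A 0)) (s : sec (E A i)) : sec (E A i) :=
  lbrk [:: incl e; incl s] i.

Definition form1 := forall x : M, fib (E A 0) x -> R.

Definition is_form1 (U : set M) (w : form1) : Prop :=
  (forall x, U x -> forall a u v, w x (a *: u + v) = a * w x u + w x v) /\
  (forall V (e : sec (E A 0)), open V -> V `<=` U -> smooth_sec V e ->
     smooth V (fun x => w x (e x))).

Definition Qclosed (U : set M) (w : form1) : Prop :=
  (forall e : sec (E A 1), smooth_sec U e ->
     forall x, U x -> w x (l1 e x) = 0) /\
  (forall e1 e2 : sec (E A 0), smooth_sec U e1 -> smooth_sec U e2 ->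
     forall x, U x ->
     w x (br2 e1 e2 x) - rho e1 x (fun y => w y (e2 y))
                       + rho e2 x (fun y => w y (e1 y)) = 0).

Definition Q0 (f : M -> R) : form1 := fun x v => - anchor v f.

(* w and w' are cocycles over U with the same class in H^1(E|_U, Q) *)
Definition same_class (U : set M) (w w' : form1) : Prop :=
  [/\ is_form1 U w /\ Qclosed U w, is_form1 U w' /\ Qclosed U w' &
      exists2 f, smooth U f &
        forall x, U x -> forall v, w x v = w' x v + Q0 f v].

(* The component of degree -i of E + TM. *)
Definition comp (i : nat) : bundle M :=
  match i with 0 => TM M | j.+1 => E A j end.

Definition ad (nabla : forall i, connection (E A i)) (e : sec (E A 0)) (i : nat) :
    sec (comp i) -> sec (comp i) :=
  match i with
  | 0 => fun X x => lie (rho e) X x + anchor (nabla 0%N x (X x) e)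
  | 1 => fun s x => br2 e s x + nabla 0%N x (anchor (s x)) e
  | j.+2 => fun s x => br2 e s x
  end.

Definition bases (x : M) := forall i, 'I_(rk (comp i)) -> fib (comp i) x.

(* Bases of all the components at x give a generator mu of the p-th tensor
   power of Ber(E + TM) at x; an element c mu of that line is represented by
   the function associating to the bases the coordinate c.  Changing bases by
   matrices P_i multiplies mu by (prod_i det(P_i)^{(-1)^i})^p. *)
Definition ber_section (p : nat) (b : forall x, bases x -> R) : Prop :=
  forall x (beta beta' : bases x) (P : forall i, 'M[R]_(rk (comp i))),
    (forall i, is_basis (beta i)) -> (forall i, is_basis (beta' i)) ->
    (forall i k, beta' i k = \sum_j P i j k *: beta i j) ->
    b x beta =
    (\prod_(i < (depth A).+1)
       (if odd i then (\det (P i))^-1 else \det (P i))) ^+ p * b x beta'.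

Definition frames := forall i, 'I_(rk (comp i)) -> sec (comp i).

Definition is_frames (U : set M) (F : frames) : Prop :=
  forall i, frame (B := comp i) U (F i).

Definition frames_at (F : frames) (x : M) : bases x := fun i k => F i k x.

Definition ber_generator (p : nat) (b : forall x, bases x -> R) : Prop :=
  [/\ ber_section p b,
      forall x (beta : bases x), (forall i, is_basis (beta i)) ->
        b x beta != 0 &
      forall V F, open V -> is_frames V F ->
        smooth V (fun x => b x (frames_at F x))].

(* The coordinate at x, in the frames F, of nabla^Ber_e b, extended to the
   p-th tensor power. *)
Definition nabla_ber (nabla : forall i, connection (E A i)) (p : nat)
    (F : frames) (e : sec (E A 0)) (b : forall x, bases x -> R) (x : M) : R :=
  rho e x (fun y => b y (frames_at F y)) +
  p%:R * (\sum_(i < (depth A).+1) (-1) ^+ i *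
    divergence (fun k => F i k x) (fun k => ad nabla e (F i k) x)) *
  b x (frames_at F x).

(* nabla^Ber_e b = w(e) b *)
Definition ber_form (nabla : forall i, connection (E A i)) (p : nat)
    (b : forall x, bases x -> R) (w : form1) : Prop :=
  forall V F e, open V -> is_frames V F -> smooth_sec V e ->
    forall x, V x ->
      nabla_ber nabla p F e b x = w x (e x) * b x (frames_at F x).

(* The modular class, as the set of the cocycles that represent it. *)
Definition modular_class (nabla : forall i, connection (E A i)) : set form1 :=
  [set eta |
    if `[< exists b, ber_generator 1 b >] then
      exists b w, [/\ ber_generator 1 b, ber_form nabla 1 b w &
                      same_class setT eta w]
    else
      exists b w, [/\ ber_generator 2 b, ber_form nabla 2 b w &
                      same_class setT eta (fun x v => 2^-1 * w x v)]].

Definition modular_function (F : frames) (e : sec (E A 0)) (x : M) : R :=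
  divergence (fun k => F 0%N k x) (fun k => lie (rho e) (F 0%N k) x) +
  \sum_(i < depth A) (-1) ^+ i.+1 *
    divergence (fun k => F i.+1 k x) (fun k => br2 e (F i.+1 k) x).

Definition modular_cocycle (U : set M) (F : frames) (w : form1) : Prop :=
  is_form1 U w /\
  forall e : sec (E A 0), smooth_sec U e ->
    forall x, U x -> w x (e x) = modular_function F e x.

End modular.

(* Main.v *)
(* Because O-bilinearity holds up to the anchor, the divergence of
   [e, -] on each E_{-i} and of [rho e, -] on TM is of first order in e; the
   first-order terms of TM and of E_{-1} cancel in the alternating sum, so that
   w is O-linear.  It is closed since, by the Jacobi identities of arities two
   and three, the action of l1 e is the supercommutator of l1 with l2(e, -), and
   that of [e1, e2] is the commutator of the actions of e1 and e2 up to the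
   supercommutator of l1 with l3(e1, e2, -): supertraces of supercommutators
   vanish.  In ad^nabla, the connection contributes the traces of
   X |-> rho (nabla_X e) on TM and of e' |-> nabla_{rho e'} e on E_{-1}, which
   are those of two composites AB and BA and cancel as well.  Hence the form of
   a generator b of the p-th power of the Berezinian is p w + d log |b(F)|.
   The brackets of local sections are those of global extensions, built with
   bump functions; everything else is computed on germs at a point. *)
Require Import Defs.
From HB Require Import structures.
From mathcomp Require Import all_boot all_order all_algebra all_fingroup.
From mathcomp Require Import all_classical all_reals all_analysis.
From mathcomp Require Import ring lra.
(* Again, because mathcomp shadows names such as [comp]. *)
Require Import Defs.

Set Implicit Arguments.
Unset Strict Implicit.
Unset Printing Implicit Defensive.

Import Order.TTheory GRing.Theory Num.Theory numFieldNormedType.Exports.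

Local Open Scope classical_set_scope.
Local Open Scope ring_scope.

(** * Differentiability classes on R^n *)

(** The bracket axioms speak only of globally smooth arguments, whereas a divergence involves frames
    that exist only over [U]; hence the local brackets, whose independence of the chosen extension
    has to be extracted from O-linearity and the Leibniz rule. For a derivation or a first-order
    operator at a point, a discontinuous indicator function replaces the bump function. That [rho]
    kills the image of [l1] and sends brackets to commutators is not among the axioms: both facts
    are read off by computing the symbol of one operator on E_{-1} in two ways, the case E_{-1} = 0
    being treated apart. Tangent vectors are abstract derivations. Instead of Hadamard's lemma, the
    n-element basis provided by the frame of TM shows that the n chart derivatives span, whence the
    chain rule for the logarithm. The Berezinian may have no global generator, which is why a power
    p, equal to 1 or 2, is carried along; the sign of b(F) may vary over [U], so log |b(F)| is
    written as half the logarithm of the square. *)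

Section Ck.
Context (R : realType) (n : nat).
Implicit Types (V W : set 'rV[R]_n) (f g : 'rV[R]_n -> R) (k : nat).

(** The difference [g - f] vanishes near [x], so the zero map is its differential there, and [g] is
    a sum of two differentiable functions. *)
Lemma differentiable_near f g (x : 'rV[R]_n) :
  (\forall y \near x, f y = g y) -> differentiable f x -> differentiable g x.
Proof.
move=> fg df; have -> : g = f + (g - f) by rewrite addrC subrK.
apply: differentiableD => //; set z := g - f.
have z0 : \forall y \near x, z y = 0.
  by apply: filterS fg => y fgy; rewrite /z -[LHS]/(g y - f y) fgy subrr.
have zE : z \o shift x = cst (z x) + \0 +o_ (0 : 'rV[R]_n) id.
  apply/eqaddoP => _/posnumP[e].
  have zy : \forall h \near (0 : 'rV[R]_n), z (h + x) = 0.
    by have := z0; rewrite (near_shift (0 : 'rV[R]_n)) subr0.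
  apply: filterS zy => h zh.
  by rewrite !fctE /= zh (nbhs_singleton z0) /= addr0 subrr normr0 mulr_ge0.
have dz := @diff_unique _ _ _ z (\0 : {linear _ -> _}) x (@cst_continuous _ _ 0) zE.
by apply/diff_locallyP; rewrite dz; split=> //; exact: cst_continuous.
Qed.

Lemma Ck_eq k V f g : open V -> (forall x, V x -> f x = g x) ->
  Ck k V f -> Ck k V g.
Proof.
move=> oV; elim: k f g => [|k IH] f g fg /=.
  move=> cf x Vx; have fgx : \forall y \near x, f y = g y.
    by apply: filterS (open_nbhs_nbhs (conj oV Vx)) => y /fg.
  have := cf x Vx; rewrite /prop_for /continuous_at (fg x Vx); apply: cvg_trans.
  exact: near_eq_cvg fgx.
have fgx x : V x -> \forall y \near x, f y = g y.
  by move=> Vx; apply: filterS (open_nbhs_nbhs (conj oV Vx)) => y /fg.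
move=> [df Df]; split=> [x Vx|v]; first exact: differentiable_near (fgx x Vx) (df x Vx).
by apply: IH (Df v) => x /fgx; apply: near_eq_derive.
Qed.

Lemma Ck_sub k V W f : W `<=` V -> Ck k V f -> Ck k W f.
Proof.
move=> WV; elim: k f => [|k IH] f /=; first by move=> h x /WV/h.
by move=> [df Df]; split=> [x /WV/df//|v]; apply: IH.
Qed.

(** Each clause of [Ck] is a condition at single points on a function defined on all of R^n. This is
    what later makes smoothness on a manifold a local property. *)
Lemma Ck_pointwise k V f : (forall x, V x -> Ck k [set x] f) -> Ck k V f.
Proof.
elim: k f => [|k IH] f /= h; first by move=> x /h; apply.
split=> [x /h[+ _]|v]; first exact.
by apply: IH => x /h[].
Qed.

Lemma CkW k V f : Ck k.+1 V f -> Ck k V f.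
Proof.
elim: k f => [|k IH] f /= [df Df].
  by move=> x /df; apply: differentiable_continuous.
by split=> // v; apply/IH/Df.
Qed.

Lemma Ck_cst k V (c : R) : Ck k V (fun=> c).
Proof.
elim: k c => [|k IH] c /=; first by move=> x _; exact: cst_continuous.
split=> [x _|v]; first exact: (@differentiable_cst _ _ _ c x).
by have -> : (fun x => 'D_v (fun=> c) x) = (fun=> 0) by apply/funext => x; rewrite derive_cst.
Qed.

Lemma Ck_add k V f g : open V -> Ck k V f -> Ck k V g ->
  Ck k V (fun x => f x + g x).
Proof.
move=> oV; elim: k f g => [|k IH] f g /=.
  by move=> cf cg x Vx; exact: cvgD (cf x Vx) (cg x Vx).
move=> [df Df] [dg Dg]; split=> [x Vx|v].
  by apply: differentiableD; [exact: df|exact: dg].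
apply: Ck_eq (IH _ _ (Df v) (Dg v)) => // x Vx.
by rewrite -deriveD//; apply: diff_derivable; [exact: df|exact: dg].
Qed.

Lemma Ck_mul k V f g : open V -> Ck k V f -> Ck k V g ->
  Ck k V (fun x => f x * g x).
Proof.
move=> oV; elim: k f g => [|k IH] f g cf cg.
  by move=> x Vx; exact: cvgM (cf x Vx) (cg x Vx).
have [[df Df] [dg Dg]] := (cf, cg).
split=> [x Vx|v].
  by apply: differentiableM; [exact: df|exact: dg].
apply: (@Ck_eq _ _ (fun x => f x * 'D_v g x + g x * 'D_v f x)) => //.
  move=> x Vx.
  by rewrite -[LHS]deriveM//; apply: diff_derivable; [exact: df|exact: dg].
by apply: Ck_add => //; [apply: IH (CkW cf) (Dg v)|apply: IH (CkW cg) (Df v)].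
Qed.

Lemma Ck_inv k V f : open V -> (forall x, V x -> f x != 0) -> Ck k V f ->
  Ck k V (fun x => (f x)^-1).
Proof.
move=> oV f0; elim: k => [|k IH] cf.
  by move=> x Vx; exact: cvgV (f0 x Vx) (cf x Vx).
have [df Df] := cf; have cV := IH (CkW cf).
split=> [x Vx|v].
  by apply: differentiableV; [exact: df|exact: f0].
apply: (@Ck_eq _ _ (fun x => - 1 * ('D_v f x * ((f x)^-1 * (f x)^-1)))) => //.
  move=> x Vx.
  rewrite [RHS]deriveV//; [|exact: f0|by apply: diff_derivable; exact: df].
  rewrite -exprVn expr2 mulN1r scaleNr; congr (- _); exact: mulrC.
by do !apply: Ck_mul => //; [exact: Ck_cst|exact: Df].
Qed.

(* For instance, h m t = t^-m exp (-1/t), continued by 0. *)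
Lemma Ck_comp k V f (h : nat -> R -> R) (c : nat -> R) (d : nat -> R) : open V ->
  (forall m (t : R), is_derive t 1 (h m) (c m * h m.+1 t + d m * h m.+2 t)) ->
  Ck k V f -> forall m, Ck k V (fun x => h m (f x)).
Proof.
move=> oV dh; elim: k => [|k IH] cf m.
  move=> x Vx; apply: (@continuous_comp _ _ _ f (h m)); first exact: cf.
  by apply: differentiable_continuous; apply/derivable1_diffP; apply: ex_derive.
have [df Df] := cf; have cV := IH (CkW cf).
have dhd t m' : differentiable (h m') t.
  by apply/derivable1_diffP; apply: ex_derive.
split=> [x Vx|v].
  by apply: (@differentiable_comp _ _ _ _ f (h m)); [exact: df|exact: dhd].
(* The chain rule stays within the family [h], at indices [m.+1] and [m.+2], so the induction on [k]
   runs for all [m] at once. *)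
apply: (@Ck_eq _ _ (fun x => 'D_v f x * (c m * h m.+1 (f x) + d m * h m.+2 (f x)))) => //.
  move=> x Vx; rewrite [RHS]deriveE//; last first.
    by apply: (@differentiable_comp _ _ _ _ f (h m)); [exact: df|exact: dhd].
  rewrite [in RHS](@diff_comp _ _ _ _ f (h m))//=; last exact: df.
  rewrite diff1E// -deriveE; last exact: df.
  by rewrite derive1E (@derive_val _ _ _ _ _ _ _ (dh m (f x))).
apply: Ck_mul => //; first exact: Df.
apply: Ck_add => //; apply: Ck_mul => //; exact: Ck_cst.
Qed.

Lemma differentiable_ln (t : R) : 0 < t -> differentiable (@ln R) t.
Proof. by move=> t0; apply/derivable1_diffP; have [] := is_derive1_ln t0. Qed.

Lemma derive_ln f x v : 0 < f x -> differentiable f x ->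
  'D_v (fun y => ln (f y)) x = 'D_v f x * (f x)^-1.
Proof.
move=> f0 df; rewrite deriveE; last exact: (@differentiable_comp _ _ _ _ f (@ln R) _ df (differentiable_ln f0)).
rewrite (@diff_comp _ _ _ _ f (@ln R))//=; last exact: differentiable_ln.
rewrite diff1E; last exact: differentiable_ln.
by rewrite -deriveE// derive1E (@derive_val _ _ _ _ _ _ _ (is_derive1_ln f0)).
Qed.

(** The first derivative f'/f already falls under [Ck_inv], so a case split on [k] takes the place
    of an induction. *)
Lemma Ck_ln k V f : open V -> (forall x, V x -> 0 < f x) -> Ck k V f ->
  Ck k V (fun x => ln (f x)).
Proof.
move=> oV f0; case: k => [|k] cf.
  move=> x Vx; apply: (@continuous_comp _ _ _ f (@ln R)); first exact: cf.
  exact/continuous_ln/f0.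
have [df Df] := cf; split=> [x Vx|v].
  by apply: (@differentiable_comp _ _ _ _ f (@ln R)); [exact: df|exact/differentiable_ln/f0].
apply: (@Ck_eq _ _ (fun x => 'D_v f x * (f x)^-1)) => //.
  by move=> x Vx; rewrite [RHS]derive_ln//; [exact: f0|exact: df].
apply: Ck_mul => //; first exact: Df.
apply: Ck_inv => //; last exact: CkW.
by move=> x /f0; rewrite lt0r => /andP[].
Qed.

End Ck.

(** * A flat function on the real line *)

Section flat.
Context (R : realType).
Implicit Types (t : R) (m : nat).

(** For [m = 0], the classical exp(-1/t); the powers of 1/t are those that its successive
    derivatives bring in. *)
Definition flat m t : R := if 0 < t then t^-1 ^+ m * expR (- t^-1) else 0.

Lemma flat_gt0 m t : 0 < t -> 0 < flat m t.
Proof. by move=> t0; rewrite /flat t0 mulr_gt0 ?expR_gt0// exprn_gt0// invr_gt0. Qed.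

Lemma flat_ge0 m t : 0 <= flat m t.
Proof.
rewrite /flat; case: ifPn => // t0.
by rewrite mulr_ge0 ?expR_ge0// exprn_ge0// invr_ge0 ltW.
Qed.

Lemma flat_eq0 m t : t <= 0 -> flat m t = 0.
Proof. by rewrite /flat ltNge => ->. Qed.

(** With u = 1/t this reads u^(m+1) <= (m+1)! e^u, which keeps one term of the exponential
    series. *)
Lemma flat_le m t : `|flat m t| <= (m.+1)`!%:R * `|t|.
Proof.
have [t0|t0] := leP t 0; first by rewrite flat_eq0// normr0 mulr_ge0.
rewrite ger0_norm ?flat_ge0// gtr0_norm// /flat t0 expRN.
have u0 : 0 < t^-1 by rewrite invr_gt0.
rewrite ler_pdivrMr ?expR_gt0//.
have := expR_ge1Dxn m (ltW u0); set u := t^-1 => eu.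
have -> : t = u^-1 by rewrite /u invrK.
rewrite mulrAC ler_pdivlMr// -exprSr.
rewrite -ler_pdivrMl ?ltr0n ?fact_gt0// mulrC.
by apply: le_trans eu; rewrite lerDr.
Qed.

Lemma flatM m t : t^-1 * flat m t = flat m.+1 t.
Proof. by rewrite /flat; case: ifP => _; rewrite ?mulr0// mulrA -exprS. Qed.

Global Instance is_derive_flat m t :
  is_derive t 1 (flat m) (- m%:R * flat m.+1 t + flat m.+2 t).
Proof.
have [t0|t0|->] := ltgtP t 0.
- rewrite !flat_eq0 ?ltW// mulr0 addr0.
  apply: (@near_eq_is_derive _ _ _ (fun=> 0)).
    by apply: filterS (lt_nbhsl t0) => s s0; rewrite flat_eq0// ltW.
- have tN0 : t != 0 by rewrite gt_eqF.
  pose h (s : R) := s^-1 ^+ m * expR (- s^-1).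
  apply: (@near_eq_is_derive _ _ _ h).
    by apply: filterS (lt_nbhsr t0) => s s0; rewrite /flat /h s0.
  have di : is_derive t 1 (fun s : R => s^-1) (- t ^- 2).
    have := @is_deriveV _ id t 1 1 tN0 (@is_derive_id _ _ t 1).
    by rewrite /= [_ *: _]mulr1.
  have dX := @is_deriveX _ _ (fun s : R => s^-1) m t 1 _ di.
  have dE := @is_derive1_comp R expR (fun s => - s^-1) t _ _ (is_derive_expR _) (is_deriveN di).
  have dM := is_deriveM dX dE.
  have -> : h = (fun s : R => s^-1) ^+ m * (expR \o (fun s => - s^-1)) by apply/funext => s; rewrite /h fctE /= exprfctE.
  suff <- : ([eta GRing.inv] ^+ m) t *: (expR (- t^-1) * - - t ^- 2) + (expR \o (fun s : R => - s^-1)) t *: ((m%:R * t^-1 ^+ m.-1) *: - t ^- 2) = - m%:R * flat m.+1 t + flat m.+2 t by exact: dM.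
  rewrite /flat t0 /= exprfctE opprK; set e := expR _.
  rewrite -exprVn; set u := t^-1; rewrite -/(u * _); change (u ^+ m * (e * u ^+ 2) + e * (m%:R * u ^+ m.-1 * - u ^+ 2) = - m%:R * (u ^+ m.+1 * e) + u ^+ m.+2 * e).
  by case: m {dX h dM} => [|m]; rewrite /= ?exprS; ring.
- rewrite !flat_eq0// mulr0 addr0.
  suff h0 : (fun h : R => h^-1 *: ((flat m \o shift 0) (h *: 1) - flat m 0)) @ 0^' --> (0 : R).
    by split; [apply/cvg_ex; exists 0|exact: cvg_lim].
  rewrite flat_eq0//; apply/cvgr0Pnorm_le => e e0.
  (* The difference quotient at 0 is [flat m.+1 h] itself, which [flat_le] bounds by (m+2)! |h|. *)
  near=> h; have -> : h^-1 *: ((flat m \o shift 0) (h *: 1) - 0) = flat m.+1 h.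
    by rewrite /= subr0 addr0 [_ *: 1]mulr1 -flatM.
  apply: le_trans (flat_le _ _) _; rewrite -ler_pdivlMl ?ltr0n ?fact_gt0//.
  near: h; apply: nbhs_dnbhs; apply: (@nbhs0_le R R ((m.+2)`!%:R^-1 * e)).
  by rewrite mulr_gt0// invr_gt0 ltr0n fact_gt0.
Unshelve. all: by end_near. Qed.

End flat.

(** * Smooth functions on a manifold *)

Lemma Ck_flat (R : realType) n k (V : set 'rV[R]_n) (f : 'rV[R]_n -> R) m :
  open V -> Ck k V f -> Ck k V (fun x => flat m (f x)).
Proof.
move=> oV cf; apply: (@Ck_comp _ _ _ _ _ (@flat R) (fun m => - m%:R) (fun=> 1)) cf m => //.
by move=> m t; rewrite mul1r; apply: is_derive_flat.
Qed.

Section smooth.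
Context (R : realType) (n : nat) (M : manifold R n).
Implicit Types (U V W : set M) (f g : M -> R) (x y : M).

Lemma nbhs_open U x : open U -> U x -> nbhs x U.
Proof. by move=> oU Ux; apply: open_nbhs_nbhs. Qed.

Lemma chart_image_open (i : chart_idx M) U : open U -> open (chart i @` (chart_dom i `&` U)).
Proof.
move=> oU; rewrite openE => _ [x [dx Ux] <-].
have cx : (chart i @` chart_dom i) (chart i x) by exists x.
have h1 : nbhs (chart i x) (chart i @` chart_dom i).
  by apply: open_nbhs_nbhs; split=> //; exact: chart_im_open.
have h2 : nbhs (chart i x) (param i @^-1` U).
  by apply: (param_continuous cx); rewrite chartK//; exact: nbhs_open.
apply: filterS2 h1 h2 => _ [z dz <-] /=; rewrite chartK// => Uz.
by exists z.
Qed.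

Lemma smooth_eq U f g : open U -> (forall x, U x -> f x = g x) ->
  smooth U f -> smooth U g.
Proof.
move=> oU fg sf i k; apply: Ck_eq (sf i k); first exact: chart_image_open.
by move=> _ [x [dx Ux] <-] /=; rewrite chartK// fg.
Qed.

Lemma smooth_sub U V f : V `<=` U -> smooth U f -> smooth V f.
Proof.
move=> VU sf i k; apply: Ck_sub (sf i k) => _ [x [dx Vx] <-].
by exists x => //; split=> //; exact: VU.
Qed.

Lemma smooth_local U f : (forall x, U x -> exists2 W, W x & smooth W f) ->
  smooth U f.
Proof.
move=> h i k; apply: Ck_pointwise => _ [x [dx Ux] <-].
have [W Wx sf] := h _ Ux; apply: Ck_sub (sf i k) => _ ->.
by exists x.
Qed.

Lemma smooth_cst U (c : R) : smooth U (fun=> c).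
Proof. by move=> i k; apply: Ck_cst. Qed.

Lemma smooth_add U f g : open U -> smooth U f -> smooth U g ->
  smooth U (fun x => f x + g x).
Proof.
move=> oU sf sg i k; apply: (@Ck_add _ _ _ _ (f \o param i) (g \o param i)) => //.
- exact: chart_image_open.
- exact: sf.
- exact: sg.
Qed.

Lemma smooth_mul U f g : open U -> smooth U f -> smooth U g ->
  smooth U (fun x => f x * g x).
Proof.
move=> oU sf sg i k; apply: (@Ck_mul _ _ _ _ (f \o param i) (g \o param i)) => //.
- exact: chart_image_open.
- exact: sf.
- exact: sg.
Qed.

Lemma smooth_inv U f : open U -> (forall x, U x -> f x != 0) -> smooth U f ->
  smooth U (fun x => (f x)^-1).
Proof.
move=> oU f0 sf i k; apply: (@Ck_inv _ _ _ _ (f \o param i)) => //.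
- exact: chart_image_open.
- by move=> _ [x [dx Ux] <-] /=; rewrite chartK//; exact: f0.
- exact: sf.
Qed.

Lemma smooth_ln U f : open U -> (forall x, U x -> 0 < f x) -> smooth U f ->
  smooth U (fun x => ln (f x)).
Proof.
move=> oU f0 sf i k; apply: (@Ck_ln _ _ _ _ (f \o param i)) => //.
- exact: chart_image_open.
- by move=> _ [x [dx Ux] <-] /=; rewrite chartK//; exact: f0.
- exact: sf.
Qed.

Lemma smooth_flat m U f : open U -> smooth U f ->
  smooth U (fun x => flat m (f x)).
Proof.
move=> oU sf i k; apply: (@Ck_flat _ _ _ _ (f \o param i)) => //.
- exact: chart_image_open.
- exact: sf.
Qed.

Lemma smooth_sum (I : finType) (P : pred I) U (F : I -> M -> R) : open U ->
  (forall i, P i -> smooth U (F i)) -> smooth U (fun x => \sum_(i | P i) F i x).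
Proof.
move=> oU sF; elim: (index_enum I) => [|i r IH].
  by apply: smooth_eq (smooth_cst U 0) => // x _; rewrite big_nil.
have [Pi|Pi] := boolP (P i).
  by apply: smooth_eq (smooth_add oU (sF i Pi) IH) => // x _; rewrite big_cons Pi.
by apply: smooth_eq IH => // x _; rewrite big_cons (negbTE Pi).
Qed.

Lemma smooth_prod (I : finType) (P : pred I) U (F : I -> M -> R) : open U ->
  (forall i, P i -> smooth U (F i)) -> smooth U (fun x => \prod_(i | P i) F i x).
Proof.
move=> oU sF; elim: (index_enum I) => [|i r IH].
  by apply: smooth_eq (smooth_cst U 1) => // x _; rewrite big_nil.
have [Pi|Pi] := boolP (P i).
  by apply: smooth_eq (smooth_mul oU (sF i Pi) IH) => // x _; rewrite big_cons Pi.
by apply: smooth_eq IH => // x _; rewrite big_cons (negbTE Pi).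
Qed.

Lemma smooth_det U m (A : M -> 'M[R]_m) : open U ->
  (forall a b, smooth U (fun x => A x a b)) -> smooth U (fun x => \det (A x)).
Proof.
move=> oU sA; apply: smooth_sum => // s _; apply: smooth_mul => //.
  exact: smooth_cst.
exact: smooth_prod.
Qed.

Lemma smooth_adj U m (A : M -> 'M[R]_m) a b : open U ->
  (forall a b, smooth U (fun x => A x a b)) -> smooth U (fun x => (\adj (A x)) a b).
Proof.
move=> oU sA.
have -> : (fun x => (\adj (A x)) a b) =
    (fun x => (-1) ^+ (b + a) * \det (row' b (col' a (A x)))).
  by apply/funext => x; rewrite mxE.
apply: smooth_mul => //; first exact: smooth_cst.
apply: smooth_det => // c d.
by apply: smooth_eq (sA (lift b c) (lift a d)) => // x _; rewrite !mxE.
Qed.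

Lemma smooth_coord (i : chart_idx M) k :
  smooth (chart_dom i) (fun x => chart i x 0 k).
Proof. by move=> j; exact: chart_transition. Qed.

Lemma smooth_continuous U f x : open U -> U x -> smooth U f ->
  {for x, continuous f}.
Proof.
move=> oU Ux sf; have [i dx] := chart_cover x.
have cx : {for chart i x, continuous (f \o param i)} by apply: (sf i 0); exists x.
have := continuous_comp (chart_continuous dx) cx.
rewrite /prop_for /continuous_at /= chartK//.
apply: cvg_trans; apply: near_eq_cvg.
by apply: filterS (nbhs_open (@chart_dom_open _ _ M i) dx) => y dy /=; rewrite chartK.
Qed.

(** The last clause says that the closed support lies in [U], in the form in which a product with
    [phi] is glued to 0. *)
Lemma bump x U : open U -> U x -> exists phi : M -> R, [/\ smooth setT phi,
  \forall y \near x, phi y = 1 &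
  forall y, U y \/ \forall z \near y, phi z = 0].
Proof.
move=> oU Ux; have [i dx] := chart_cover x.
set a := chart i x; set W := chart i @` (chart_dom i `&` U).
have Wa : nbhs a W.
  by apply: open_nbhs_nbhs; split; [exact: chart_image_open|exists x].
have [e /= e0 eW] := (nbhs_ballP _ _).1 Wa.
pose B := closed_ball a (e / 2).
have e20 : 0 < e / 2 by rewrite divr_gt0.
have BW : B `<=` W.
  apply: subset_trans eW; apply: closed_ball_subset => //.
  by rewrite ltr_pdivrMr// ltr_pMr// ltr1n.
have cB : compact B.
  apply: bounded_closed_compact; last exact: closed_ball_closed.
  exists (`|a| + e / 2); split; first exact: num_real.
  move=> N ltN y; rewrite /B closed_ballE// /closed_ball_/= => aey.
  rewrite ltW//; apply: le_lt_trans ltN.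
  by rewrite -lerBlDl (le_trans _ aey)// (le_trans (lerB_dist _ _))// distrC.
(* [K] is compact, hence closed as [M] is Hausdorff: the complement of [K] is then an open set on
   which [phi] is 0, and it covers what lies outside the chart. *)
pose K := param i @` B.
have cK : closed K.
  apply: compact_closed; first exact: points_hausdorff.
  apply: continuous_compact cB; apply: continuous_in_subspaceT => y.
  rewrite inE => /BW[z [dz _] <-]; apply: param_continuous; by exists z.
have KU : K `<=` chart_dom i `&` U.
  by move=> _ [y /BW[z [dz Uz] <-] <-]; rewrite chartK.
(* [q] is the squared Euclidean distance to [a] in the chart. [psi] is 1 where q <= r/4 and 0 where
   q >= r; its denominator is positive because u + v = 3r/4 > 0. *)
pose q (y : M) := \sum_k (chart i y 0 k - a 0 k) ^+ 2.
pose r := (e / 2) ^+ 2.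
pose u y := r - q y; pose v y := q y - r / 4.
pose psi y := flat 0 (u y) / (flat 0 (u y) + flat 0 (v y)).
pose phi (y : M) := if pselect (chart_dom i y) then psi y else 0.
have r0 : 0 < r by rewrite exprn_gt0.
have d0 y : flat 0 (u y) + flat 0 (v y) != 0.
  rewrite gt_eqF//; have [u0|u0] := ltP 0 (u y).
    by rewrite ltr_pwDl ?flat_gt0 ?flat_ge0.
  rewrite ltr_wpDl ?flat_ge0// flat_gt0//.
  by move: u0; rewrite /u /v; lra.
have oD := @chart_dom_open _ _ M i.
have sq : smooth (chart_dom i) q.
  apply: smooth_sum => // k _; apply: smooth_mul => //; apply: smooth_add => //.
  - exact: smooth_coord.
  - exact: smooth_cst.
  - exact: smooth_coord.
  - exact: smooth_cst.
have su : smooth (chart_dom i) u.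
  have := smooth_add oD (smooth_cst _ r) (smooth_mul oD (smooth_cst _ (-1)) sq).
  by apply: smooth_eq => // y _; rewrite /u mulN1r.
have sv : smooth (chart_dom i) v by apply: smooth_add => //; exact: smooth_cst.
have spsi : smooth (chart_dom i) psi.
  apply: smooth_mul => //; first exact: smooth_flat.
  by apply: smooth_inv => //; apply: smooth_add => //; exact: smooth_flat.
have phi0 y : ~ K y -> phi y = 0.
  rewrite /phi; case: pselect => // dy nK.
  rewrite /psi [flat 0 (u y)]flat_eq0 ?mul0r// /u subr_le0.
  (* Where q < r, every coordinate is within e/2 of that of [a]: the Euclidean ball is contained in
     the ball [B] of the maximum norm. *)
  rewrite leNgt; apply/negP => qr; apply: nK; exists (chart i y); last exact: chartK.
  rewrite /B closed_ballE// /closed_ball_/= [leLHS]mx_normrE.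
  apply/bigmax_leP; split => [|[j k] _ /=]; first exact: ltW.
  rewrite -ler_sqr ?nnegrE// ?(ltW e20)// real_normK ?num_real//.
  have -> : (a - chart i y) j k = a j k - chart i y j k by rewrite !mxE.
  rewrite -sqrrN opprB (ord1 j).
  apply: le_trans (ltW qr); rewrite /q (bigD1 k)//= lerDl.
  by apply: sumr_ge0 => l _; exact: sqr_ge0.
have oKC : open (~` K) by exact: closed_openC.
exists phi; split.
- apply: smooth_local => y _; have [dy|ndy] := pselect (chart_dom i y).
    exists (chart_dom i) => //; apply: smooth_eq spsi => // z dz.
    by rewrite /phi; case: pselect.
  exists (~` K); first by move=> /KU[].
  by apply: smooth_eq (smooth_cst _ 0) => // z /phi0.
- have qx : q x = 0 by rewrite /q big1// => k _; rewrite subrr expr0n.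
  have qr : \forall y \near x, q y < r / 4.
    apply: (cvgr_lt (q x)); first exact: smooth_continuous oD dx sq.
    by rewrite qx divr_gt0.
  apply: filterS2 qr (nbhs_open oD dx) => y qy dy.
  rewrite /phi; case: (pselect _) => // dy0; rewrite /psi [flat 0 (v y)]flat_eq0.
    by rewrite addr0 divff// gt_eqF// flat_gt0// /u; move: r0 qy; lra.
  by rewrite /v subr_le0 ltW.
- move=> y; have [Uy|nUy] := pselect (U y); [by left|right].
  by apply: filterS phi0 _; apply: nbhs_open => // /KU[].
Qed.

End smooth.

(** * Bases and traces; tangent vectors *)

Section bases.
Context (R : realType) (V : lmodType R) (r : nat).
Implicit Types (s : 'I_r -> V) (v : V).

Definition coord s v : 'rV[R]_r := xget 0 [set c : 'rV[R]_r | v = \sum_k c 0 k *: s k].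

Variables (s : 'I_r -> V).
Hypothesis bs : is_basis s.

Lemma coordK v : v = \sum_k coord s v 0 k *: s k.
Proof. by have [c [vc _]] := bs v; exact: (@xgetPex _ 0 [set c : 'rV[R]_r | v = \sum_k c 0 k *: s k] (ex_intro _ c vc)). Qed.

Lemma coord_unique v (c : 'rV[R]_r) : v = \sum_k c 0 k *: s k -> coord s v = c.
Proof. by move=> vc; have [d [_ ud]] := bs v; rewrite -(ud _ vc) -(ud _ (coordK v)). Qed.

Lemma coord_linear a u v : coord s (a *: u + v) = a *: coord s u + coord s v.
Proof.
apply: coord_unique; rewrite [in LHS](coordK u) [in LHS](coordK v) scaler_sumr -big_split/=.
by apply: eq_bigr => k _; rewrite !mxE scalerDl scalerA.
Qed.

Lemma coord_basis k : coord s (s k) = delta_mx 0 k.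
Proof.
apply: coord_unique; rewrite (bigD1 k)//= mxE !eqxx scale1r big1 ?addr0// => j jk.
by rewrite mxE (negbTE jk) andbF scale0r.
Qed.

Lemma coord0 : coord s 0 = 0.
Proof. by apply: coord_unique; rewrite big1// => k _; rewrite mxE scale0r. Qed.

Lemma coordZ a v : coord s (a *: v) = a *: coord s v.
Proof. by rewrite -[a *: v]addr0 coord_linear coord0 addr0. Qed.

Lemma coordD u v : coord s (u + v) = coord s u + coord s v.
Proof. by rewrite -[u]scale1r coord_linear !scale1r. Qed.

Lemma coordN v : coord s (- v) = - coord s v.
Proof. by rewrite -scaleN1r coordZ scaleN1r. Qed.

Lemma coord_sum (I : Type) (q : seq I) (P : pred I) (F : I -> V) :
  coord s (\sum_(i <- q | P i) F i) = \sum_(i <- q | P i) coord s (F i).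
Proof. exact: (big_morph (coord s) coordD coord0). Qed.

Definition coord_det (v : 'I_r -> V) : R := \det (\matrix_(i < r) coord s (v i)).

(** Its value on the basis [s] is 1, so it separates the multiples of [wedge s]; the uniqueness of
    the divergence rests on it. *)
Program Definition det_form : altform V r := @Altform R V r coord_det _ _.
Next Obligation.
move=> v k a u w; rewrite /coord_det -[X in _ = _ + X]mul1r.
apply: (@determinant_multilinear _ _ _ _ _ k); [|apply/matrixP..].
- by rewrite !rowK/= !eqxx coord_linear scale1r.
- by move=> i j; rewrite !mxE /= eq_sym (negbTE (neq_lift _ _)).
- by move=> i j; rewrite !mxE /= eq_sym (negbTE (neq_lift _ _)).
Qed.
Next Obligation.
move=> v i j ij vij; apply: (determinant_alternate ij) => k.
by rewrite !mxE vij.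
Qed.

Definition tr (Ds : 'I_r -> V) : R := \sum_k coord s (Ds k) 0 k.

Lemma alt_sum (phi : altform V r) (v : 'I_r -> V) k (I : Type) (q : seq I) (c : I -> R) (w : I -> V) :
  phi [eta v with k |-> \sum_(i <- q) c i *: w i] =
  \sum_(i <- q) c i * phi [eta v with k |-> w i].
Proof.
elim: q => [|i q IH]; last by rewrite !big_cons alt_linear IH.
rewrite !big_nil; have := alt_linear phi v k 0 0 0.
by rewrite scaler0 add0r mul0r add0r => /eqP; rewrite -subr_eq0 subrr => _; have := alt_linear phi v k (-1) 0 0; rewrite scaler0 addr0 mulN1r addNr.
Qed.

(** Expanding [Ds k] in the basis, every term but the diagonal one repeats a vector and is killed by
    alternation. Uniqueness of the factor comes from evaluating at [det_form]. *)
Lemma divergenceE Ds : divergence s Ds = tr Ds.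
Proof.
have trP : \sum_k wedge [eta s with k |-> Ds k] = tr Ds *: wedge s.
  apply/funext => phi.
  have -> : (\sum_k wedge [eta s with k |-> Ds k]) phi = \sum_k phi [eta s with k |-> Ds k].
    elim: (index_enum _) => [|k q IH]; first by rewrite !big_nil.
    by rewrite !big_cons -IH.
  have -> : (tr Ds *: wedge s) phi = tr Ds * phi s by [].
  rewrite mulr_suml; apply: eq_bigr => k _.
  rewrite [in LHS](coordK (Ds k)) alt_sum (bigD1 k)//= big1 ?addr0.
    congr (_ * phi _); apply/funext => j /=.
    by case: eqP => [->|].
  move=> j jk; rewrite (@alt_alternate _ _ _ phi _ j k) ?mulr0//=.
  by rewrite eqxx (negbTE jk).
have uniq d : \sum_k wedge [eta s with k |-> Ds k] = d *: wedge s -> d = tr Ds.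
  rewrite trP => /(congr1 (fun w : altform V r -> R^o => w det_form)).
  have E (a : R) : (a *: wedge s) det_form = a * coord_det s by [].
  have det1s : coord_det s = 1.
    rewrite /coord_det (_ : \matrix_i _ = 1%:M) ?det1//.
    by apply/matrixP => i j; rewrite !mxE coord_basis !mxE eqxx eq_sym.
  by rewrite !E det1s !mulr1 => ->.
rewrite /divergence; by case: xgetP => [d _ /uniq//|/(_ _ trP)].
Qed.

Lemma trD D1 D2 : tr (fun k => D1 k + D2 k) = tr D1 + tr D2.
Proof. by rewrite -big_split/=; apply: eq_bigr => k _; rewrite coordD mxE. Qed.

Lemma trZ a D : tr (fun k => a *: D k) = a * tr D.
Proof. by rewrite mulr_sumr; apply: eq_bigr => k _; rewrite coordZ mxE. Qed.

Lemma trN D : tr (fun k => - D k) = - tr D.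
Proof. by rewrite -sumrN; apply: eq_bigr => k _; rewrite coordN mxE. Qed.

End bases.

(** This is tr(BA) = tr(AB) for the linear maps A : V -> W and B : W -> V with values [u] and [w] on
    the bases; the dimensions may differ. *)
Lemma tr_swap (R : realType) (V W : lmodType R) r q (s : 'I_r -> V) (t : 'I_q -> W)
    (u : 'I_r -> W) (w : 'I_q -> V) : is_basis s -> is_basis t ->
  tr s (fun k => \sum_j coord t (u k) 0 j *: w j) =
  tr t (fun j => \sum_k coord s (w j) 0 k *: u k).
Proof.
move=> bs bt; rewrite /tr.
under eq_bigr do rewrite coord_sum// summxE.
under [RHS]eq_bigr do rewrite coord_sum// summxE.
rewrite exchange_big/=; apply: eq_bigr => j _; apply: eq_bigr => k _.
by rewrite !coordZ// !mxE mulrC.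
Qed.

(** * Germs of functions and tangent vectors *)

Section germs.
Context (R : realType) (n : nat) (M : manifold R n).
Implicit Types (U V W : set M) (f g : M -> R) (x y : M).

Lemma smooth_at_open U f x : open U -> U x -> smooth U f -> smooth_at x f.
Proof. by move=> oU Ux sf; exists U. Qed.

Lemma smooth_atP U f : open U -> (forall x, U x -> smooth_at x f) -> smooth U f.
Proof. by move=> oU h; apply: smooth_local => x /h[W [_ Wx] sf]; exists W. Qed.

Lemma near_open (P : M -> Prop) x : (\forall y \near x, P y) ->
  exists2 U, open U /\ U x & U `<=` P.
Proof. by rewrite -nbhs_nearE nbhsE => -[U ? ?]; exists U. Qed.

Lemma smooth_at_near x f : smooth_at x f -> \forall y \near x, smooth_at y f.
Proof.
move=> [U [oU Ux] sf]; apply: filterS (nbhs_open oU Ux) => y Uy.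
exact: smooth_at_open sf.
Qed.

Lemma smooth_at_eq x f g : (\forall y \near x, f y = g y) -> smooth_at x f ->
  smooth_at x g.
Proof.
move=> /near_open[W [oW Wx] fg] [U [oU Ux] sf].
have oI := openI oW oU; exists (W `&` U); first by split.
apply: (@smooth_eq _ _ _ _ f) => //; first by move=> y [/fg].
by apply: smooth_sub sf => y [].
Qed.

Lemma smooth_at_cst x (c : R) : smooth_at x (fun=> c).
Proof. by exists setT; [split=> //; exact: openT|exact: smooth_cst]. Qed.

Lemma smooth_at2 (P : (M -> R) -> (M -> R) -> M -> R) x f g :
  (forall U, open U -> smooth U f -> smooth U g -> smooth U (P f g)) ->
  smooth_at x f -> smooth_at x g -> smooth_at x (P f g).
Proof.
move=> hP [U [oU Ux] sf] [V [oV Vx] sg]; exists (U `&` V).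
  by split=> //; exact: openI.
by apply: hP; [exact: openI|apply: smooth_sub sf => y []|apply: smooth_sub sg => y []].
Qed.

Lemma smooth_at_add x f g : smooth_at x f -> smooth_at x g ->
  smooth_at x (fun y => f y + g y).
Proof. by apply: (@smooth_at2 (fun f g y => f y + g y)) => U; exact: smooth_add. Qed.

Lemma smooth_at_mul x f g : smooth_at x f -> smooth_at x g ->
  smooth_at x (fun y => f y * g y).
Proof. by apply: (@smooth_at2 (fun f g y => f y * g y)) => U; exact: smooth_mul. Qed.

Lemma smooth_at_opp x f : smooth_at x f -> smooth_at x (fun y => - f y).
Proof.
move=> /(smooth_at_mul (smooth_at_cst x (-1))); apply: smooth_at_eq.
by apply: nearW => y; rewrite mulN1r.
Qed.

Lemma smooth_at_sum (I : finType) (P : pred I) x (F : I -> M -> R) :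
  (forall i, P i -> smooth_at x (F i)) -> smooth_at x (fun y => \sum_(i | P i) F i y).
Proof.
move=> sF; elim: (index_enum I) => [|i r IH].
  by apply: smooth_at_eq (smooth_at_cst x 0); apply: nearW => y; rewrite big_nil.
have [Pi|Pi] := boolP (P i).
  apply: smooth_at_eq (smooth_at_add (sF i Pi) IH).
  by apply: nearW => y; rewrite big_cons Pi.
by apply: smooth_at_eq IH; apply: nearW => y; rewrite big_cons (negbTE Pi).
Qed.

Section tangent.
Context (x : M).
Implicit Types (v w : tangent x).

Lemma tangent_lin v a f g : smooth_at x f -> smooth_at x g ->
  v (fun y => a * f y + g y) = a * v f + v g.
Proof. by have /asboolP[+ _ _] := tangentP v; apply. Qed.

Lemma tangent_mul v f g : smooth_at x f -> smooth_at x g ->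
  v (fun y => f y * g y) = f x * v g + g x * v f.
Proof. by have /asboolP[_ + _] := tangentP v; apply. Qed.

Lemma tangent_nonsmooth v f : ~ smooth_at x f -> v f = 0.
Proof. by have /asboolP[_ _ +] := tangentP v; apply. Qed.

Lemma tangent_ext v w : (forall f, smooth_at x f -> v f = w f) -> v = w.
Proof.
move=> vw; apply/val_inj/funext => f; have [sf|nf] := pselect (smooth_at x f).
  exact: vw.
by rewrite /= !tangent_nonsmooth.
Qed.

Lemma tangentD v w f : (v + w : tangent x) f = v f + w f.
Proof. by []. Qed.

Lemma tangentZ a v f : (a *: v : tangent x) f = a * v f.
Proof. by []. Qed.

Lemma tangentN v f : (- v : tangent x) f = - v f.
Proof. by []. Qed.

Lemma tangent0 f : (0 : tangent x) f = 0.
Proof. by []. Qed.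

Lemma tangent_sum (I : Type) (r : seq I) (P : pred I) (F : I -> tangent x) f :
  (\sum_(i <- r | P i) F i : tangent x) f = \sum_(i <- r | P i) F i f.
Proof. exact: (big_morph (fun v : tangent x => v f) (fun v w => tangentD v w f) (tangent0 f)). Qed.

Lemma tangent_cst v (c : R) : v (fun=> c) = 0.
Proof.
have s1 := smooth_at_cst x (1 : R); have s0 := smooth_at_cst x (0 : R).
have v0 : v (fun=> 0) = 0.
  transitivity (-1 * v (fun=> 0) + v (fun=> 0)); last by rewrite mulN1r addNr.
  by rewrite -tangent_lin//; congr (v _); apply/funext => y; rewrite mulr0 addr0.
have v1 : v (fun=> 1) = 0.
  apply: (addrI (v (fun=> 1))); rewrite addr0.
  transitivity (1 * v (fun=> 1) + 1 * v (fun=> 1)); first by rewrite !mul1r.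
  by rewrite -tangent_mul//; congr (v _); apply/funext => y; rewrite mulr1.
have <- : c * v (fun=> 1) + v (fun=> 0) = 0 by rewrite v0 v1 mulr0 addr0.
by rewrite -tangent_lin//; congr (v _); apply/funext => y; rewrite mulr1 addr0.
Qed.

Lemma tangent_add v f g : smooth_at x f -> smooth_at x g ->
  v (fun y => f y + g y) = v f + v g.
Proof.
move=> sf sg; have := tangent_lin v 1 sf sg; rewrite mul1r => <-.
by congr (v _); apply/funext => y; rewrite mul1r.
Qed.

Lemma tangent_opp v f : smooth_at x f -> v (fun y => - f y) = - v f.
Proof.
move=> sf; have := tangent_lin v (-1) sf (smooth_at_cst x 0).
rewrite tangent_cst addr0 mulN1r => <-.
by congr (v _); apply/funext => y; rewrite mulN1r addr0.
Qed.

Lemma tangent_scale v a f : smooth_at x f -> v (fun y => a * f y) = a * v f.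
Proof.
move=> sf; have := tangent_lin v a sf (smooth_at_cst x 0).
rewrite tangent_cst addr0 => <-.
by congr (v _); apply/funext => y; rewrite addr0.
Qed.

Lemma tangent_sumf (I : finType) (P : pred I) v (F : I -> M -> R) :
  (forall i, P i -> smooth_at x (F i)) ->
  v (fun y => \sum_(i | P i) F i y) = \sum_(i | P i) v (F i).
Proof.
move=> sF; suff: forall r, smooth_at x (fun y => \sum_(i <- r | P i) F i y) /\
   v (fun y => \sum_(i <- r | P i) F i y) = \sum_(i <- r | P i) v (F i).
  by move=> /(_ (index_enum I))[].
elim=> [|i r [sr IH]].
  split; last first.
    rewrite big_nil; transitivity (v (fun=> 0)); last exact: tangent_cst.
    by congr (v _); apply/funext => y; rewrite big_nil.
  by apply: smooth_at_eq (smooth_at_cst x 0); apply: nearW => y; rewrite big_nil.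
have -> : (fun y => \sum_(j <- i :: r | P j) F j y) =
    (fun y => (if P i then F i y else 0) + \sum_(j <- r | P j) F j y).
  by apply/funext => y; rewrite big_cons; case: ifP => //; rewrite add0r.
rewrite big_cons; case: ifPn => Pi.
  by split; [exact: smooth_at_add (sF i Pi) sr|rewrite tangent_add ?IH//; exact: sF].
have -> : (fun y => 0 + \sum_(j <- r | P j) F j y) = (fun y => \sum_(j <- r | P j) F j y).
  by apply/funext => y; rewrite add0r.
by split.
Qed.

(* Multiplying by the indicator function of the set where f and g agree makes
   them equal; as that function is 1 near x, no bump function is needed. *)
Lemma tangent_near v f g : (\forall y \near x, f y = g y) -> v f = v g.
Proof.
move=> fg; have [sf|nf] := pselect (smooth_at x f); last first.
  rewrite !tangent_nonsmooth// => sg; apply: nf; apply: smooth_at_eq sg.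
  by apply: filterS fg.
have sg := smooth_at_eq fg sf.
pose chi y : R := if f y == g y then 1 else 0.
have chi1 : \forall y \near x, 1 = chi y.
  by apply: filterS fg => y fgy; rewrite /chi fgy eqxx.
have sc : smooth_at x chi := smooth_at_eq chi1 (smooth_at_cst x 1).
have chix : chi x = 1 by rewrite -(nbhs_singleton chi1).
have e : (fun y => chi y * f y) = (fun y => chi y * g y).
  by apply/funext => y; rewrite /chi; case: eqP => [->//|_]; rewrite !mul0r.
have := congr1 v e; rewrite !tangent_mul// chix !mul1r (nbhs_singleton fg).
by move/addIr.
Qed.

(** Truncating [D] to 0 on functions that are not smooth near [x] secures the normalising clause of
    [derivation_at]. *)
Lemma mk_tangent (D : (M -> R) -> R) :
  (forall a f g, smooth_at x f -> smooth_at x g ->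
     D (fun y => a * f y + g y) = a * D f + D g) ->
  (forall f g, smooth_at x f -> smooth_at x g ->
     D (fun y => f y * g y) = f x * D g + g x * D f) ->
  exists v : tangent x, forall f, smooth_at x f -> v f = D f.
Proof.
move=> D1 D2; pose D' f : R^o := if pselect (smooth_at x f) then D f else 0.
have DE f : smooth_at x f -> D' f = D f by rewrite /D'; case: pselect.
have DP : D' \in derivations x.
  apply/asboolP; split.
  - move=> a f g sf sg; rewrite !DE//; first exact: D1.
    by apply: smooth_at_add => //; apply: smooth_at_mul => //; exact: smooth_at_cst.
  - by move=> f g sf sg; rewrite !DE//; [exact: D2|exact: smooth_at_mul].
  - by move=> f nf; rewrite /D'; case: pselect.
by exists (Tangent DP) => f /DE.
Qed.

End tangent.

End germs.

(** * Frames of TM and of vector bundles *)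

Lemma linear_zero (R : pzRingType) (V W : lmodType R) (f : V -> W) :
  linear f -> f 0 = 0.
Proof.
by move=> lf; have := lf (-1) 0 0; rewrite scaler0 addr0 scaleN1r => ->; rewrite addNr.
Qed.

Lemma linear_comb (R : pzRingType) (V W : lmodType R) (f : V -> W) (I : Type)
    (r : seq I) (c : I -> R) (v : I -> V) : linear f ->
  f (\sum_(i <- r) c i *: v i) = \sum_(i <- r) c i *: f (v i).
Proof.
move=> lf; elim: r => [|i r IH]; last by rewrite !big_cons lf IH.
by rewrite !big_nil linear_zero.
Qed.

(* The record [bundle] carries no laws; these ones hold for TM and for vector
   bundles. *)
Record tame R n (M : manifold R n) (B : bundle M) : Prop := Tame {
  tame_sub : forall (U V : set M) (s : sec B), V `<=` U -> smooth_sec U s -> smooth_sec V s ;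
  tame_eq : forall (U : set M) (s t : sec B), open U -> (forall x, U x -> s x = t x) ->
    smooth_sec U s -> smooth_sec U t ;
  tame_comb : forall (U : set M) f (s t : sec B), open U -> smooth U f ->
    smooth_sec U s -> smooth_sec U t -> smooth_sec U (fun x => f x *: s x + t x) ;
  tame_zero : forall (U : set M), open U -> smooth_sec U (fun x => 0 : fib B x) ;
  tame_local : forall (U : set M) (s : sec B), open U ->
    (forall x, U x -> exists W : set M, [/\ open W, W x & smooth_sec W s]) -> smooth_sec U s ;
  tame_coef : forall (U V : set M) (F : 'I_(rk B) -> sec B) (c : M -> 'rV[R]_(rk B)),
    open U -> open V -> V `<=` U -> frame U F ->
    smooth_sec V (fun x => \sum_k c x 0 k *: F k x) ->
    forall k, smooth V (fun x => c x 0 k) }.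

(** Cramer's rule: the inverse matrix is the adjugate divided by the determinant, both polynomial in
    the smooth entries. *)
Lemma smooth_solve R n (M : manifold R n) (V : set M) m (T : M -> 'M[R]_m)
    (b c : M -> 'rV[R]_m) : open V ->
  (forall k l, smooth V (fun x => T x k l)) ->
  (forall l, smooth V (fun x => b x 0 l)) ->
  (forall x, V x -> T x \in unitmx) -> (forall x, V x -> c x *m T x = b x) ->
  forall k, smooth V (fun x => c x 0 k).
Proof.
move=> oV sT sb uT cT k.
apply: (@smooth_eq _ _ _ _ (fun x => \sum_l b x 0 l * ((\det (T x))^-1 * (\adj (T x)) l k))) => //.
  move=> x Vx; have -> : c x = b x *m invmx (T x) by rewrite -cT// mulmxK// uT.
  by rewrite mxE /invmx (uT _ Vx); apply: eq_bigr => l _; rewrite [in RHS]mxE.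
apply: smooth_sum => // l _; do !apply: smooth_mul => //.
  apply: smooth_inv => //; last exact: smooth_det.
  by move=> x Vx; have := uT _ Vx; rewrite unitmxE unitfE.
exact: smooth_adj.
Qed.

Section vbundle_tame.
Context (R : realType) (n : nat) (M : manifold R n) (B : vbundle M).

Lemma vbundle_tame : tame B.
Proof.
have oI i U : open U -> open (triv_dom (v := B) i `&` U).
  by move=> oU; apply: openI => //; exact: triv_dom_open.
split.
- by move=> U V s VU ss i k; apply: smooth_sub (ss i k) => x [? /VU].
- move=> U s t oU st ss i k; apply: smooth_eq (ss i k); first exact: oI.
  by move=> x [_ Ux]; rewrite st.
- move=> U f s t oU sf ss st i k.
  have : smooth (triv_dom (v := B) i `&` U) (fun x => f x * triv (v := B) i (s x) 0 k + triv (v := B) i (t x) 0 k).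
    apply: smooth_add; [exact: oI| |exact: st].
    by apply: smooth_mul; [exact: oI|apply: smooth_sub sf => x []|exact: ss].
  by apply: smooth_eq; [exact: oI|move=> x [dx _]; rewrite triv_linear// !mxE].
- move=> U oU i k; apply: smooth_eq (smooth_cst _ 0); first exact: oI.
  by move=> x [dx _]; rewrite (linear_zero (triv_linear dx)) mxE.
- move=> U s oU h i k; apply: smooth_local => x [dx Ux].
  have [W [oW Wx sW]] := h _ Ux; by exists (triv_dom (v := B) i `&` W).
- move=> U V F c oU oV VU [sF bF] sc k.
  apply: smooth_local => x Vx; have [i dx] := triv_cover B x.
  exists (triv_dom (v := B) i `&` V) => //.
  pose T x := \matrix_(k, l) triv (v := B) i (F k x) 0 l : 'M[R]_(rk B).
  have TE y (d : 'rV_(rk B)) : triv_dom (v := B) i y ->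
      triv (v := B) i (\sum_k d 0 k *: F k y) = d *m T y.
    move=> dy; rewrite (linear_comb _ _ _ (triv_linear dy)).
    by apply/rowP => l; rewrite summxE mxE; apply: eq_bigr => j _; rewrite !mxE.
  apply: (@smooth_solve _ _ _ _ _ T (fun x => triv (v := B) i (\sum_k c x 0 k *: F k x))).
  + exact: oI.
  + move=> a l; apply: (@smooth_eq _ _ _ _ (fun x => triv (v := B) i (F a x) 0 l)).
    * exact: oI.
    * by move=> y _; rewrite mxE.
    * by apply: smooth_sub (sF a i l) => y [? /VU].
  + by move=> l; apply: sc.
  + move=> y [dy Vy]; have [g gK fK] := triv_bij dy.
    (* The rows of [C] are the frame coordinates of the vectors that the trivialisation sends to the
       standard basis, so [C] is a left inverse of [T y]. *)
    pose C := \matrix_l coord (F^~ y) (g (delta_mx 0 l)) : 'M[R]_(rk B).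
    suff /mulmx1_unit[] : C *m T y = 1%:M by [].
    apply/row_matrixP => l; rewrite row_mul rowK -TE// -coordK ?fK ?row1//.
    exact/bF/VU.
  + by move=> y [dy Vy]; rewrite TE.
Qed.
End vbundle_tame.

Section TM_tame.
Context (R : realType) (n : nat) (M : manifold R n).

(** The duality with the chart coordinates gives linear independence, which is half of the proof
    that these vectors form a basis. *)
Lemma partial_derivation (i : chart_idx M) (x : M) k : chart_dom i x ->
  exists v : tangent x,
    (forall f, smooth_at x f -> v f = 'D_(delta_mx 0 k) (f \o param i) (chart i x)) /\
    forall l, v (fun y => chart i y 0 l) = (k == l)%:R.
Proof.
move=> dx.
have df f : smooth_at x f -> derivable (f \o param i) (chart i x) (delta_mx 0 k).
  by move=> [U [oU Ux] /(_ i 1)[+ _]] => h; apply/diff_derivable/h; exists x.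
have [||v vE] := @mk_tangent R n M x (fun f => 'D_(delta_mx 0 k) (f \o param i) (chart i x)).
- move=> a f g /df sf /df sg.
  by have := deriveD (derivableZ (k := a) sf) sg; rewrite deriveZ.
- move=> f g /df sf /df sg.
  by have := deriveM sf sg; rewrite /= chartK.
exists v; split=> // l; rewrite vE; last first.
  by apply: (smooth_at_open (@chart_dom_open _ _ M i) dx); exact: smooth_coord.
have dc : differentiable (fun y : 'rV[R]_n => y 0 l) (chart i x) by exact: differentiable_coord.
transitivity ('D_(delta_mx 0 k) (fun y : 'rV[R]_n => y 0 l) (chart i x)).
  apply: near_eq_derive.
  apply: filterS (open_nbhs_nbhs (conj (@chart_im_open _ _ M i) (ex_intro2 _ _ x dx erefl))).
  by move=> _ [y dy <-] /=; rewrite chartK.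
apply: cvg_lim => //; apply: (@cvg_trans _ ((fun=> (k == l)%:R : R) @ 0^')); last exact: cvg_cst.
apply: near_eq_cvg; near=> h => /=.
have h0 : h != 0 by near: h; exact: nbhs_dnbhs_neq.
by rewrite !mxE eqxx /= eq_sym addrK [_ *: _]mulrA mulVf// mul1r.
Unshelve. all: by end_near. Qed.

(* A basis of T_xM has n elements, and so do the linearly independent partial
   derivatives: every derivation at x is a combination of them. *)
Lemma tangent_partial (x : M) (i : chart_idx M) (b : 'I_n -> tangent x) (v : tangent x) :
  chart_dom i x -> is_basis b -> exists a : 'I_n -> R, forall f, smooth_at x f ->
    v f = \sum_l a l * 'D_(delta_mx 0 l) (f \o param i) (chart i x).
Proof.
move=> dx bb; have [d dP] := choice (fun k => partial_derivation k dx).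
pose C := \matrix_l coord b (d l) : 'M[R]_n.
pose T := \matrix_(k, l) b k (fun y => chart i y 0 l) : 'M[R]_n.
have CT : C *m T = 1%:M.
  apply/matrixP => a l; rewrite mxE [RHS]mxE -(dP a).2 [in RHS](coordK bb (d a)) tangent_sum.
  by apply: eq_bigr => j _; rewrite !mxE.
exists (fun l => (coord b v *m T) 0 l) => f sf.
transitivity (\sum_l (coord b v *m T) 0 l * d l f); last first.
  by apply: eq_bigr => l _; rewrite (dP l).1.
have vE : v = \sum_l (coord b v *m T) 0 l *: d l.
  rewrite [LHS](coordK bb); under [RHS]eq_bigr => l _ do rewrite (coordK bb (d l)) scaler_sumr.
  rewrite exchange_big/=; apply: eq_bigr => k _.
  under eq_bigr => l _ do rewrite scalerA.
  rewrite -scaler_suml; congr (_ *: _).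
  (* The equality of dimensions enters here: [C] and [T] are square, so [C *m T = 1] gives
     [T *m C = 1], and n independent derivations span. *)
  transitivity ((coord b v *m T *m C) 0 k); first by rewrite -mulmxA (mulmx1C CT) mulmx1.
  by rewrite mxE; apply: eq_bigr => l _; rewrite [C l k]mxE.
by rewrite [in LHS]vE tangent_sum.
Qed.

(** The chain rule is not part of the definition of a derivation; it is inherited from the partial
    derivatives of a chart, of which [v] is a combination. *)
Lemma tangent_ln (x : M) (b : 'I_n -> tangent x) (v : tangent x) f : is_basis b ->
  smooth_at x f -> (\forall y \near x, 0 < f y) ->
  v (fun y => ln (f y)) = v f * (f x)^-1.
Proof.
move=> bb sf f0; have [i dx] := chart_cover x.
have [a aE] := tangent_partial v dx bb.
have [U [oU Ux] sU] := sf; have [W [oW Wx] W0] := near_open f0.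
have sl : smooth_at x (fun y => ln (f y)).
  exists (U `&` W); first by split=> //; exact: openI.
  by apply: smooth_ln; [exact: openI|move=> y [_ /W0]|apply: smooth_sub sU => y []].
rewrite !aE// mulr_suml; apply: eq_bigr => l _; rewrite -mulrA; congr (_ * _).
have df : differentiable (f \o param i) (chart i x).
  by have [+ _] := sU i 1; apply; exists x.
rewrite (@derive_ln _ _ (f \o param i))//= chartK//; exact: W0.
Qed.

Lemma smooth_TM_at (x : M) (X : sec (TM M)) f : smooth_sec_at x X -> smooth_at x f ->
  smooth_at x (fun y => X y f).
Proof.
move=> [U [oU Ux] sX] [V [oV Vx] sf]; exists (U `&` V).
  by split=> //; exact: openI.
by apply: sX; [exact: openI|move=> y []|apply: smooth_sub sf => y []].
Qed.

Lemma TM_tame : tame (TM M).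
Proof.
split.
- by move=> U V s VU ss W f oW WV; apply: ss => //; exact: subset_trans VU.
- move=> U s t oU st ss W f oW WU sf; apply: smooth_eq (ss W f oW WU sf) => //.
  by move=> x /WU Ux; rewrite st.
- move=> U f s t oU sf ss st W g oW WU sg.
  apply: (@smooth_add _ _ _ _ (fun x => f x * s x g) (fun x => t x g)) => //; last exact: st.
  by apply: smooth_mul => //; [exact: smooth_sub sf|exact: ss].
- by move=> U oU W f oW WU sf; exact: (smooth_cst W 0).
- move=> U s oU h W f oW WU sf; apply: smooth_local => x Wx.
  have [W' [oW' W'x sW']] := h _ (WU _ Wx); exists (W `&` W') => //.
  by apply: sW'; [exact: openI|move=> y []|apply: smooth_sub sf => y []].
- move=> U V F c oU oV VU [sF bF] sc k.
  apply: smooth_local => x Vx; have [i dx] := chart_cover x.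
  have oI : open (chart_dom i `&` V) by apply: openI => //; exact: chart_dom_open.
  exists (chart_dom i `&` V) => //.
  (* Applying vector fields to the chart coordinates stands in for a trivialisation, and the partial
     derivatives, expanded in the frame, give the inverse of [T]. *)
  pose T x := \matrix_(k, l) (F k x : tangent x) (fun y => chart i y 0 l) : 'M[R]_n.
  pose b x := \row_l (\sum_k c x 0 k *: F k x : tangent x) (fun y => chart i y 0 l) : 'rV[R]_n.
  have sco l : smooth (chart_dom i `&` V) (fun y => chart i y 0 l).
    by apply: smooth_sub (@smooth_coord _ _ _ i l) => y [].
  apply: (@smooth_solve _ _ _ _ _ T b) => //.
  + move=> a l; apply: (@smooth_eq _ _ _ _ (fun x => (F a x : tangent x) (fun y => chart i y 0 l))) => //.
      by move=> y _; rewrite mxE.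
    by apply: sF => // y [_ /VU].
  + move=> l; apply: (@smooth_eq _ _ _ _ (fun x => (\sum_k c x 0 k *: F k x : tangent x) (fun y => chart i y 0 l))) => //.
      by move=> y _; rewrite mxE.
    by apply: sc => // y [].
  + move=> y [dy Vy]; have [v vP] := choice (fun k => partial_derivation k dy).
    have vE k0 := (vP k0).2.
    pose C := \matrix_l coord (F^~ y) (v l) : 'M[R]_n.
    suff /mulmx1_unit[] : C *m T y = 1%:M by [].
    apply/matrixP => a l; rewrite mxE [RHS]mxE -vE [in RHS](coordK (bF y (VU y Vy)) (v a)) tangent_sum.
    by apply: eq_bigr => j _; rewrite !mxE.
  + move=> y [dy Vy]; apply/rowP => l; rewrite !mxE tangent_sum.
    by apply: eq_bigr => a _; rewrite mxE.
Qed.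
End TM_tame.

(** * First-order operators and traces *)

Section sections.
Context (R : realType) (n : nat) (M : manifold R n) (B : bundle M).
Hypothesis tB : tame B.
Implicit Types (U V W : set M) (f g : M -> R) (x y : M) (s t : sec B).

Lemma sec_at_open U s x : open U -> U x -> smooth_sec U s -> smooth_sec_at x s.
Proof. by move=> oU Ux ss; exists U. Qed.

Lemma sec_atP U s : open U -> (forall x, U x -> smooth_sec_at x s) -> smooth_sec U s.
Proof.
by move=> oU h; apply: tame_local => // x /h[W [oW Wx] ss]; exists W; split.
Qed.

Lemma sec_at_near x s : smooth_sec_at x s -> \forall y \near x, smooth_sec_at y s.
Proof.
move=> [U [oU Ux] sf]; apply: filterS (nbhs_open oU Ux) => y Uy.
exact: sec_at_open sf.
Qed.

Lemma sec_at_eq x s t : (\forall y \near x, s y = t y) -> smooth_sec_at x s ->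
  smooth_sec_at x t.
Proof.
move=> /near_open[W [oW Wx] st] [U [oU Ux] ss].
have oI := openI oW oU; exists (W `&` U); first by split.
apply: (@tame_eq _ _ _ _ tB _ s) => //; first by move=> y [/st].
by apply: tame_sub ss => // y [].
Qed.

Lemma sec_at_comb x f s t : smooth_at x f -> smooth_sec_at x s ->
  smooth_sec_at x t -> smooth_sec_at x (fun y => f y *: s y + t y).
Proof.
move=> [U [oU Ux] sf] [V [oV Vx] ss] [W [oW Wx] st].
have oI : open (U `&` V `&` W) by do !apply: openI.
exists (U `&` V `&` W) => //; apply: tame_comb => //.
- by apply: smooth_sub sf => y [[]].
- by apply: tame_sub ss => // y [[]].
- by apply: tame_sub st => // y [[]].
Qed.

Lemma sec_at_zero x : smooth_sec_at x (fun y => 0 : fib B y).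
Proof. by exists setT; [split=> //; exact: openT|apply: tame_zero => //; exact: openT]. Qed.

Lemma sec_at_scale x f s : smooth_at x f -> smooth_sec_at x s ->
  smooth_sec_at x (fun y => f y *: s y).
Proof.
move=> sf ss; apply: sec_at_eq (sec_at_comb sf ss (sec_at_zero x)).
by apply: nearW => y; rewrite addr0.
Qed.

Lemma sec_at_add x s t : smooth_sec_at x s -> smooth_sec_at x t ->
  smooth_sec_at x (fun y => s y + t y).
Proof.
move=> ss st; apply: sec_at_eq (sec_at_comb (smooth_at_cst x 1) ss st).
by apply: nearW => y; rewrite scale1r.
Qed.

(* [f |-> X f *: K] is the symbol of D at x. *)
Definition first_order x (V : lmodType R) (X : tangent x) (K : fib B x -> V)
    (D : sec B -> V) : Prop :=
  (forall s t, smooth_sec_at x s -> smooth_sec_at x t ->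
     D (fun y => s y + t y) = D s + D t) /\
  (forall f s, smooth_at x f -> smooth_sec_at x s ->
     D (fun y => f y *: s y) = f x *: D s + X f *: K (s x)).

Section first_order.
Context (x : M) (V : lmodType R) (X : tangent x) (K : fib B x -> V) (D : sec B -> V).
Hypothesis DX : first_order X K D.

Lemma first_order0 : D (fun y => 0) = 0.
Proof.
have [_ DM] := DX; have := DM (fun=> 0) (fun y => 0) (smooth_at_cst x 0) (sec_at_zero x).
rewrite tangent_cst !scale0r addr0 => <-; congr (D _).
by apply: functional_extensionality_dep => y; rewrite scaler0.
Qed.

(** Both sections are multiplied by the indicator of the set where they agree. It is 1 near [x], so
    the symbol term drops out. *)
Lemma first_order_near s t : smooth_sec_at x s -> (\forall y \near x, s y = t y) ->
  D s = D t.
Proof.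
move=> ss st; have [_ DM] := DX; have s't := sec_at_eq st ss.
pose chi y : R := if `[< s y = t y >] then 1 else 0.
have chi1 : \forall y \near x, 1 = chi y.
  by apply: filterS st => y sty; rewrite /chi asboolT.
have sc : smooth_at x chi := smooth_at_eq chi1 (smooth_at_cst x 1).
have e : (fun y => chi y *: s y) = (fun y => chi y *: t y).
  by apply: functional_extensionality_dep => y; rewrite /chi; case: asboolP => [->//|_]; rewrite !scale0r.
have := congr1 D e; rewrite !DM// -(nbhs_singleton chi1) -(tangent_near X chi1) tangent_cst.
by rewrite !scale1r !scale0r !addr0.
Qed.

Lemma first_order_sum (I : Type) (r : seq I) (c : I -> M -> R) (s : I -> sec B) :
  (forall i, smooth_at x (c i)) -> (forall i, smooth_sec_at x (s i)) ->
  D (fun y => \sum_(i <- r) c i y *: s i y) =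
  \sum_(i <- r) (c i x *: D (s i) + X (c i) *: K (s i x)).
Proof.
have [DA DM] := DX; move=> sc ss.
suff [] : smooth_sec_at x (fun y => \sum_(i <- r) c i y *: s i y) /\
  D (fun y => \sum_(i <- r) c i y *: s i y) =
  \sum_(i <- r) (c i x *: D (s i) + X (c i) *: K (s i x)) by [].
elim: r => [|i r [sr IH]].
  have -> : (fun y => \sum_(i <- [::]) c i y *: s i y) = (fun y => 0).
    by apply: functional_extensionality_dep => y; rewrite big_nil.
  by rewrite big_nil first_order0; split=> //; exact: sec_at_zero.
have -> : (fun y => \sum_(j <- i :: r) c j y *: s j y) =
   (fun y => c i y *: s i y + \sum_(j <- r) c j y *: s j y).
  by apply: functional_extensionality_dep => y; rewrite big_cons.
have si := sec_at_scale (sc i) (ss i).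
by rewrite big_cons; split; [exact: sec_at_add|rewrite DA// IH DM].
Qed.
End first_order.

Section frame.
Context (U : set M) (F : 'I_(rk B) -> sec B).
Hypotheses (oU : open U) (FU : frame U F).

Lemma frame_basis x : U x -> is_basis (F^~ x).
Proof. by have [_ +] := FU; apply. Qed.

Lemma frame_at k x : U x -> smooth_sec_at x (F k).
Proof. by move=> Ux; exists U => //; have [] := FU. Qed.

Lemma smooth_coords V s k : open V -> V `<=` U -> smooth_sec V s ->
  smooth V (fun x => coord (F^~ x) (s x) 0 k).
Proof.
move=> oV VU ss; move: k; apply: tame_coef FU _ => //.
by apply: (tame_eq tB) ss => // x /VU Ux; rewrite -coordK//; exact: frame_basis.
Qed.

Lemma smooth_at_coords x s k : U x -> smooth_sec_at x s ->
  smooth_at x (fun y => coord (F^~ y) (s y) 0 k).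
Proof.
move=> Ux [V [oV Vx] ss]; have oI := openI oU oV.
exists (U `&` V) => //; apply: smooth_coords => //.
by apply: tame_sub ss => // y [].
Qed.

Lemma smooth_tr V (D : 'I_(rk B) -> sec B) : open V -> V `<=` U ->
  (forall k, smooth_sec V (D k)) -> smooth V (fun x => tr (F^~ x) (D^~ x)).
Proof. by move=> oV VU sD; apply: smooth_sum => // k _; apply: smooth_coords. Qed.

Lemma first_order_frame x (V : lmodType R) (X : tangent x) (K : fib B x -> V)
    (D : sec B -> V) s : first_order X K D -> U x -> smooth_sec_at x s ->
  D s = \sum_k (coord (F^~ x) (s x) 0 k *: D (F k) +
                X (fun y => coord (F^~ y) (s y) 0 k) *: K (F k x)).
Proof.
move=> DX Ux ss; rewrite -(first_order_sum DX); last 2 first.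
- by move=> k; exact: smooth_at_coords.
- by move=> k; exact: frame_at.
apply: (first_order_near DX) => //.
by apply: filterS (nbhs_open oU Ux) => y Uy; rewrite -coordK//; exact: frame_basis.
Qed.

(* The matrices A1, A2 of D1, D2 in the frame satisfy
   tr [D1, D2] = X1 (tr A2) - X2 (tr A1) + tr [A2, A1]. *)
Lemma tr_commutator x (X1 X2 : sec (TM M)) (D1 D2 : sec B -> sec B) : U x ->
  (forall y, U y -> first_order (X1 y) id (D1^~ y)) ->
  (forall y, U y -> first_order (X2 y) id (D2^~ y)) ->
  (forall s, smooth_sec_at x s -> smooth_sec_at x (D1 s)) ->
  (forall s, smooth_sec_at x s -> smooth_sec_at x (D2 s)) ->
  tr (F^~ x) (fun k => D1 (D2 (F k)) x - D2 (D1 (F k)) x) =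
  X1 x (fun y => tr (F^~ y) (fun k => D2 (F k) y)) -
  X2 x (fun y => tr (F^~ y) (fun k => D1 (F k) y)).
Proof.
move=> Ux d1 d2 s1 s2; have bF := frame_basis Ux.
rewrite trD// trN//.
have sF k := frame_at k Ux.
(* Expanding [D2' (F k)] in the frame, [D1'] acts either on the frame, which gives a product of two
   matrices, or on the coefficients, where only the k-th one contributes to the trace. *)
have trE (X1' : sec (TM M)) (D1' D2' : sec B -> sec B) :
    (forall y, U y -> first_order (X1' y) id (D1'^~ y)) ->
    (forall s, smooth_sec_at x s -> smooth_sec_at x (D2' s)) ->
    tr (F^~ x) (fun k => D1' (D2' (F k)) x) =
    tr (F^~ x) (fun k => \sum_j coord (F^~ x) (D2' (F k) x) 0 j *: D1' (F j) x) +
    X1' x (fun y => tr (F^~ y) (fun k => D2' (F k) y)).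
  move=> d1' s2'; rewrite /tr tangent_sumf; last first.
    by move=> k _; apply: smooth_at_coords => //; exact: s2'.
  rewrite -big_split/=; apply: eq_bigr => k _.
  rewrite (first_order_frame (d1' _ Ux) Ux (s2' _ (sF k))) big_split/= coordD// mxE; congr (_ + _).
  rewrite coord_sum// summxE (bigD1 k)//= coordZ// coord_basis// !mxE !eqxx mulr1 big1 ?addr0// => j jk.
  by rewrite coordZ// coord_basis// !mxE eqxx eq_sym (negbTE jk) mulr0.
(* The two products of matrices have equal traces; only the derivatives of traces survive. *)
rewrite (trE X1 D1 D2)// (trE X2 D2 D1)// (tr_swap _ _ bF bF) opprD addrACA.
by rewrite subrr add0r.
Qed.
End frame.
End sections.

Section tensorial.
Context (R : realType) (n : nat) (M : manifold R n).
Implicit Types (B C : bundle M).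

(** O-linearity phrased as a zero symbol, so that the lemmas on first-order operators (dependence on
    the germ, expansion in a frame) apply as they are. *)
Definition tensorial B (x : M) (V : lmodType R) (D : sec B -> V) : Prop :=
  first_order (0 : tangent x) (fun=> 0) D.

Lemma tensorial_frame B (tB : tame B) (U : set M) F x (V : lmodType R) (D : sec B -> V) s :
  open U -> frame U F -> tensorial x D -> U x -> smooth_sec_at x s ->
  D s = \sum_k coord (F^~ x) (s x) 0 k *: D (F k).
Proof.
move=> oU FU tD Ux ss; rewrite (first_order_frame tB oU FU tD Ux ss).
by apply: eq_bigr => k _; rewrite scaler0 addr0.
Qed.

(** Each composite is expanded in the frame of the intermediate bundle, and tr(AB) = tr(BA) applies
    at the point [x]. *)
Lemma tr_tensorial B C (tB : tame B) (tC : tame C) (U : set M) F G x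
    (L : sec B -> sec C) (T : sec C -> sec B) : open U ->
  frame (B := B) U F -> frame (B := C) U G -> U x ->
  tensorial x (L^~ x) -> tensorial x (T^~ x) ->
  (forall s, smooth_sec_at x s -> smooth_sec_at x (L s)) ->
  (forall s, smooth_sec_at x s -> smooth_sec_at x (T s)) ->
  tr (F^~ x) (fun k => T (L (F k)) x) = tr (G^~ x) (fun k => L (T (G k)) x).
Proof.
move=> oU FU GU Ux tL tT sL sT.
have bF := frame_basis FU Ux; have bG := frame_basis GU Ux.
transitivity (tr (F^~ x) (fun k => \sum_j coord (G^~ x) (L (F k) x) 0 j *: T (G j) x)).
  congr (tr _ _); apply/funext => k; apply: (tensorial_frame tC oU GU tT Ux).
  exact: sL (frame_at oU FU k Ux).
rewrite tr_swap//; congr (tr _ _); apply/funext => k; apply/esym.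
by apply: (tensorial_frame tB oU FU tL Ux); exact: sT (frame_at oU GU k Ux).
Qed.

End tensorial.

(** * Lie brackets of vector fields *)

Section lie.
Context (R : realType) (n : nat) (M : manifold R n).
Implicit Types (X Y Z : sec (TM M)) (x : M) (f : M -> R).

(** [lie] takes its value by choice; the second-order terms of the two composites cancel, so the
    commutator is a derivation and there is a value to choose. *)
Lemma lieE X Y x f : smooth_sec_at x X -> smooth_sec_at x Y -> smooth_at x f ->
  (lie X Y x : tangent x) f = X x (fun y => Y y f) - Y x (fun y => X y f).
Proof.
move=> sX sY; have XP h : smooth_at x h -> smooth_at x (fun y => X y h) by exact: smooth_TM_at.
have YP h : smooth_at x h -> smooth_at x (fun y => Y y h) by exact: smooth_TM_at.
have [||v vE] := @mk_tangent _ _ _ x (fun f => X x (fun y => Y y f) - Y x (fun y => X y f)).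
- move=> a f' g sf sg.
  have e Z1 : \forall y \near x, Z1 y (fun y => a * f' y + g y) = a * Z1 y f' + Z1 y g.
    by apply: filterS2 (smooth_at_near sf) (smooth_at_near sg) => y sf' sg'; rewrite tangent_lin.
  rewrite (tangent_near _ (e Y)) (tangent_near _ (e X)) !tangent_lin//; [|exact: XP..|exact: YP|exact: YP].
  by ring.
- move=> f' g sf sg.
  have e Z1 : \forall y \near x, Z1 y (fun y => f' y * g y) = f' y * Z1 y g + g y * Z1 y f'.
    by apply: filterS2 (smooth_at_near sf) (smooth_at_near sg) => y sf' sg'; rewrite tangent_mul.
  have [sXf sXg sYf sYg] := And4 (XP _ sf) (XP _ sg) (YP _ sf) (YP _ sg).
  rewrite (tangent_near _ (e Y)) (tangent_near _ (e X)) !tangent_add ?tangent_mul//; try exact: smooth_at_mul.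
  by ring.
move=> sf; rewrite /lie; case: xgetP => [w _ wE|/(_ v)[]//]; exact: wE.
Qed.

Lemma lie_near X X' Y x : smooth_sec_at x X -> smooth_sec_at x Y ->
  (\forall y \near x, X y = X' y) -> lie X Y x = lie X' Y x.
Proof.
move=> sX sY XX'; apply: tangent_ext => f sf; have sX' := sec_at_eq (TM_tame M) XX' sX.
rewrite !lieE// (nbhs_singleton XX'); congr (_ - _); apply: tangent_near.
by apply: filterS XX' => y ->.
Qed.

Lemma lie_smooth X Y x : smooth_sec_at x X -> smooth_sec_at x Y ->
  smooth_sec_at x (lie X Y).
Proof.
move=> sX sY; have [U [oU Ux] UX] := near_open (sec_at_near sX).
have [V [oV Vx] VY] := near_open (sec_at_near sY).
have oI := openI oU oV; exists (U `&` V) => // W f oW WUV sf.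
apply: smooth_atP => // y Wy; have [Uy Vy] := WUV _ Wy.
have s' Z : (forall y, W y -> smooth_sec_at y Z) -> forall y, W y -> smooth_at y (fun y => Z y f).
  by move=> sZ z Wz; apply: smooth_TM_at (sZ z Wz) _; exact: smooth_at_open sf.
apply: (@smooth_at_eq _ _ _ _ (fun y => X y (fun y => Y y f) + - Y y (fun y => X y f))).
  apply: filterS (nbhs_open oW Wy) => z Wz; have [Uz Vz] := WUV _ Wz.
  by rewrite lieE//; [exact: UX|exact: VY|exact: smooth_at_open sf].
apply: smooth_at_add; [|apply: smooth_at_opp]; apply: smooth_TM_at.
- exact: UX.
- by apply: s' => // z /WUV[_ Vz]; exact: VY.
- exact: VY.
- by apply: s' => // z /WUV[Uz _]; exact: UX.
Qed.

Lemma lie_first_order X x : smooth_sec_at x X ->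
  first_order (B := TM M) (X x) id (fun Y => lie X Y x).
Proof.
move=> sX; have XP h : smooth_at x h -> smooth_at x (fun y => X y h) by exact: smooth_TM_at.
split=> [Y Z sY sZ|g Y sg sY]; apply: tangent_ext => f sf.
  have [sXf sYf sZf] := And3 (XP _ sf) (smooth_TM_at sY sf) (smooth_TM_at sZ sf).
  rewrite tangentD !lieE//; last exact: (sec_at_add (TM_tame M)).
  rewrite (_ : (fun z => (Y z + Z z : tangent z) f) = (fun z => Y z f + Z z f))//.
  by rewrite tangent_add// tangentD; ring.
have [sXf sYf] := conj (XP _ sf) (smooth_TM_at sY sf).
rewrite tangentD !tangentZ !lieE//; last exact: (sec_at_scale (TM_tame M)).
rewrite (_ : (fun z => (g z *: Y z : tangent z) f) = (fun z => g z * Y z f))//.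
by rewrite tangent_mul// tangentZ; ring.
Qed.

Lemma lie_scalel g X Y x : smooth_at x g -> smooth_sec_at x X -> smooth_sec_at x Y ->
  lie (fun y => g y *: X y) Y x = g x *: lie X Y x - Y x g *: X x.
Proof.
move=> sg sX sY; apply: tangent_ext => f sf.
have [sXf sYf] := conj (smooth_TM_at sX sf) (smooth_TM_at sY sf).
rewrite tangentD tangentN !tangentZ !lieE//; last exact: (sec_at_scale (TM_tame M)).
rewrite (_ : (fun z => (g z *: X z : tangent z) f) = (fun z => g z * X z f))//.
by rewrite tangent_mul// tangentZ; ring.
Qed.

Lemma lie_addl X Y Z x : smooth_sec_at x X -> smooth_sec_at x Y -> smooth_sec_at x Z ->
  lie (fun y => X y + Y y) Z x = lie X Z x + lie Y Z x.
Proof.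
move=> sX sY sZ; apply: tangent_ext => f sf.
have [sXf sYf] := conj (smooth_TM_at sX sf) (smooth_TM_at sY sf).
rewrite tangentD !lieE//; last exact: (sec_at_add (TM_tame M)).
rewrite (_ : (fun z => (X z + Y z : tangent z) f) = (fun z => X z f + Y z f))//.
by rewrite tangent_add// tangentD; ring.
Qed.

Lemma lie_jacobi X Y Z x : smooth_sec_at x X -> smooth_sec_at x Y ->
  smooth_sec_at x Z ->
  lie (lie X Y) Z x = lie X (lie Y Z) x - lie Y (lie X Z) x.
Proof.
move=> sX sY sZ; apply: tangent_ext => f sf.
have [sXY sYZ sXZ] := And3 (lie_smooth sX sY) (lie_smooth sY sZ) (lie_smooth sX sZ).
have near_lie X1 Y1 : smooth_sec_at x X1 -> smooth_sec_at x Y1 ->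
    \forall y \near x, (lie X1 Y1 y : tangent y) f = X1 y (fun y => Y1 y f) - Y1 y (fun y => X1 y f).
  move=> s1 s2; apply: filterS3 (sec_at_near s1) (sec_at_near s2) (smooth_at_near sf).
  by move=> y ? ? ?; rewrite lieE.
have [sXf sYf sZf] := And3 (smooth_TM_at sX sf) (smooth_TM_at sY sf) (smooth_TM_at sZ sf).
have sub X1 Y1 Z1 : smooth_sec_at x X1 -> smooth_sec_at x Y1 -> smooth_sec_at x Z1 ->
   Z1 x (fun y => (lie X1 Y1 y : tangent y) f) = Z1 x (fun y => X1 y (fun y => Y1 y f)) - Z1 x (fun y => Y1 y (fun y => X1 y f)).
  move=> s1 s2 s3; rewrite (tangent_near _ (near_lie _ _ s1 s2)) tangent_add ?tangent_opp//.
  - by apply: smooth_TM_at => //; exact: smooth_TM_at.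
  - by apply: smooth_TM_at => //; exact: smooth_TM_at.
  - by apply: smooth_at_opp; apply: smooth_TM_at => //; exact: smooth_TM_at.
rewrite tangentD tangentN !lieE// !sub//.
by ring.
Qed.

End lie.

(** * Brackets of germs of sections *)

Lemma fib_rk0 R n (M : manifold R n) (B : vbundle M) x (v : fib B x) : rk B = 0 -> v = 0.
Proof.
move=> r0; have [i dx] := triv_cover B x; have [g gK _] := triv_bij dx.
rewrite -(gK v) -(gK 0); congr (g _); apply/rowP => k.
by have := ltn_ord k; rewrite [X in (_ < X)%N]r0.
Qed.

Section germ_brackets.
Context (R : realType) (n : nat) (M : manifold R n) (A : lie_inf M).
Local Notation gsec := (gsec (E A)).
Implicit Types (u v : gsec) (us ts : seq gsec) (x y : M) (U V W : set M) (f : M -> R).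

Let tE i : tame (E A i) := vbundle_tame (E A i).

Lemma gsecP u v : (forall i x, u i x = v i x) -> u = v.
Proof.
by move=> uv; do 2!apply: functional_extensionality_dep => ?; exact: uv.
Qed.

Definition gsmooth_at x u := exists2 U, open U /\ U x & gsmooth U u.

Lemma gsmooth_comb U f u v : open U -> smooth U f -> gsmooth U u -> gsmooth U v ->
  gsmooth U (gcomb f u v).
Proof. by move=> oU sf su sv i; apply: (tame_comb (tE i)). Qed.

Lemma gsmooth_zero U : open U -> gsmooth U (fun i x => 0 : fib (E A i) x).
Proof. by move=> oU i; apply: (tame_zero (tE i)). Qed.

Lemma gsmooth_eq U u v : open U -> (forall x, U x -> forall i, u i x = v i x) ->
  gsmooth U u -> gsmooth U v.
Proof. by move=> oU uv su i; apply: (tame_eq (tE i)) (su i) => // x /uv. Qed.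

Lemma gsmooth_scale U f u : open U -> smooth U f -> gsmooth U u -> gsmooth U (gscale f u).
Proof.
move=> oU sf su; apply: gsmooth_eq (gsmooth_comb oU sf su (gsmooth_zero oU)) => //.
by move=> x _ i; rewrite /gcomb addr0.
Qed.

Lemma gsmooth_sub U V u : V `<=` U -> gsmooth U u -> gsmooth V u.
Proof. by move=> VU su i; apply: (tame_sub (tE i)) (su i). Qed.

Lemma gsmooth_incl U i (s : sec (E A i)) : open U -> smooth_sec U s -> gsmooth U (incl s).
Proof.
move=> oU ss j; have [<-|ij] := eqVneq i j; first by rewrite /incl dfwithin.
rewrite /incl dfwithout//; exact: (tame_zero (tE j)).
Qed.

Lemma gsmooth_at_incl x i (s : sec (E A i)) : smooth_sec_at x s -> gsmooth_at x (incl s).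
Proof. by move=> [U [oU Ux] ss]; exists U => //; exact: gsmooth_incl. Qed.

Lemma inclE i (s : sec (E A i)) : incl s i = s.
Proof. exact: dfwithin. Qed.

Lemma inclN i j (s : sec (E A i)) x : j != i -> incl s j x = 0.
Proof. by move=> ji; rewrite /incl dfwithout// eq_sym. Qed.

Lemma homog_incl i (s : sec (E A i)) : homog i.+1 (incl s).
Proof. by move=> j; rewrite eqSS => ji x; rewrite inclN. Qed.

Lemma homog_scale d f u : homog d u -> homog d (gscale f u).
Proof. by move=> hu i id x; rewrite /gscale hu// scaler0. Qed.

(* Multiplication by phi makes sections global without changing them on W. *)
Definition extends (phi : M -> R) W := [/\ smooth setT phi, open W & forall y, W y -> phi y = 1].

Lemma extension U x : open U -> U x -> exists phi W, [/\ extends phi W, W x,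
  forall u, gsmooth U u -> gsmooth setT (gscale phi u) &
  forall f, smooth U f -> smooth setT (fun y => phi y * f y)].
Proof.
move=> oU Ux; have [phi [sphi /near_open[W [oW Wx] phi1] phi0]] := bump oU Ux.
exists phi, W; split=> // [u su i|f sf].
  apply: (tame_local (tE i)) => [|y _]; first exact: openT.
  have [Uy|/near_open[V [oV Vy] V0]] := phi0 y.
    exists U; split=> //; apply: gsmooth_scale => //.
    exact: smooth_sub sphi.
  exists V; split=> //; apply: (tame_eq (tE i)) (tame_zero (tE i) oV) => // z Vz.
  by rewrite /gscale V0// scale0r.
apply: smooth_local => y _.
have [Uy|/near_open[V [oV Vy] V0]] := phi0 y.
  exists U => //; apply: smooth_mul => //; exact: smooth_sub sphi.
exists V => //; apply: smooth_eq (smooth_cst V 0) => // z Vz.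
by rewrite V0// mul0r.
Qed.

Lemma gsmooth_at_all x us : List.Forall (gsmooth_at x) us ->
  exists2 U, open U /\ U x & List.Forall (gsmooth U) us.
Proof.
elim => [|u {}us [V [oV Vx] su] _ [U [oU Ux] sus]].
  by exists setT => //; split=> //; exact: openT.
exists (V `&` U); first by split=> //; exact: openI.
apply: List.Forall_cons; first by apply: gsmooth_sub su => y [].
by apply: List.Forall_impl sus => t; apply: gsmooth_sub => y [].
Qed.

Lemma brk_zero (s1 s2 : seq gsec) : List.Forall (gsmooth setT) (s1 ++ s2) ->
  brk (s1 ++ (fun i x => 0 : fib (E A i) x) :: s2) = (fun i x => 0).
Proof.
move=> /List.Forall_app[h1 h2]; set z : gsec := fun i x => 0.
have sz : gsmooth setT z by apply: gsmooth_zero; exact: openT.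
have := @brk_linear _ _ _ A s1 s2 (-1) z z.
have -> : gcomb (fun=> -1) z z = z by apply: gsecP => i x; rewrite /gcomb /z scaler0 addr0.
move=> ->; last by apply/List.Forall_app; split=> //; do !apply: List.Forall_cons.
by apply: gsecP => i x; rewrite /gcomb scaleN1r addNr.
Qed.

(** The factor is 1 minus a bump supported where [u] vanishes. It turns a statement about supports
    into one about O-linearity. *)
Lemma vanishing_factor u x : (\forall y \near x, forall i, u i y = 0) ->
  exists f, [/\ smooth setT f, \forall y \near x, f y = 0 & u = gscale f u].
Proof.
move=> /near_open[W [oW Wx] u0]; have [phi [sphi phi1 phi0]] := bump oW Wx.
exists (fun y => 1 + (-1) * phi y); split.
- do ?[exact: openT|apply: smooth_add|apply: smooth_mul] => //; exact: smooth_cst.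
- by apply: filterS phi1 => y ->; rewrite mulr1 subrr.
apply: gsecP => i y; rewrite /gscale.
have [Wy|/nbhs_singleton ->] := phi0 y; first by rewrite u0// scaler0.
by rewrite mulr0 addr0 scale1r.
Qed.

Lemma brk_vanish_last u v x k : gsmooth setT u -> gsmooth setT v ->
  (\forall y \near x, forall i, u i y = 0) -> brk [:: v; u] k x = 0.
Proof.
move=> su sv /[dup] /nbhs_singleton u0 /vanishing_factor[f [sf f0 uE]].
rewrite uE brk_leibniz// /gcomb /gscale (tangent_near _ f0) tangent_cst.
by rewrite (nbhs_singleton f0) !scale0r addr0.
Qed.

(** Finite depth makes [u] the finite sum of its components, reached by truncation. This reduces to
    homogeneous sections, the only ones for which symmetry of the brackets is postulated. *)
Lemma gsec_ind (P : gsec -> Prop) u : gsmooth setT u ->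
  P (fun i x => 0) ->
  (forall t s, gsmooth setT t -> gsmooth setT s -> P t -> P s -> P (gcomb (fun=> 1) t s)) ->
  (forall i, P (incl (u i))) -> P u.
Proof.
move=> su P0 PD Pi; have sz : gsmooth setT (fun i x => 0 : fib (E A i) x).
  exact/gsmooth_zero/openT.
pose trunc m : gsec := fun i x => if (i < m)%N then u i x else 0.
suff h m : gsmooth setT (trunc m) /\ P (trunc m).
  have -> : u = trunc (depth A) by apply: gsecP => i x; rewrite /trunc; case: ltnP => // di; apply: fib_rk0; exact: rk_depth.
  by have [] := h (depth A).
elim: m => [|m [sm Pm]]; first by split.
have -> : trunc m.+1 = gcomb (fun=> 1) (incl (u m)) (trunc m).
  apply: gsecP => i x; rewrite /gcomb scale1r /trunc ltnS leq_eqVlt.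
  have [->|im] := eqVneq i m; first by rewrite inclE ltnn addr0.
  by rewrite inclN// add0r.
have sim : gsmooth setT (incl (u m)) by apply: gsmooth_incl => //; exact: openT.
split; last exact: PD.
by apply: gsmooth_comb => //; [exact: openT|exact: smooth_cst].
Qed.

(* The Leibniz rule only bears on the last argument of the binary bracket;
   symmetry, which holds for homogeneous arguments, transfers it to the first. *)
Lemma brk_vanish_first u v x k : gsmooth setT u -> gsmooth setT v ->
  (\forall y \near x, forall i, u i y = 0) -> brk [:: u; v] k x = 0.
Proof.
move=> su sv u0.
have sz : gsmooth setT (fun i x => 0 : fib (E A i) x) by exact/gsmooth_zero/openT.
have si (t : gsec) i : gsmooth setT t -> gsmooth setT (incl (t i)).
  move=> st; apply: (@gsmooth_incl setT i (t i)) => //; exact: openT.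
suff : gsmooth setT u /\ brk [:: u; v] k x = 0 by case.
apply: (@gsec_ind (fun w => gsmooth setT w /\ brk [:: w; v] k x = 0) u su).
- by split=> //; rewrite (@brk_zero [::] [:: v])//; do ?[exact: List.Forall_nil|apply: List.Forall_cons].
- move=> t s st ss [_ bt] [_ bs]; split.
    by apply: gsmooth_comb => //; [exact: openT|exact: smooth_cst].
  rewrite (@brk_linear _ _ _ A [::] [:: v]); last by do ?[exact: List.Forall_nil|apply: List.Forall_cons].
  by rewrite /gcomb /= bt bs scaler0 addr0.
move=> i; split; first exact: si.
suff : gsmooth setT v /\ brk [:: incl (u i); v] k x = 0 by case.
apply: (@gsec_ind (fun w => gsmooth setT w /\ brk [:: incl (u i); w] k x = 0) v sv).
- by split=> //; rewrite (@brk_zero [:: incl (u i)] [::])//; do ?[exact: List.Forall_nil|apply: List.Forall_cons] => //; exact: si.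
- move=> t s st ss [_ bt] [_ bs]; split.
    by apply: gsmooth_comb => //; [exact: openT|exact: smooth_cst].
  rewrite (@brk_linear _ _ _ A [:: incl (u i)] [::]); last by do ?[exact: List.Forall_nil|apply: List.Forall_cons] => //; exact: si.
  by rewrite /gcomb /= bt bs scaler0 addr0.
move=> j; split; first exact: si.
rewrite (@brk_symmetric _ _ _ A [::] [::] _ _ i.+1 j.+1); [|by do ?[exact: List.Forall_nil|apply: List.Forall_cons] => //; exact: si|exact: homog_incl..].
rewrite /gscale brk_vanish_last ?scaler0//; [exact: si..|].
apply: filterS u0 => y uy l; have [->|li] := eqVneq l i; first by rewrite inclE.
by rewrite inclN.
Qed.

Lemma brk_vanish s1 s2 u x k : List.Forall (gsmooth setT) (s1 ++ u :: s2) ->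
  (\forall y \near x, forall i, u i y = 0) -> brk (s1 ++ u :: s2) k x = 0.
Proof.
move=> sus u0; have [h1 h] := (List.Forall_app _ _ _).1 sus.
(* A total of one other argument means the binary bracket, which obeys the Leibniz rule; the other
   arities are O-linear. *)
have [s12|] := eqVneq (size s1 + size s2)%N 1; last first.
  move=> s12; have [f [sf f0 uE]] := vanishing_factor u0.
  by rewrite uE brk_Olinear// /gscale (nbhs_singleton f0) scale0r.
inversion h as [|? ? su h2]; subst.
case: s1 s2 h1 h2 s12 {h sus} => [|v [|? ?]] [|v' [|? ?]]// h1 h2 _.
  by inversion h2; subst; exact: brk_vanish_first.
by inversion h1; subst; exact: brk_vanish_last.
Qed.

(** Arguments are replaced one at a time, [s1] collecting those already treated; each replacement
    changes the bracket by that of a section vanishing near [x]. *)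
Lemma brk_local s1 ts ts' x k : List.Forall (gsmooth setT) s1 ->
  List.Forall2 (fun t t' => [/\ gsmooth setT t, gsmooth setT t' &
    \forall y \near x, forall i, t i y = t' i y]) ts ts' ->
  brk (s1 ++ ts) k x = brk (s1 ++ ts') k x.
Proof.
move=> + tt'; elim: tt' s1 => // t t' {}ts {}ts' [st st' tt'] tts IH s1 ss1.
have sts : List.Forall (gsmooth setT) ts by elim: tts {IH} => // a b l l' [sa _ _] _ IH; apply: List.Forall_cons.
rewrite -[in RHS]cat_rcons -IH; last first.
  by rewrite -cats1; apply/List.Forall_app; split=> //; apply: List.Forall_cons.
rewrite cat_rcons; pose w := gcomb (fun=> -1) t' t.
have sw : gsmooth setT w by apply: gsmooth_comb => //; [exact: openT|exact: smooth_cst].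
have -> : t = gcomb (fun=> 1) w t'.
  by apply: gsecP => i y; rewrite /w /gcomb scaleN1r scale1r addrAC addNr add0r.
rewrite brk_linear; last by apply/List.Forall_app; split=> //; do !apply: List.Forall_cons.
rewrite /gcomb brk_vanish ?scaler0 ?add0r//.
  by apply/List.Forall_app; split=> //; do !apply: List.Forall_cons.
by apply: filterS tt' => y e i; rewrite /w /gcomb e scaleN1r addNr.
Qed.

(** By locality, all families of global extensions give the same value, so the choice made in [lbrk]
    is immaterial. *)
Lemma lbrkE ts us x k : List.Forall2 (fun t u => gsmooth setT t /\
   \forall y \near x, forall i, t i y = u i y) ts us ->
  lbrk us k x = brk ts k x.
Proof.
move=> tu; rewrite /lbrk; case: xgetP => [v _ [ts' t'u ->]|/(_ (brk ts k x))]; last by case; exists ts.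
apply: (@brk_local [::]) => //; elim: tu ts' t'u => [|t u {}ts {}us [st tu] _ IH] ts' h.
  by inversion h.
inversion h as [|t' u' l l' [st' t'u] h']; subst; apply: List.Forall2_cons; last exact: IH.
by split=> //; apply: filterS2 t'u tu => y e e' i; rewrite e e'.
Qed.

Lemma lbrk_extends phi W us y k : extends phi W -> W y ->
  List.Forall (fun u => gsmooth setT (gscale phi u)) us ->
  lbrk us k y = brk (map (gscale phi) us) k y.
Proof.
move=> [_ oW phi1] Wy sus; apply: lbrkE; elim: sus => // u {}us su _ IH.
apply: List.Forall2_cons => //; split=> //.
by apply: filterS (nbhs_open oW Wy) => z Wz i; rewrite /gscale phi1// scale1r.
Qed.

Lemma extension_all x us : List.Forall (gsmooth_at x) us ->
  exists phi W, [/\ extends phi W, W x & List.Forall (fun u => gsmooth setT (gscale phi u)) us].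
Proof.
move=> /gsmooth_at_all[U [oU Ux] sus]; have [phi [W [ext Wx sphi _]]] := extension oU Ux.
by exists phi, W; split=> //; apply: List.Forall_impl sus.
Qed.

Lemma gsmooth_at_lbrk x us : List.Forall (gsmooth_at x) us -> gsmooth_at x (lbrk us).
Proof.
move=> /extension_all[phi [W [ext Wx sus]]]; have [_ oW _] := ext; exists W => //.
have sb : gsmooth setT (brk (map (gscale phi) us)).
  by apply: brk_smooth; exact/List.Forall_map.
apply: gsmooth_eq (gsmooth_sub (fun _ _ => I) sb) => // y Wy i.
by rewrite (lbrk_extends _ ext).
Qed.

Lemma gsmooth_atE x u i : gsmooth_at x u -> smooth_sec_at x (u i).
Proof. by move=> [U ? su]; exists U. Qed.

Lemma lbrk_near us us' x k : List.Forall (gsmooth_at x) us ->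
  List.Forall2 (fun u u' => \forall y \near x, forall i, u i y = u' i y) us us' ->
  lbrk us k x = lbrk us' k x.
Proof.
move=> /extension_all[phi [W [ext Wx sus]]] uu'; rewrite (lbrk_extends _ ext)//.
have [_ oW phi1] := ext.
apply/esym/lbrkE; elim: uu' sus => // u u' {}us {}us' uu' _ IH sus.
inversion sus; subst; apply: List.Forall2_cons; last exact: IH.
split=> //; apply: filterS2 uu' (nbhs_open oW Wx) => y uy Wy i.
by rewrite /gscale phi1// scale1r.
Qed.

Lemma lbrk_linear s1 s2 (a : R) u v x k :
  List.Forall (gsmooth_at x) (s1 ++ u :: v :: s2) ->
  lbrk (s1 ++ gcomb (fun=> a) u v :: s2) k x =
  a *: lbrk (s1 ++ u :: s2) k x + lbrk (s1 ++ v :: s2) k x.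
Proof.
move=> /extension_all[phi [W [ext Wx]]] /List.Forall_app[h1 h].
inversion h as [|? ? su h']; inversion h' as [|? ? sv h2]; subst.
have e : gscale phi (gcomb (fun=> a) u v) = gcomb (fun=> a) (gscale phi u) (gscale phi v).
  by apply: gsecP => i y; rewrite /gscale /gcomb scalerDr !scalerA mulrC.
have sc : gsmooth setT (gscale phi (gcomb (fun=> a) u v)).
  by rewrite e; apply: gsmooth_comb => //; [exact: openT|exact: smooth_cst].
rewrite !(lbrk_extends _ ext)//; try by apply/List.Forall_app; split=> //; exact: List.Forall_cons.
rewrite !map_cat /= e brk_linear//.
by apply/List.Forall_app; split; [exact/List.Forall_map|do !apply: List.Forall_cons => //; exact/List.Forall_map].
Qed.

Lemma lbrk_symmetric s1 s2 u v p q x k :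
  List.Forall (gsmooth_at x) (s1 ++ u :: v :: s2) -> homog p u -> homog q v ->
  lbrk (s1 ++ u :: v :: s2) k x = (-1) ^+ (p * q) *: lbrk (s1 ++ v :: u :: s2) k x.
Proof.
move=> /extension_all[phi [W [ext Wx]]] /List.Forall_app[h1 h] hu hv.
inversion h as [|? ? su h']; inversion h' as [|? ? sv h2]; subst.
rewrite !(lbrk_extends _ ext)//; try by apply/List.Forall_app; split=> //; do !apply: List.Forall_cons.
rewrite !map_cat /= (@brk_symmetric _ _ _ A _ _ _ _ p q)//; try exact: homog_scale.
by apply/List.Forall_app; split; [exact/List.Forall_map|do !apply: List.Forall_cons => //; exact/List.Forall_map].
Qed.

Lemma lbrk_degree ds us x k : (0 < size us)%N -> List.Forall (gsmooth_at x) us ->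
  List.Forall2 (@homog _ _ _ (E A)) ds us -> k.+1 != (sumn ds).-1 -> lbrk us k x = 0.
Proof.
move=> us0 /extension_all[phi [W [ext Wx sus]]] dus kd; rewrite (lbrk_extends _ ext)//.
apply: (@brk_degree _ _ _ A ds) => //; first by rewrite size_map.
- exact/List.Forall_map.
- by elim: dus {us0 sus kd} => [|d u {}ds {}us hu _ IH]; [exact: List.Forall2_nil|apply: List.Forall2_cons => //; exact: homog_scale].
Qed.

Lemma lbrk_extension x us f : List.Forall (gsmooth_at x) us -> smooth_at x f ->
  exists (h : gsec -> gsec) g, [/\ smooth setT g, \forall y \near x, g y = f y,
   (forall u, \forall y \near x, forall i, h u i y = u i y) &
   List.Forall (fun u => gsmooth setT (h u)) us].
Proof.
move=> /gsmooth_at_all[U [oU Ux] sus] [V [oV Vx] sf].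
have [||phi [W [[sphi oW phi1] Wx su sg]]] := @extension (U `&` V) x; [exact: openI|by []|].
exists (gscale phi), (fun y => phi y * f y); split.
- by apply: sg; apply: smooth_sub sf => y [].
- by apply: filterS (nbhs_open oW Wx) => y /phi1 ->; rewrite mul1r.
- by move=> u; apply: filterS (nbhs_open oW Wx) => y /phi1 e i; rewrite /gscale e scale1r.
- by apply: List.Forall_impl sus => t st; apply: su; apply: gsmooth_sub st => y [].
Qed.

Lemma Forall2_map (h : gsec -> gsec) us x : (forall u, \forall y \near x, forall i, h u i y = u i y) ->
  List.Forall (fun u => gsmooth setT (h u)) us ->
  List.Forall2 (fun t u => gsmooth setT t /\ \forall y \near x, forall i, t i y = u i y) (map h us) us.
Proof.
by move=> hh; elim=> [|u {}us su _ IH]; [exact: List.Forall2_nil|apply: List.Forall2_cons].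
Qed.

Lemma near_scale (h : gsec -> gsec) g f u x : (forall u, \forall y \near x, forall i, h u i y = u i y) ->
  (\forall y \near x, g y = f y) ->
  \forall y \near x, forall i, gscale g (h u) i y = gscale f u i y.
Proof. by move=> hh gf; apply: filterS2 (hh u) gf => y e e' i; rewrite /gscale e e'. Qed.

Lemma lbrk_Olinear s1 s2 f u x k : (size s1 + size s2 != 1)%N -> smooth_at x f ->
  List.Forall (gsmooth_at x) (s1 ++ u :: s2) ->
  lbrk (s1 ++ gscale f u :: s2) k x = f x *: lbrk (s1 ++ u :: s2) k x.
Proof.
move=> s12 sf sus; have [h [g [sg gf hh shu]]] := lbrk_extension sus sf.
have [h1 h'] := (List.Forall_app _ _ _).1 shu; inversion h' as [|? ? su h2]; subst.
rewrite (lbrkE k (Forall2_map hh shu)).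
rewrite (@lbrkE (map h s1 ++ gscale g (h u) :: map h s2)); last first.
  apply: List.Forall2_app; first exact: Forall2_map.
  apply: List.Forall2_cons; last exact: Forall2_map.
  by split; [apply: gsmooth_scale => //; exact: openT|exact: near_scale].
rewrite brk_Olinear ?size_map//; first by rewrite /gscale (nbhs_singleton gf) map_cat.
by apply/List.Forall_app; split; [exact/List.Forall_map|do !apply: List.Forall_cons => //; exact/List.Forall_map].
Qed.

Lemma lbrk_leibniz f u v x k : smooth_at x f -> gsmooth_at x u -> gsmooth_at x v ->
  lbrk [:: u; gscale f v] k x =
  f x *: lbrk [:: u; v] k x + anchor (u 0%N x) f *: v k x.
Proof.
move=> sf su sv; have suv : List.Forall (gsmooth_at x) [:: u; v] by do !apply: List.Forall_cons.
have [h [g [sg gf hh shu]]] := lbrk_extension suv sf.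
inversion shu as [|? ? shu' h']; inversion h' as [|? ? shv h2]; subst.
rewrite (lbrkE k (Forall2_map hh shu)).
rewrite (@lbrkE [:: h u; gscale g (h v)]); last first.
  do !apply: List.Forall2_cons => //; split=> //; last exact: near_scale.
  by apply: gsmooth_scale => //; exact: openT.
rewrite brk_leibniz// /gcomb /gscale (nbhs_singleton gf) (nbhs_singleton (hh u)).
by rewrite (nbhs_singleton (hh v)) (tangent_near _ gf).
Qed.

Lemma lbrk_jacobi m (u : 'I_m -> gsec) (d : 'I_m -> nat) (x : M) k : (0 < m)%N ->
  (forall a, gsmooth_at x (u a)) -> (forall a, homog (d a) (u a)) ->
  \sum_(i < m.+1 | (0 < i)%N) \sum_(s : 'S_m | unshuffle i s)
    koszul R d s *:
    lbrk (lbrk [seq u (s a) | a : 'I_m <- enum 'I_m & (a < i)%N]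
         :: [seq u (s a) | a : 'I_m <- enum 'I_m & (i <= a)%N]) k x = 0.
Proof.
move=> m0 su hu.
have sus : List.Forall (gsmooth_at x) (codom u).
  by apply/List.Forall_map; elim: (enum _) => [|a l IH]; [exact: List.Forall_nil|exact: List.Forall_cons].
have [phi [W [ext Wx]]] := extension_all sus => /List.Forall_map sphi.
have su' a : gsmooth setT (gscale phi (u a)).
  have := mem_enum 'I_m a; elim: sphi => // b l sb _ IH; rewrite in_cons => /orP[/eqP->//|]; exact: IH.
rewrite -[RHS](@brk_jacobi _ _ _ A m (fun a => gscale phi (u a)) d m0 su' _ k x); last first.
  by move=> a; exact: homog_scale.
have sall (T : Type) (F : T -> 'I_m) l : List.Forall (fun t => gsmooth setT (gscale phi t)) [seq u (F a) | a <- l].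
  by elim: l => [|a l IH]; [exact: List.Forall_nil|exact: List.Forall_cons].
apply: eq_bigr => i i0; apply: eq_bigr => s us; congr (_ *: _).
have mapE l : map (gscale phi) [seq u (s a) | a : 'I_m <- l] = [seq gscale phi (u (s a)) | a <- l].
  by rewrite -map_comp.
(* With one cutoff for all arguments, the inner bracket of the extensions agrees with the inner
   local bracket on all of [W], hence is a legitimate extension of it in the outer bracket. *)
have [_ oW phi1] := ext; apply: lbrkE; rewrite -!mapE; apply: List.Forall2_cons.
  split; first by apply: brk_smooth; exact/List.Forall_map.
  by apply: filterS (nbhs_open oW Wx) => y Wy j; rewrite (lbrk_extends _ ext).
apply: Forall2_map => // t.
by apply: filterS (nbhs_open oW Wx) => y Wy j; rewrite /gscale phi1// scale1r.
Qed.

End germ_brackets.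

(** * Unshuffles of two and three elements *)

Section unshuffles.
Local Notation o0 := (ord0 : 'I_3).
Local Notation o1 := (lift ord0 ord0 : 'I_3).
Local Notation o2 := (lift ord0 (lift ord0 ord0) : 'I_3).

Lemma ord3P (P : 'I_3 -> Prop) : P o0 -> P o1 -> P o2 -> forall i, P i.
Proof.
move=> P0 P1 P2 [[|[|[|//]]] h].
- by rewrite (_ : Ordinal h = o0)//; apply: val_inj.
- by rewrite (_ : Ordinal h = o1)//; apply: val_inj.
- by rewrite (_ : Ordinal h = o2)//; apply: val_inj.
Qed.

Lemma ord2P (P : 'I_2 -> Prop) : P ord0 -> P (lift ord0 ord0) -> forall i, P i.
Proof.
move=> P0 P1 [[|[|//]] h].
  by rewrite (_ : Ordinal h = ord0)//; apply: val_inj.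
by rewrite (_ : Ordinal h = lift ord0 ord0)//; apply: val_inj.
Qed.

Lemma enum3 : enum 'I_3 = [:: o0; o1; o2].
Proof. by apply: (inj_map val_inj); rewrite val_enum_ord. Qed.

Lemma enum2 : enum 'I_2 = [:: ord0; lift ord0 ord0].
Proof. by apply: (inj_map val_inj); rewrite val_enum_ord. Qed.

(** The digits are the images of 0, 1, 2. Every permutation but the reversal is an unshuffle for
    some splitting. *)
Definition p012 : 'S_3 := 1%g.
Definition p021 : 'S_3 := tperm o1 o2.
Definition p102 : 'S_3 := tperm o0 o1.
Definition p120 : 'S_3 := (tperm o0 o1 * tperm o0 o2)%g.
Definition p201 : 'S_3 := (tperm o0 o2 * tperm o0 o1)%g.

Lemma perm3E :
  (((p012 o0 = o0) * (p012 o1 = o1) * (p012 o2 = o2)) *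
   ((p021 o0 = o0) * (p021 o1 = o2) * (p021 o2 = o1)) *
   ((p102 o0 = o1) * (p102 o1 = o0) * (p102 o2 = o2)) *
   ((p120 o0 = o1) * (p120 o1 = o2) * (p120 o2 = o0)) *
   ((p201 o0 = o2) * (p201 o1 = o0) * (p201 o2 = o1)))%type.
Proof. by do !split; apply: val_inj; rewrite /= ?permM ?permE /= ?permE. Qed.

Lemma unshuffle3 (i : nat) (s : 'S_3) : unshuffle i s =
  [&& ((1 < i) || (i <= 0))%N ==> (s o0 < s o1)%N,
      ((2 < i) || (i <= 0))%N ==> (s o0 < s o2)%N &
      ((2 < i) || (i <= 1))%N ==> (s o1 < s o2)%N].
Proof.
apply/forallP/and3P => [h|[h1 h2 h3]].
  split.
  - by have /forallP/(_ o1) := h o0.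
  - by have /forallP/(_ o2) := h o0.
  - by have /forallP/(_ o2) := h o1.
by apply: ord3P; apply/forallP; apply: ord3P.
Qed.

Lemma perm3_inj (s t : 'S_3) : s o0 = t o0 -> s o1 = t o1 -> s o2 = t o2 -> s = t.
Proof. by move=> h0 h1 h2; apply/permP; exact: ord3P. Qed.

Lemma big_unshuffle3 (V : nmodType) (f : 'S_3 -> V) :
  ((\sum_(s : 'S_3 | unshuffle 1 s) f s = (f p012 + f p102 + f p201)%R) *
   (\sum_(s : 'S_3 | unshuffle 2 s) f s = (f p012 + f p021 + f p120)%R) *
   (\sum_(s : 'S_3 | unshuffle 3 s) f s = f p012))%type.
Proof.
(* The images are later enumerated over all 27 triples; injectivity discards those that are not
   permutations. *)
have val3 (s : 'S_3) : [/\ s o0 != s o1, s o0 != s o2 & s o1 != s o2].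
  by split; rewrite (inj_eq perm_inj).
have sumE i (l : seq 'S_3) : uniq l -> (forall s, unshuffle i s = (s \in l)) ->
    \sum_(s : 'S_3 | unshuffle i s) f s = \sum_(s <- l) f s.
  by move=> ul il; rewrite big_uniq//; apply: eq_bigl => s; rewrite il.
have pP (s t : 'S_3) : (s == t) = [&& s o0 == t o0, s o1 == t o1 & s o2 == t o2].
  apply/eqP/and3P => [->//|[/eqP h0 /eqP h1 /eqP h2]]; exact: perm3_inj.
split; [split|].
- rewrite (sumE 1 [:: p012; p102; p201]) ?big_cons ?big_nil ?addr0 ?addrA//.
    by rewrite /= !inE !pP !perm3E.
  move=> s; rewrite unshuffle3 !inE !pP !perm3E; have [] := val3 s.
  by move: (s o0) (s o1) (s o2); do 3!apply: ord3P.
- rewrite (sumE 2 [:: p012; p021; p120]) ?big_cons ?big_nil ?addr0 ?addrA//.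
    by rewrite /= !inE !pP !perm3E.
  move=> s; rewrite unshuffle3 !inE !pP !perm3E; have [] := val3 s.
  by move: (s o0) (s o1) (s o2); do 3!apply: ord3P.
- rewrite (sumE 3 [:: p012]) ?big_cons ?big_nil ?addr0//.
  move=> s; rewrite unshuffle3 !inE !pP !perm3E; have [] := val3 s.
  by move: (s o0) (s o1) (s o2); do 3!apply: ord3P.
Qed.

Lemma big_unshuffle2 (V : nmodType) (f : 'S_2 -> V) :
  ((\sum_(s : 'S_2 | unshuffle 1 s) f s = (f 1%g + f (tperm ord0 (lift ord0 ord0)))%R) *
   (\sum_(s : 'S_2 | unshuffle 2 s) f s = f 1%g))%type.
Proof.
have val2 (s : 'S_2) : s ord0 != s (lift ord0 ord0) by rewrite (inj_eq perm_inj).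
have sumE i (l : seq 'S_2) : uniq l -> (forall s, unshuffle i s = (s \in l)) ->
    \sum_(s : 'S_2 | unshuffle i s) f s = \sum_(s <- l) f s.
  by move=> ul il; rewrite big_uniq//; apply: eq_bigl => s; rewrite il.
have pP (s t : 'S_2) : (s == t) = (s ord0 == t ord0) && (s (lift ord0 ord0) == t (lift ord0 ord0)).
  apply/eqP/andP => [->//|[/eqP h0 /eqP h1]]; apply/permP; exact: ord2P.
have unsh i (s : 'S_2) : unshuffle i s =
    (((1 < i) || (i <= 0))%N ==> (s ord0 < s (lift ord0 ord0))%N).
  apply/forallP/idP => [h|h]; first by have /forallP/(_ (lift ord0 ord0)) := h ord0.
  by apply: ord2P; apply/forallP; apply: ord2P.
have tE : ((tperm ord0 (lift ord0 ord0) : 'S_2) ord0 = lift ord0 ord0) *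
   ((tperm ord0 (lift ord0 ord0) : 'S_2) (lift ord0 ord0) = ord0).
  by rewrite tpermL tpermR.
split.
- rewrite (sumE 1 [:: 1%g; tperm ord0 (lift ord0 ord0)]) ?big_cons ?big_nil ?addr0//.
    by rewrite /= !inE pP !tE !perm1.
  move=> s; rewrite unsh !inE !pP !tE !perm1; have := val2 s.
  by move: (s ord0) (s (lift ord0 ord0)); do 2!apply: ord2P.
- rewrite (sumE 2 [:: 1%g]) ?big_cons ?big_nil ?addr0//.
  move=> s; rewrite unsh !inE !pP !perm1; have := val2 s.
  by move: (s ord0) (s (lift ord0 ord0)); do 2!apply: ord2P.
Qed.

Lemma koszul3 (R : realType) (d : 'I_3 -> nat) (s : 'S_3) : koszul R d s =
  (if (s o1 < s o0)%N then (-1) ^+ (d (s o0) * d (s o1)) else 1) *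
  (if (s o2 < s o0)%N then (-1) ^+ (d (s o0) * d (s o2)) else 1) *
  (if (s o2 < s o1)%N then (-1) ^+ (d (s o1) * d (s o2)) else 1).
Proof.
rewrite /koszul !big_ord_recl !big_ord0.
do 3!rewrite [\prod_(_ < 3 | _) _]big_mkcond !big_ord_recl !big_ord0 /=.
by rewrite !mulr1 !mul1r.
Qed.
End unshuffles.

(** * Jacobi identities of arities two and three *)

Section jacobi.
Context (R : realType) (n : nat) (M : manifold R n) (A : lie_inf M).
Local Notation gsec := (gsec (E A)).
Implicit Types (u v w : gsec) (x : M).
Local Notation o0 := (ord0 : 'I_3).
Local Notation o1 := (lift ord0 ord0 : 'I_3).
Local Notation o2 := (lift ord0 (lift ord0 ord0) : 'I_3).

(** The first two terms come from the unshuffles with a unary inner bracket, the third from the one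
    with a binary inner bracket. *)
Lemma jacobi2 u v p q k x : gsmooth_at x u -> gsmooth_at x v -> homog p u -> homog q v ->
  lbrk [:: lbrk [:: u]; v] k x + (-1) ^+ (q * p) *: lbrk [:: lbrk [:: v]; u] k x +
  lbrk [:: lbrk [:: u; v]] k x = 0.
Proof.
move=> su sv hu hv.
pose t (i : 'I_2) : gsec := nth u [:: u; v] i; pose d (i : 'I_2) := nth 0 [:: p; q] i.
pose G i := \sum_(s : 'S_2 | unshuffle i s) koszul R d s *:
    lbrk (lbrk [seq t (s a) | a : 'I_2 <- enum 'I_2 & (a < i)%N]
         :: [seq t (s a) | a : 'I_2 <- enum 'I_2 & (i <= a)%N]) k x.
have st a : gsmooth_at x (t a) by elim/ord2P: a.
have ht a : homog (d a) (t a) by elim/ord2P: a.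
have := lbrk_jacobi k (isT : 0 < 2)%N st ht.
rewrite -(big_mkord (fun i => 0 < i)%N G) /index_iota /= !big_cons big_nil /= addr0.
rewrite /G !big_unshuffle2 !enum2 /=.
rewrite !perm1 tpermL tpermR.
have kE (s : 'S_2) : koszul R d s =
  if (s (lift ord0 ord0) < s ord0)%N then (-1) ^+ (d (s ord0) * d (s (lift ord0 ord0))) else 1.
  rewrite /koszul !big_ord_recl !big_ord0.
  do 2!rewrite [\prod_(_ < 2 | _) _]big_mkcond !big_ord_recl !big_ord0 /=.
  by rewrite !mulr1 !mul1r.
by rewrite !kE !perm1 tpermL tpermR /= !scale1r.
Qed.

Lemma jacobi3 u v w p q r k x : gsmooth_at x u -> gsmooth_at x v -> gsmooth_at x w ->
  homog p u -> homog q v -> homog r w ->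
  (lbrk [:: lbrk [:: u]; v; w] k x +
   (-1) ^+ (q * p) *: lbrk [:: lbrk [:: v]; u; w] k x +
   ((-1) ^+ (r * p) * (-1) ^+ (r * q)) *: lbrk [:: lbrk [:: w]; u; v] k x) +
  (lbrk [:: lbrk [:: u; v]; w] k x +
   (-1) ^+ (r * q) *: lbrk [:: lbrk [:: u; w]; v] k x +
   ((-1) ^+ (q * p) * (-1) ^+ (r * p)) *: lbrk [:: lbrk [:: v; w]; u] k x) +
  lbrk [:: lbrk [:: u; v; w]] k x = 0.
Proof.
move=> su sv sw hu hv hw.
pose t (i : 'I_3) : gsec := nth u [:: u; v; w] i; pose d (i : 'I_3) := nth 0 [:: p; q; r] i.
pose G i := \sum_(s : 'S_3 | unshuffle i s) koszul R d s *:
    lbrk (lbrk [seq t (s a) | a : 'I_3 <- enum 'I_3 & (a < i)%N]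
         :: [seq t (s a) | a : 'I_3 <- enum 'I_3 & (i <= a)%N]) k x.
have st a : gsmooth_at x (t a) by elim/ord3P: a.
have ht a : homog (d a) (t a) by elim/ord3P: a.
have := lbrk_jacobi k (isT : 0 < 3)%N st ht.
rewrite -(big_mkord (fun i => 0 < i)%N G) /index_iota /= !big_cons big_nil /= addr0.
rewrite /G !big_unshuffle3 !enum3 /= !koszul3 !perm3E /=.
by rewrite !mulr1 !mul1r !scale1r addrA.
Qed.
End jacobi.

Ltac forall_incl :=
  do ?[exact: List.Forall_nil
      |apply: List.Forall_cons; first by exact: gsmooth_at_incl].

Ltac forall_homog :=
  do ?[exact: List.Forall2_nil
      |apply: List.Forall2_cons; first by exact: homog_incl].

(** * Operators obtained by fixing arguments of the brackets *)

Section operators.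
Context (R : realType) (n : nat) (M : manifold R n) (A : lie_inf M).
Local Notation E := (E A).
Implicit Types (x : M) (f : M -> R).

Let tE i : tame (E i) := vbundle_tame (E i).

Lemma incl_add i (s t : sec (E i)) :
  incl (E := E) (fun y => s y + t y) = gcomb (fun=> 1) (incl s) (incl t).
Proof.
apply: gsecP => j y; rewrite /gcomb scale1r.
have [->|ji] := eqVneq j i; first by rewrite !inclE.
by rewrite !inclN// addr0.
Qed.

Lemma incl_scale i f (s : sec (E i)) :
  incl (E := E) (fun y => f y *: s y) = gscale f (incl s).
Proof.
apply: gsecP => j y; rewrite /gscale.
have [->|ji] := eqVneq j i; first by rewrite !inclE.
by rewrite !inclN// scaler0.
Qed.

(* The operators of degree -1 whose supercommutators with l1 are the defects in
   [br2_l1] and [br2_br2]. *)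
Definition l2_op (e : sec (E 1)) i (s : sec (E i)) : sec (E i.+1) :=
  lbrk [:: incl e; incl s] i.+1.

Definition l3_op (e1 e2 : sec (E 0)) i (s : sec (E i)) : sec (E i.+1) :=
  lbrk [:: incl e1; incl e2; incl s] i.+1.

Lemma lbrk_add_last x us i (s t : sec (E i)) k : List.Forall (gsmooth_at x) us ->
  smooth_sec_at x s -> smooth_sec_at x t ->
  lbrk (us ++ [:: incl (E := E) (fun y => s y + t y)]) k x =
  lbrk (us ++ [:: incl s]) k x + lbrk (us ++ [:: incl t]) k x.
Proof.
move=> sus ss st; rewrite incl_add lbrk_linear ?scale1r//.
by apply/List.Forall_app; split=> //; forall_incl.
Qed.

Lemma lbrk_tensorial x us i k : (size us != 1)%N -> List.Forall (gsmooth_at x) us ->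
  tensorial (B := E i) x (fun s => lbrk (us ++ [:: incl s]) k x).
Proof.
move=> us1 sus; split=> [s t ss st|f s sf ss]; first exact: lbrk_add_last.
rewrite incl_scale lbrk_Olinear ?addn0 ?scaler0 ?addr0//.
by apply/List.Forall_app; split=> //; forall_incl.
Qed.

Lemma l1_tensorial x i : tensorial (B := E i.+1) x (fun s => l1 s x).
Proof. by apply: (@lbrk_tensorial x [::]) => //; exact: List.Forall_nil. Qed.

Lemma l3_tensorial x e1 e2 i : smooth_sec_at x e1 -> smooth_sec_at x e2 ->
  tensorial (B := E i) x (fun s => l3_op e1 e2 s x).
Proof. by move=> s1 s2; apply: (@lbrk_tensorial x [:: incl e1; incl e2]) => //; forall_incl. Qed.

(** The Leibniz term is a multiple of [s], which has no component in the degree of the value. *)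
Lemma l2_tensorial x e i : smooth_sec_at x e ->
  tensorial (B := E i) x (fun s => l2_op e s x).
Proof.
move=> se; split=> [s t ss st|f s sf ss].
  by apply: (@lbrk_add_last x [:: incl e]) => //; forall_incl.
rewrite /l2_op incl_scale lbrk_leibniz//; try exact: gsmooth_at_incl.
have -> : incl (E := E) s i.+1 x = 0 by rewrite inclN// gtn_eqF.
by rewrite scaler0 addr0 scaler0 addr0.
Qed.

Lemma br2_first_order x e i : smooth_sec_at x e ->
  first_order (B := E i) (rho e x) id (fun s => br2 e s x).
Proof.
move=> se; split=> [s t ss st|f s sf ss].
  by apply: (@lbrk_add_last x [:: incl e]) => //; forall_incl.
rewrite /br2 incl_scale lbrk_leibniz//; try exact: gsmooth_at_incl.
by rewrite !inclE.
Qed.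

Lemma l1_smooth x i (s : sec (E i.+1)) : smooth_sec_at x s -> smooth_sec_at x (l1 s).
Proof. by move=> ss; apply: (gsmooth_atE _ (gsmooth_at_lbrk _)); forall_incl. Qed.

Lemma br2_smooth x e i (s : sec (E i)) : smooth_sec_at x e -> smooth_sec_at x s ->
  smooth_sec_at x (br2 e s).
Proof. by move=> se ss; apply: (gsmooth_atE _ (gsmooth_at_lbrk _)); forall_incl. Qed.

Lemma l2_smooth x e i (s : sec (E i)) : smooth_sec_at x e -> smooth_sec_at x s ->
  smooth_sec_at x (l2_op e s).
Proof. by move=> se ss; apply: (gsmooth_atE _ (gsmooth_at_lbrk _)); forall_incl. Qed.

Lemma l3_smooth x e1 e2 i (s : sec (E i)) : smooth_sec_at x e1 -> smooth_sec_at x e2 ->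
  smooth_sec_at x s -> smooth_sec_at x (l3_op e1 e2 s).
Proof. by move=> s1 s2 ss; apply: (gsmooth_atE _ (gsmooth_at_lbrk _)); forall_incl. Qed.

Lemma rho_smooth x (e : sec (E 0)) : smooth_sec_at x e -> smooth_sec_at (B := TM M) x (rho (A := A) e).
Proof. by move=> [U [oU Ux] se]; exists U => //; exact: anchor_smooth. Qed.

Lemma br2_antisym x (e s : sec (E 0)) : smooth_sec_at x e -> smooth_sec_at x s ->
  br2 e s x = - br2 s e x.
Proof.
move=> se ss; rewrite /br2 (@lbrk_symmetric _ _ _ A [::] [::] _ _ 1 1) ?scaleN1r//; try exact: homog_incl.
by forall_incl.
Qed.

Lemma br2_sym x i (e : sec (E 0)) (s : sec (E i)) : smooth_sec_at x e -> smooth_sec_at x s ->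
  br2 e s x = (-1) ^+ i.+1 *: lbrk [:: incl s; incl e] i x.
Proof.
move=> se ss; rewrite /br2 (@lbrk_symmetric _ _ _ A [::] [::] _ _ 1 i.+1) ?mul1n//; try exact: homog_incl.
by forall_incl.
Qed.

Lemma br2_addl x i (e e' : sec (E 0)) (s : sec (E i)) : smooth_sec_at x e ->
  smooth_sec_at x e' -> smooth_sec_at x s ->
  br2 (fun y => e y + e' y) s x = br2 e s x + br2 e' s x.
Proof.
move=> se se' ss; rewrite /br2 incl_add (@lbrk_linear _ _ _ A [::]) ?scale1r//.
by forall_incl.
Qed.

(** The Leibniz rule in the first argument, by symmetry. Both occurrences of [incl] vanish unless
    [i = 0], so the extra term concerns E_{-1} alone. *)
Lemma br2_scalel x i f (e : sec (E 0)) (s : sec (E i)) : smooth_at x f ->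
  smooth_sec_at x e -> smooth_sec_at x s ->
  br2 (fun y => f y *: e y) s x =
  f x *: br2 e s x + ((-1) ^+ i.+1 * anchor (incl (E := E) s 0%N x) f) *: incl (E := E) e i x.
Proof.
move=> sf se ss; rewrite !br2_sym//; last exact: (sec_at_scale (tE 0)).
rewrite incl_scale lbrk_leibniz//; try exact: gsmooth_at_incl.
by rewrite scalerDr !scalerA mulrC.
Qed.

(** A bracket of homogeneous sections sits in a single degree; written as an [incl], it can be fed
    to another operator. *)
Lemma lbrk_homog x ds us i : List.Forall (gsmooth_at x) us -> (0 < size us)%N ->
  List.Forall2 (@homog _ _ _ E) ds us -> (sumn ds).-1 = i.+1 ->
  \forall y \near x, forall j, lbrk us j y = incl (lbrk us i) j y.
Proof.
move=> /gsmooth_at_all[U [oU Ux] sus] us0 hus di.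
apply: filterS (nbhs_open oU Ux) => y Uy j; have [->|ji] := eqVneq j i; first by rewrite inclE.
rewrite inclN// (@lbrk_degree _ _ _ A ds)// ?di ?eqSS//.
by apply: List.Forall_impl sus => u su; exists U.
Qed.

(** The value would have degree 0, where E has no component: this is why [l1] vanishes on E_{-1}. *)
Lemma lbrk_homog0 x ds us : List.Forall (gsmooth_at x) us -> (0 < size us)%N ->
  List.Forall2 (@homog _ _ _ E) ds us -> (sumn ds).-1 = 0 ->
  \forall y \near x, forall j, lbrk us j y = 0.
Proof.
move=> /gsmooth_at_all[U [oU Ux] sus] us0 hus di.
apply: filterS (nbhs_open oU Ux) => y Uy j.
rewrite (@lbrk_degree _ _ _ A ds)// ?di//.
by apply: List.Forall_impl sus => u su; exists U.
Qed.

End operators.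

(** In a commutator of first-order operators applied to f s, [b] and [c] are the cross terms (X1 f)
    D2 s and (X2 f) D1 s, which occur in both composites. *)
Lemma symbol_cancel (V : zmodType) (a b c d a' d' : V) :
  a + b + (c + d) - (a' + c + (b + d')) = a - a' + (d - d').
Proof.
have -> : a + b + (c + d) = a + d + (b + c) by rewrite [c + d]addrC addrACA.
have -> : a' + c + (b + d') = a' + d' + (b + c) by rewrite [b + d']addrC addrACA [c + b]addrC.
by rewrite opprD addrACA subrr addr0 opprD addrACA.
Qed.

Lemma jacobi_solve (V : zmodType) (a b c d l : V) :
  a + (b + c - d) + l = 0 -> b = d - c - (l + a).
Proof.
move=> h; apply/eqP; rewrite -subr_eq0 -h; apply/eqP.
by rewrite opprB opprB -[b + c - d]addrA [RHS]addrAC [LHS]addrCA [l + a]addrC.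
Qed.

(** * Symbols of composites and commutators *)

Section symbols.
Context (R : realType) (n : nat) (M : manifold R n) (B : bundle M).
Hypothesis tB : tame B.
Implicit Types (x : M) (s t : sec B).

(** O-linearity of [T] is assumed near [x], because [L] is applied to the germ of [T s]. *)
Lemma tensorial_comp (C : bundle M) x (V : lmodType R) (T : sec C -> sec B) (L : sec B -> V) :
  (\forall y \near x, tensorial y (T^~ y)) ->
  (forall s : sec C, smooth_sec_at x s -> smooth_sec_at x (T s)) ->
  tame C -> tensorial x L -> tensorial x (fun s : sec C => L (T s)).
Proof.
move=> tT sT tC tL; have [LA LM] := tL; split=> [s t ss st|f s sf ss].
  rewrite -LA; [|exact: sT..]; apply: (first_order_near tB tL).
    by apply/sT/sec_at_add.
  apply: filterS3 tT (sec_at_near ss) (sec_at_near st) => y [TA _] sy ty.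
  exact: TA.
transitivity (L (fun y => f y *: T s y)); last by rewrite LM//; exact: sT.
apply: (first_order_near tB tL); first by apply/sT/sec_at_scale.
apply: filterS3 tT (smooth_at_near sf) (sec_at_near ss) => y [_ TM] fy sy.
by rewrite TM// scaler0 addr0.
Qed.

Lemma first_order_comm x (X1 X2 : sec (TM M)) (D1 D2 : sec B -> sec B) :
  smooth_sec_at x X1 -> smooth_sec_at x X2 ->
  (\forall y \near x, first_order (X1 y) id (D1^~ y)) ->
  (\forall y \near x, first_order (X2 y) id (D2^~ y)) ->
  (forall s, smooth_sec_at x s -> smooth_sec_at x (D1 s)) ->
  (forall s, smooth_sec_at x s -> smooth_sec_at x (D2 s)) ->
  first_order (lie X1 X2 x) id (fun s => D1 (D2 s) x - D2 (D1 s) x).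
Proof.
move=> sX1 sX2 d1 d2 s1 s2.
have addE (X X' : sec (TM M)) (D D' : sec B -> sec B) s t :
    (\forall y \near x, first_order (X y) id (D^~ y)) ->
    (\forall y \near x, first_order (X' y) id (D'^~ y)) ->
    (forall s, smooth_sec_at x s -> smooth_sec_at x (D' s)) ->
    smooth_sec_at x s -> smooth_sec_at x t ->
    D (D' (fun y => s y + t y)) x = D (D' s) x + D (D' t) x.
  move=> /nbhs_singleton d d' s' ss st; have [DA _] := d.
  rewrite -DA; [|exact: s'..]; apply: (first_order_near tB d).
    by apply: s'; apply: sec_at_add.
  by apply: filterS3 d' (sec_at_near ss) (sec_at_near st) => y [TA _] sy ty; exact: TA.
have scaleE (X X' : sec (TM M)) (D D' : sec B -> sec B) f s :
    (\forall y \near x, first_order (X y) id (D^~ y)) ->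
    (\forall y \near x, first_order (X' y) id (D'^~ y)) ->
    (forall s, smooth_sec_at x s -> smooth_sec_at x (D' s)) ->
    smooth_sec_at x X' ->
    smooth_at x f -> smooth_sec_at x s ->
    D (D' (fun y => f y *: s y)) x = f x *: D (D' s) x + X x f *: D' s x +
       (X' x f *: D s x + X x (fun y => X' y f) *: s x).
  move=> /nbhs_singleton d d' s' sX' sf ss; have [DA DM] := d.
  have sXf := smooth_TM_at sX' sf.
  rewrite -(DM f (D' s))//; last exact: s'.
  rewrite -(DM (fun y => X' y f) s)//.
  rewrite -DA; [|by apply: sec_at_scale => //; exact: s'|exact: sec_at_scale].
  apply: (first_order_near tB d); first by apply: s'; apply: sec_at_scale.
  by apply: filterS3 d' (smooth_at_near sf) (sec_at_near ss) => y [_ TM] fy sy; exact: TM.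
split=> [s t ss st|f s sf ss].
  rewrite (addE _ _ _ _ _ _ d1 d2)// (addE _ _ _ _ _ _ d2 d1)//.
  by rewrite opprD addrACA.
rewrite (scaleE _ _ _ _ _ _ d1 d2)// (scaleE _ _ _ _ _ _ d2 d1)//.
rewrite lieE// scalerBr scalerBl.
exact: symbol_cancel.
Qed.
End symbols.

(** * The binary bracket as an action up to homotopy *)

Section homotopies.
Context (R : realType) (n : nat) (M : manifold R n) (A : lie_inf M).
Local Notation E := (E A).
Implicit Types (x : M) (f : M -> R).

Let tE i : tame (E i) := vbundle_tame (E i).

(* [T o l1], where l1 vanishes on E_{-1}. *)
Definition after_l1 (T : forall i, sec (E i) -> sec (E i.+1)) i : sec (E i) -> sec (E i) :=
  match i with 0 => fun _ _ => 0 | j.+1 => fun s => T j (l1 s) end.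

Lemma lbrk_zero_first x u us k : gsmooth_at x u -> List.Forall (gsmooth_at x) us ->
  (\forall y \near x, forall i, u i y = 0) -> lbrk (A := A) (u :: us) k x = 0.
Proof.
move=> su sus u0; pose z : gsec E := fun i y => 0.
have sz : gsmooth_at x z.
  by exists setT; [split=> //; exact: openT|exact/gsmooth_zero/openT].
have -> : lbrk (A := A) (u :: us) k x = lbrk (z :: us) k x.
  apply: lbrk_near; first exact: List.Forall_cons.
  apply: List.Forall2_cons => //; elim: us {sus} => [|v us IH]; first exact: List.Forall2_nil.
  by apply: List.Forall2_cons => //; exact: nearW.
have := @lbrk_linear _ _ _ A [::] us (-1) z z x k.
have -> : gcomb (fun=> -1) z z = z by apply: gsecP => i y; rewrite /gcomb /z scaler0 addr0.
by move=> ->; [rewrite scaleN1r addNr|do !apply: List.Forall_cons].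
Qed.

Lemma lbrk_replace x u u' us k : gsmooth_at x u -> List.Forall (gsmooth_at x) us ->
  (\forall y \near x, forall i, u i y = u' i y) ->
  lbrk (A := A) (u :: us) k x = lbrk (u' :: us) k x.
Proof.
move=> su sus uu; apply: lbrk_near; first exact: List.Forall_cons.
apply: List.Forall2_cons => //; elim: us {sus} => [|v us IH]; first exact: List.Forall2_nil.
by apply: List.Forall2_cons => //; exact: nearW.
Qed.

Lemma lbrk_nest x ds us i vs k : List.Forall (gsmooth_at x) us -> (0 < size us)%N ->
  List.Forall2 (@homog _ _ _ E) ds us -> (sumn ds).-1 = i.+1 ->
  List.Forall (gsmooth_at x) vs ->
  lbrk (A := A) (lbrk us :: vs) k x = lbrk (incl (E := E) (lbrk us i) :: vs) k x.
Proof.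
move=> sus us0 hus di svs; apply: lbrk_replace => //; first exact: gsmooth_at_lbrk.
exact: lbrk_homog hus di.
Qed.

Lemma lbrk_nest0 x ds us vs k : List.Forall (gsmooth_at x) us -> (0 < size us)%N ->
  List.Forall2 (@homog _ _ _ E) ds us -> (sumn ds).-1 = 0 ->
  List.Forall (gsmooth_at x) vs ->
  lbrk (A := A) (lbrk us :: vs) k x = 0.
Proof.
move=> sus us0 hus di svs; apply: lbrk_zero_first => //; first exact: gsmooth_at_lbrk.
exact: lbrk_homog0 hus di.
Qed.

(** The Jacobi identity of [e] and [s]; as [e] has even degree -2, every Koszul sign is +1. *)
Lemma br2_l1 x (e : sec (E 1)) i (s : sec (E i)) :
  smooth_sec_at x e -> smooth_sec_at x s ->
  br2 (l1 e) s x = - (l1 (l2_op e s) x + after_l1 (fun j => @l2_op _ _ _ A e j) s x).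
Proof.
move=> se ss; have se1 := gsmooth_at_incl se; have ss1 := gsmooth_at_incl ss.
have := jacobi2 i se1 ss1 (homog_incl e) (homog_incl s).
rewrite (@lbrk_nest x [:: 2] [:: incl e] 0) //; try first [by rewrite /= ?addn0 | by forall_incl; forall_homog].
rewrite (@lbrk_nest x [:: 2; i.+1] [:: incl e; incl s] i.+1) //; try first [by rewrite /= ?addn0 | by forall_incl; forall_homog].
rewrite -signr_odd oddM andbF expr0 scale1r.
set t := (X in _ + X + _ = 0).
have -> : t = after_l1 (fun j => @l2_op _ _ _ A e j) s x.
  rewrite /t; case: i s ss ss1 {t} => [|i] s ss ss1 /=.
    by rewrite (@lbrk_nest0 x [:: 1]) //; forall_incl; forall_homog.
  rewrite (@lbrk_nest x [:: i.+2] _ i) //; try first [by rewrite /= ?addn0 | by forall_incl; forall_homog].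
  have sl := gsmooth_at_incl (l1_smooth ss).
  rewrite (@lbrk_symmetric _ _ _ A [::] [::] _ _ i.+1 2); [|exact: (List.Forall_cons _ sl (List.Forall_cons _ se1 (List.Forall_nil _)))|exact: homog_incl..].
  by rewrite -signr_odd oddM andbF expr0 scale1r.
by move=> /eqP; rewrite -addrA addr_eq0 addrC => /eqP.
Qed.

(** The Jacobi identity of [e1], [e2], [s], where the terms in [l1 e1] and [l1 e2] vanish for degree
    reasons. Bringing [e1] and [e2] back to the front absorbs the signs. *)
Lemma br2_br2 x (e1 e2 : sec (E 0)) i (s : sec (E i)) :
  smooth_sec_at x e1 -> smooth_sec_at x e2 -> smooth_sec_at x s ->
  br2 (br2 e1 e2) s x = br2 e1 (br2 e2 s) x - br2 e2 (br2 e1 s) x -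
  (l1 (l3_op e1 e2 s) x + after_l1 (fun j => @l3_op _ _ _ A e1 e2 j) s x).
Proof.
move=> se1 se2 ss; have g1 := gsmooth_at_incl se1; have g2 := gsmooth_at_incl se2.
have gs := gsmooth_at_incl ss.
have := jacobi3 i g1 g2 gs (homog_incl e1) (homog_incl e2) (homog_incl s).
rewrite (@lbrk_nest0 x [:: 1] [:: incl e1]) //; try first [by rewrite /= ?addn0 | by forall_incl; forall_homog].
rewrite (@lbrk_nest0 x [:: 1] [:: incl e2]) //; try first [by rewrite /= ?addn0 | by forall_incl; forall_homog].
rewrite (@lbrk_nest x [:: 1; 1] [:: incl e1; incl e2] 0) //; try first [by rewrite /= ?addn0 | by forall_incl; forall_homog].
rewrite (@lbrk_nest x [:: 1; i.+1] [:: incl e1; incl s] i) //; try first [by rewrite /= ?addn0 | by forall_incl; forall_homog].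
rewrite (@lbrk_nest x [:: 1; i.+1] [:: incl e2; incl s] i) //; try first [by rewrite /= ?addn0 | by forall_incl; forall_homog].
rewrite (@lbrk_nest x [:: 1; 1; i.+1] [:: incl e1; incl e2; incl s] i.+1) //; try first [by rewrite /= ?addn0 | by forall_incl; forall_homog].
have sq j : (-1) ^+ j * (-1) ^+ j = 1 :> R by rewrite -exprD addnn -signr_odd odd_double.
rewrite scaler0 !muln1 expr1 sq scale1r !add0r mulN1r scaleNr.
have swap (e : sec (E 0)) (t : sec (E i)) : smooth_sec_at x e -> smooth_sec_at x t ->
    (-1) ^+ i.+1 *: lbrk (A := A) [:: incl (E := E) t; incl (E := E) e] i x = br2 e t x.
  by move=> ? ?; rewrite -br2_sym.
rewrite !swap//; try exact: br2_smooth.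
set t := lbrk [:: lbrk [:: incl s]; _; _] i x.
have -> : t = after_l1 (fun j => @l3_op _ _ _ A e1 e2 j) s x.
  rewrite /t; case: i s ss gs {t swap} => [|i] s ss gs /=.
    by rewrite (@lbrk_nest0 x [:: 1]) //; forall_incl; forall_homog.
  rewrite (@lbrk_nest x [:: i.+2] _ i) //; try first [by rewrite /= ?addn0 | by forall_incl; forall_homog].
  have sl := gsmooth_at_incl (l1_smooth ss).
  (* [l1 s] is moved past [e1] and then past [e2]; the two signs are equal and cancel. *)
  rewrite (@lbrk_symmetric _ _ _ A [::] [:: incl e2] _ _ i.+1 1); [|by do ?[exact: List.Forall_nil|apply: List.Forall_cons]|exact: homog_incl..].
  rewrite (@lbrk_symmetric _ _ _ A [:: incl e1] [::] _ _ i.+1 1); [|by do ?[exact: List.Forall_nil|apply: List.Forall_cons]|exact: homog_incl..].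
  by rewrite scalerA !muln1 sq scale1r.
exact: jacobi_solve.
Qed.
End homotopies.

(** * Supertraces *)

Section framed.
Context (R : realType) (n : nat) (M : manifold R n) (A : lie_inf M).
Context (U : set M) (F : frames A).
Hypotheses (oU : open U) (FU : is_frames U F).
Local Notation E := (E A).
Implicit Types (x : M) (f : M -> R).

Let tE i : tame (E i) := vbundle_tame (E i).

Lemma comp_tame i : tame (comp A i).
Proof. by case: i => [|i]; [exact: TM_tame|exact: vbundle_tame]. Qed.

Lemma frames_basis i x : U x -> is_basis (fun k => F (i := i) k x).
Proof. by move=> Ux; exact: (frame_basis (FU i) Ux). Qed.

Lemma frames_smooth_at i k x : U x -> smooth_sec_at x (F (i := i) k).
Proof. by move=> Ux; exact: (frame_at oU (FU i) k Ux). Qed.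

(** A section of the frame is nonzero at [x], so a symbol determines its tangent vector; positive
    rank provides such a section. *)
Lemma symbol_unique x (v w : tangent x) : U x -> (0 < rk (E 0))%N ->
  (forall f (s : sec (E 0)), smooth_at x f -> smooth_sec_at x s ->
    v f *: s x = w f *: s x) -> v = w.
Proof.
move=> Ux r0 vw; apply: tangent_ext => f sf; pose k : 'I_(rk (E 0)) := Ordinal r0.
have bF := @frames_basis 1%N x Ux.
have := vw f _ sf (@frames_smooth_at 1%N k x Ux).
move=> /(congr1 (fun u => coord (fun k => F (i := 1%N) k x) u 0 k)).
by rewrite !coordZ// !mxE coord_basis// mxE !eqxx !mulr1.
Qed.

(** On E_{-1}, [br2_l1] leaves only [l1] after [l2_op e], a composite of O-linear operators. *)
Lemma br2_l1_tensorial x (e : sec (E 1)) : smooth_sec_at x e ->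
  tensorial (B := E 0) x (fun s => br2 (l1 e) s x).
Proof.
move=> se; have tc : tensorial (B := E 0) x (fun s => l1 (l2_op e s) x).
  apply: (@tensorial_comp _ _ _ _ (tE 1) (E 0) x _ (@l2_op _ _ _ A e 0) (fun s => l1 s x)) => //; last exact: l1_tensorial.
    by apply: filterS (sec_at_near se) => y; exact: l2_tensorial.
  by move=> s; exact: l2_smooth.
have bE (s : sec (E 0)) : smooth_sec_at x s -> br2 (l1 e) s x = - l1 (l2_op e s) x.
  by move=> ss; rewrite br2_l1//= addr0.
have [cA cM] := tc; split=> [s t ss st|f s sf ss].
  by rewrite !bE//; [rewrite cA// opprD|exact: (sec_at_add (tE 0))].
rewrite !bE//; last exact: (sec_at_scale (tE 0)).
by rewrite cM// scaler0 !addr0 scalerN.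
Qed.

(** [rho (l1 e)] is the symbol of an operator that [br2_l1_tensorial] shows to have symbol 0. *)
Lemma anchor_l1 x (e : sec (E 1)) : U x -> smooth_sec_at x e -> rho (l1 e) x = 0.
Proof.
move=> Ux se; have [r0|] := posnP (rk (E 0)).
  rewrite /rho (fib_rk0 (l1 e x) r0); exact: linear_zero (@anchor_linear _ _ _ A x).
move=> r0; apply: (symbol_unique Ux r0) => f s sf ss.
have [_ tM] := br2_l1_tensorial se; have [_ dM] := br2_first_order 0 (l1_smooth se).
have := dM f s sf ss; rewrite tM// scaler0 addr0 => /esym/eqP.
by rewrite -subr_eq0 [_ + _ - _]addrAC subrr add0r tangent0 scale0r => /eqP.
Qed.

(** Two computations of the symbol of the bracket with [br2 e1 e2] on E_{-1}: directly, and as a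
    commutator up to the O-linear term in [l3_op]. *)
Lemma anchor_br2 x (e1 e2 : sec (E 0)) : U x -> smooth_sec_at x e1 -> smooth_sec_at x e2 ->
  rho (br2 e1 e2) x = lie (rho e1) (rho e2) x.
Proof.
move=> Ux se1 se2; have [s1 s2] := conj (rho_smooth se1) (rho_smooth se2).
have [r0|r0] := posnP (rk (E 0)).
  have rho0 (e : sec (E 0)) y : rho (A := A) e y = 0.
    by rewrite /rho (fib_rk0 (e y) r0); exact: linear_zero (@anchor_linear _ _ _ A y).
  apply: tangent_ext => f sf; by rewrite lieE// !rho0 !tangent0 subr0.
apply: (symbol_unique Ux r0) => f s sf ss.
have [_ dM] := br2_first_order 0 (br2_smooth se1 se2).
have tc : tensorial (B := E 0) x (fun s => l1 (l3_op e1 e2 s) x).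
  apply: (@tensorial_comp _ _ _ _ (tE 1) (E 0) x _ (@l3_op _ _ _ A e1 e2 0) (fun s => l1 s x)) => //; last exact: l1_tensorial.
    by apply: filterS2 (sec_at_near se1) (sec_at_near se2) => y; exact: l3_tensorial.
  by move=> t; exact: l3_smooth.
have [_ cM] := tc.
have [_ bM] : first_order (B := E 0) (lie (rho e1) (rho e2) x) id
    (fun s => br2 e1 (br2 e2 s) x - br2 e2 (br2 e1 s) x).
  apply: (@first_order_comm _ _ _ _ (tE 0) x (rho e1) (rho e2) (@br2 _ _ _ A 0 e1) (@br2 _ _ _ A 0 e2)) => //.
  - by apply: filterS (sec_at_near se1) => y; exact: br2_first_order.
  - by apply: filterS (sec_at_near se2) => y; exact: br2_first_order.
  - by move=> t; exact: br2_smooth.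
  - by move=> t; exact: br2_smooth.
have sfs := sec_at_scale (tE 0) sf ss.
have := dM f s sf ss; rewrite !br2_br2//= !addr0 bM// cM// scaler0 addr0.
by rewrite addrAC !scalerBr => /addrI.
Qed.

Lemma telescope_sign (c : nat -> R) d :
  \sum_(i < d) (-1) ^+ i.+1 * (c i.+1 + c i) = (-1) ^+ d * c d - c 0.
Proof.
elim: d => [|d IH]; first by rewrite big_ord0 expr0 mul1r subrr.
by rewrite big_ord_recr /= IH exprS; ring.
Qed.

(** The trace of [l1] after [T] on one component equals that of [T] after [l1] on the next, so the
    alternating sum telescopes. It ends in 0 on both sides: [l1] is 0 on E_{-1}, and the rank is 0
    beyond the depth. *)
Lemma supertrace_homotopy x (T : forall i, sec (E i) -> sec (E i.+1)) : U x ->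
  (forall i, tensorial (B := E i) x (fun s => T i s x)) ->
  (forall i (s : sec (E i)), smooth_sec_at x s -> smooth_sec_at x (T i s)) ->
  \sum_(i < depth A) (-1) ^+ i.+1 *
    tr (fun k => F (i := i.+1) k x)
       (fun k => l1 (T i (F (i := i.+1) k)) x + after_l1 T (F (i := i.+1) k) x) = 0.
Proof.
move=> Ux tT sT.
pose c i := tr (fun k => F (i := i.+1) k x) (fun k => after_l1 T (F (i := i.+1) k) x).
have c0 : c 0 = 0.
  by rewrite /c /tr big1// => k _; rewrite coord0 ?mxE//; exact: frames_basis.
have cd : c (depth A) = 0.
  rewrite /c /tr big1// => -[k kr] _; exfalso; move: kr.
  by rewrite [rk _](@rk_depth _ _ _ A).
have := telescope_sign c (depth A); rewrite c0 cd mulr0 subr0 => sc.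
apply: etrans sc; apply: eq_bigr => i _; congr (_ * _); rewrite trD; last exact: frames_basis.
congr (_ + _).
exact: (tr_tensorial (tE i) (tE i.+1) oU (FU i.+1) (FU i.+2) Ux (tT i) (@l1_tensorial _ _ _ A x i) (sT i) (@l1_smooth _ _ _ A x i)).
Qed.

End framed.

(** * The modular form *)

Section modular_function.
Context (R : realType) (n : nat) (M : manifold R n) (A : lie_inf M).
Context (U : set M) (F : frames A).
Hypotheses (oU : open U) (FU : is_frames U F).
Local Notation E := (E A).
Implicit Types (x : M) (f : M -> R) (e : sec (E 0)).

Let tE i : tame (E i) := vbundle_tame (E i).
Let bF i x (Ux : U x) : is_basis (fun k => F (i := i) k x) := @frames_basis _ _ _ _ _ _ FU i x Ux.
Let sF i k x (Ux : U x) : smooth_sec_at x (F (i := i) k) := @frames_smooth_at _ _ _ _ _ _ oU FU i k x Ux.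

Lemma modular_functionE e x : U x -> modular_function F e x =
  tr (fun k => F (i := 0%N) k x) (fun k => lie (rho e) (F (i := 0%N) k) x) +
  \sum_(i < depth A) (-1) ^+ i.+1 *
    tr (fun k => F (i := i.+1) k x) (fun k => br2 e (F (i := i.+1) k) x).
Proof.
move=> Ux; rewrite /modular_function divergenceE; last exact: bF.
congr (_ + _); apply: eq_bigr => i _; congr (_ * _).
by rewrite (@divergenceE _ _ _ _ (@bF i.+1%N x Ux)).
Qed.

(* The first-order terms that arise in the TM and E_{-1} summands cancel. *)
Lemma modular_function_tensorial x : U x ->
  tensorial (B := E 0) (V := R^o) x (fun e => modular_function F e x).
Proof.
move=> Ux; split=> [e e' se se'|f e sf se].
  change (modular_function F (fun y => e y + e' y) x = modular_function F e x + modular_function F e' x).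
  rewrite !modular_functionE// addrACA -[in X in _ = _ + X]big_split/=; congr (_ + _).
    rewrite -(trD (@bF 0%N x Ux)); congr (tr _ _); apply/funext => k.
    have -> : rho (A := A) (fun y => e y + e' y) = (fun y => rho e y + rho e' y).
      apply: functional_extensionality_dep => y; rewrite /rho.
      by have := @anchor_linear _ _ _ A y 1 (e y) (e' y); rewrite !scale1r.
    by apply: lie_addl; [exact: rho_smooth..|exact: (@sF 0%N)].
  apply: eq_bigr => i _; rewrite -mulrDr; congr (_ * _).
  rewrite -(trD (@bF i.+1%N x Ux)); congr (tr _ _); apply/funext => k.
  by apply: br2_addl => //; exact: (@sF i.+1).
rewrite scaler0 addr0.
change (modular_function F (fun y => f y *: e y) x = f x * modular_function F e x).
rewrite !modular_functionE// mulrDr.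
have -> : rho (A := A) (fun y => f y *: e y) = (fun y => f y *: rho e y).
  apply: functional_extensionality_dep => y; rewrite /rho.
  have := @anchor_linear _ _ _ A y (f y) (e y) 0.
  by rewrite (linear_zero (@anchor_linear _ _ _ A y)) !addr0.
(* The defect of O-linearity is Y |-> -(Y f) rho e, of rank one and of trace -(rho e) f. *)
have TMpart : tr (fun k => F (i := 0%N) k x) (fun k => lie (fun y => f y *: rho e y) (F (i := 0%N) k) x) =
    f x * tr (fun k => F (i := 0%N) k x) (fun k => lie (rho e) (F (i := 0%N) k) x) - rho e x f.
  rewrite -(trZ (@bF 0%N x Ux)) [in RHS](coordK (@bF 0%N x Ux) (rho e x)) tangent_sum /tr -sumrB.
  apply: eq_bigr => k _; rewrite lie_scalel//; [|exact: rho_smooth|exact: (@sF 0%N)].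
  rewrite (coordD (@bF 0%N x Ux)) (coordN (@bF 0%N x Ux)) (coordZ (@bF 0%N x Ux) (F k x f)) mxE; congr (_ + _).
  by rewrite !mxE mulrC.
(* On E_{-1} the defect e' |-> -(rho(e') f) e has the same trace as that on TM; the sign -1 of this
   summand makes them cancel. *)
pose d i : R := if i == 0%N then - rho e x f else 0.
have Epart i : tr (fun k => F (i := i.+1) k x) (fun k => br2 (fun y => f y *: e y) (F (i := i.+1) k) x) =
    f x * tr (fun k => F (i := i.+1) k x) (fun k => br2 e (F (i := i.+1) k) x) + d i.
  rewrite -(trZ (@bF i.+1%N x Ux)).
  have bE k : br2 (fun y => f y *: e y) (F (i := i.+1) k) x = f x *: br2 e (F (i := i.+1) k) x +
     ((-1) ^+ i.+1 * anchor (incl (E := E) (F (i := i.+1) k) 0%N x) f) *: incl (E := E) e i x.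
    by apply: br2_scalel => //; exact: (@sF i.+1).
  transitivity (tr (fun k => F (i := i.+1) k x) (fun k => f x *: br2 e (F (i := i.+1) k) x +
     ((-1) ^+ i.+1 * anchor (incl (E := E) (F (i := i.+1) k) 0%N x) f) *: incl (E := E) e i x)).
    by congr (tr _ _); apply/funext => k; exact: bE.
  rewrite (trD (@bF i.+1%N x Ux)); congr (_ + _); rewrite /d; case: eqP => [i0|/eqP i0].
    rewrite {}i0 in bE *; 
    have -> : rho e x = \sum_k coord (fun k => F (i := 1%N) k x) (e x) 0 k *: anchor (F (i := 1%N) k x).
      rewrite /rho [in LHS](coordK (@bF 1%N x Ux) (e x)).
      exact: (linear_comb _ _ _ (@anchor_linear _ _ _ A x)).
    rewrite tangent_sum /tr -sumrN.
    apply: eq_bigr => k _; rewrite !inclE (coordZ (@bF 1%N x Ux)) mxE expr1 mulN1r mulNr.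
    by rewrite tangentZ mulrC.
  have -> : incl (E := E) e i x = 0 by rewrite inclN.
  by rewrite /tr big1// => k _; rewrite scaler0 (coord0 (@bF i.+1%N x Ux)) mxE.
rewrite TMpart; under eq_bigr => i _ do rewrite Epart mulrDr.
rewrite big_split/=.
have -> : \sum_(i < depth A) (-1) ^+ i.+1 * d i = rho e x f.
  (* At depth 0 the sum has no E_{-1} summand, but then E_{-1} = 0 and [rho e] vanishes. *)
  have [d0|d0] := posnP (depth A).
    have r0 : rk (E 0) = 0 by apply: (@rk_depth _ _ _ A); rewrite d0.
    rewrite big1 => [|i _]; last by have := ltn_ord i; rewrite [X in (_ < X)%N]d0.
    by rewrite /rho (fib_rk0 (e x) r0) (linear_zero (@anchor_linear _ _ _ A x)).
  rewrite (bigD1 (Ordinal d0))//= expr1 mulN1r opprK big1 ?addr0// => i i0.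
  by rewrite /d ifF ?mulr0//; apply/negbTE; apply: contra i0 => /eqP h; apply/eqP/val_inj.
rewrite -addrA [X in _ + X = _]addrC addrK; congr (_ + _).
by rewrite mulr_sumr; apply: eq_bigr => i _; rewrite mulrCA.
Qed.

(** A form is evaluated on vectors of a fibre, whereas [modular_function] takes sections; its values
    on the frame, extended linearly, give the form. *)
Definition modular_form : form1 A := fun x v =>
  \sum_k coord (fun k => F (i := 1%N) k x) v 0 k * modular_function F (F (i := 1%N) k) x.

Lemma modular_formE e x : U x -> smooth_sec_at x e ->
  modular_form (e x) = modular_function F e x.
Proof.
move=> Ux se; symmetry.
exact: (tensorial_frame (tE 0) oU (FU 1%N) (modular_function_tensorial Ux) Ux se).
Qed.

Lemma modular_form_linear x a u v : U x ->
  modular_form (a *: u + v : fib (E 0) x) = a * modular_form u + modular_form v.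
Proof.
move=> Ux; rewrite /modular_form mulr_sumr -big_split/=; apply: eq_bigr => k _.
by rewrite (coord_linear (@bF 1%N x Ux)) !mxE mulrDl mulrA.
Qed.

Lemma smooth_modular_function V e : open V -> V `<=` U -> smooth_sec V e ->
  smooth V (modular_function F e).
Proof.
move=> oV VU se; have se' x : V x -> smooth_sec_at x e by move=> Vx; exists V.
have sVF i k : smooth_sec V (F (i := i) k).
  by apply: (tame_sub (comp_tame A i)) VU _; have [] := FU i.
apply: (@smooth_eq _ _ _ _ (fun x =>
  tr (fun k => F (i := 0%N) k x) (fun k => lie (rho e) (F (i := 0%N) k) x) +
  \sum_(i < depth A) (-1) ^+ i.+1 *
    tr (fun k => F (i := i.+1) k x) (fun k => br2 e (F (i := i.+1) k) x))) => //.
  by move=> x /VU Ux; rewrite modular_functionE.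
apply: smooth_add => //.
  apply: (smooth_tr (TM_tame M) oU (FU 0%N) (D := fun k => lie (rho e) (F (i := 0%N) k))) => // k.
  apply: (sec_atP (TM_tame M)) => // x Vx; apply: lie_smooth; last exact: (@sF 0%N k x (VU _ Vx)).
  exact/rho_smooth/se'.
apply: smooth_sum => // i _; apply: smooth_mul => //; first exact: smooth_cst.
apply: (smooth_tr (tE i) oU (FU i.+1) (D := fun k => br2 e (F (i := i.+1) k))) => // k.
apply: (sec_atP (tE i)) => // x Vx; apply: br2_smooth; last exact: (@sF i.+1 k x (VU _ Vx)).
exact/se'.
Qed.

Lemma modular_form_is_form1 : is_form1 U modular_form.
Proof.
split=> [x Ux a u v|V e oV VU se]; first exact: modular_form_linear.
apply: smooth_eq (smooth_modular_function oV VU se) => // x Vx.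
by rewrite modular_formE//; [exact: VU|exists V].
Qed.

Lemma modular_form_cocycle : modular_cocycle U F modular_form.
Proof.
split; first exact: modular_form_is_form1.
by move=> e se x Ux; apply: modular_formE => //; exists U.
Qed.

End modular_function.

(** * Closedness *)

Section closedness.
Context (R : realType) (n : nat) (M : manifold R n) (A : lie_inf M).
Context (U : set M) (F : frames A).
Hypotheses (oU : open U) (FU : is_frames U F).
Local Notation E := (E A).
Implicit Types (x : M) (f : M -> R).

Let tE i : tame (E i) := vbundle_tame (E i).
Let bF i x (Ux : U x) : is_basis (fun k => F (i := i) k x) := @frames_basis _ _ _ _ _ _ FU i x Ux.
Let sF i k x (Ux : U x) : smooth_sec_at x (F (i := i) k) := @frames_smooth_at _ _ _ _ _ _ oU FU i k x Ux.

Lemma lie0l x (X : sec (TM M)) : smooth_sec_at x X -> lie (fun y => 0 : tangent y) X x = 0.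
Proof.
move=> sX; apply: tangent_ext => f sf; rewrite lieE//; last exact: (sec_at_zero (TM_tame M)).
by rewrite !tangent0 tangent_cst subr0.
Qed.

Lemma modular_function_l1 x (e : sec (E 1)) : U x -> smooth_sec_at x e ->
  modular_function F (l1 e) x = 0.
Proof.
move=> Ux se; rewrite (modular_functionE FU)//.
rewrite {1}/tr big1 ?add0r => [|k _]; last first.
  (* The Lie bracket differentiates [rho (l1 e)], so its vanishing is used on a neighbourhood of
     [x]. *)
  rewrite (@lie_near _ _ _ _ (fun y => 0)); [|exact/rho_smooth/l1_smooth|exact: (@sF 0%N)|].
    by rewrite lie0l ?(coord0 (@bF 0%N x Ux)) ?mxE//; exact: (@sF 0%N).
  apply: filterS2 (nbhs_open oU Ux) (sec_at_near se) => y Uy sey.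
  exact: (anchor_l1 oU FU).
transitivity (- \sum_(i < depth A) (-1) ^+ i.+1 *
    tr (fun k => F (i := i.+1) k x)
       (fun k => l1 (l2_op e (F (i := i.+1) k)) x +
                 after_l1 (fun j => @l2_op _ _ _ A e j) (F (i := i.+1) k) x)); last first.
  rewrite (@supertrace_homotopy _ _ _ _ _ _ oU FU x (fun j => @l2_op _ _ _ A e j)) ?oppr0//.
  - by move=> i; exact: l2_tensorial.
  - by move=> i s; exact: l2_smooth.
rewrite -sumrN; apply: eq_bigr => i _; rewrite -mulrN -(trN (@bF i.+1 x Ux)); congr (_ * _).
by congr (tr _ _); apply/funext => k; rewrite br2_l1//; exact: (@sF i.+1).
Qed.

Lemma modular_function_br2 x (e1 e2 : sec (E 0)) : smooth_sec U e1 -> smooth_sec U e2 ->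
  U x -> modular_function F (br2 e1 e2) x =
  rho e1 x (modular_function F e2) - rho e2 x (modular_function F e1).
Proof.
move=> s1 s2 Ux.
have se1 y : U y -> smooth_sec_at y e1 by move=> Uy; exists U.
have se2 y : U y -> smooth_sec_at y e2 by move=> Uy; exists U.
pose TMtr e y := tr (fun k => F (i := 0%N) k y) (fun k => lie (rho (A := A) e) (F (i := 0%N) k) y).
pose Etr i e y := tr (fun k => F (i := i.+1) k y) (fun k => br2 (A := A) e (F (i := i.+1) k) y).
have stm e : smooth_sec U e -> smooth_at x (TMtr e).
  move=> se; exists U => //.
  apply: (smooth_tr (TM_tame M) oU (FU 0%N) (D := fun k => lie (rho e) (F (i := 0%N) k))) => // k.
  apply: (sec_atP (TM_tame M)) => // y Uy; apply: lie_smooth; last exact: (@sF 0%N k y Uy).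
  by apply: rho_smooth; exists U.
have stE i e : smooth_sec U e -> smooth_at x (Etr i e).
  move=> se; exists U => //.
  apply: (smooth_tr (tE i) oU (FU i.+1) (D := fun k => br2 e (F (i := i.+1) k))) => // k.
  by apply: (sec_atP (tE i)) => // y Uy; apply: br2_smooth; [exists U|exact: (@sF i.+1 k y Uy)].
have rhoE e e' : smooth_sec U e' -> rho (A := A) e x (modular_function F e') =
    rho e x (TMtr e') + \sum_(i < depth A) (-1) ^+ i.+1 * rho e x (Etr i e').
  move=> se'; rewrite (@tangent_near _ _ _ _ _ _ (fun y => TMtr e' y + \sum_(i < depth A) (-1) ^+ i.+1 * Etr i e' y)); last first.
    by apply: filterS (nbhs_open oU Ux) => y Uy; rewrite (modular_functionE FU).
  have sE' (i : 'I_(depth A)) : smooth_at x (fun y => (-1) ^+ i.+1 * Etr i e' y).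
    by apply: smooth_at_mul; [exact: smooth_at_cst|exact: stE].
  rewrite tangent_add; [|exact: stm|by apply: smooth_at_sum => i _; exact: sE'].
  rewrite (@tangent_sumf _ _ _ _ _ xpredT _ (fun (i : 'I_(depth A)) y => (-1) ^+ i.+1 * Etr i e' y)); last by move=> i _; exact: sE'.
  congr (_ + _); apply: eq_bigr => i _.
  by rewrite tangent_scale//; exact: stE.
(* The TM summand is treated first: there the action is strict, by the Jacobi identity of vector
   fields and [anchor_br2]. *)
rewrite !rhoE// (modular_functionE FU)// opprD addrACA -sumrB; congr (_ + _).
  rewrite -(tr_commutator (TM_tame M) oU (FU 0%N) (X1 := rho e1) (X2 := rho e2) (D1 := lie (rho e1)) (D2 := lie (rho e2)) Ux).
  - congr (tr _ _); apply/funext => k.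
    have [r1 r2] := conj (rho_smooth (se1 _ Ux)) (rho_smooth (se2 _ Ux)).
    rewrite (@lie_near _ _ _ _ (lie (rho e1) (rho e2))); [|by apply: rho_smooth; apply: br2_smooth; [exact: se1|exact: se2]|exact: (@sF 0%N)|].
      by apply: lie_jacobi => //; exact: (@sF 0%N).
    apply: filterS (nbhs_open oU Ux) => y Uy; apply: (anchor_br2 oU FU) => //; [exact: se1|exact: se2].
  - by move=> y Uy; apply: lie_first_order; exact/rho_smooth/se1.
  - by move=> y Uy; apply: lie_first_order; exact/rho_smooth/se2.
  - by move=> s; apply: lie_smooth; exact/rho_smooth/se1.
  - by move=> s; apply: lie_smooth; exact/rho_smooth/se2.
have stH := @supertrace_homotopy _ _ _ _ _ _ oU FU x (fun j => @l3_op _ _ _ A e1 e2 j) Ux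
   (fun i => @l3_tensorial _ _ _ A x e1 e2 i (se1 _ Ux) (se2 _ Ux))
   (fun i s => @l3_smooth _ _ _ A x e1 e2 i s (se1 _ Ux) (se2 _ Ux)).
(* The vanishing supertrace of the homotopy term in [l3_op] is inserted, so that the identity can be
   checked summand by summand. *)
rewrite -[RHS]subr0 -[X in _ - X]stH -sumrB; apply: eq_bigr => i _.
rewrite -mulrBr -mulrBr; congr (_ * _).
rewrite -(tr_commutator (tE i) oU (FU i.+1) (X1 := rho e1) (X2 := rho e2) (D1 := br2 (i := i) e1) (D2 := br2 (i := i) e2) Ux).
- rewrite -(trN (@bF i.+1 x Ux)) -(trD (@bF i.+1 x Ux)); congr (tr _ _); apply/funext => k.
  by rewrite br2_br2//; [exact: se1|exact: se2|exact: (@sF i.+1)].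
- by move=> y Uy; apply: br2_first_order; exact: se1.
- by move=> y Uy; apply: br2_first_order; exact: se2.
- by move=> s; apply: br2_smooth; exact: se1.
- by move=> s; apply: br2_smooth; exact: se2.
Qed.

Lemma modular_form_closed : Qclosed U (modular_form F).
Proof.
split=> [e se x Ux|e1 e2 s1 s2 x Ux].
  have sex : smooth_sec_at x e by exists U.
  by rewrite (modular_formE oU FU)//; [exact: modular_function_l1|exact: l1_smooth].
have near_mf (e : sec (E 0)) : smooth_sec U e ->
    \forall y \near x, modular_form F (e y) = modular_function F e y.
  by move=> se; apply: filterS (nbhs_open oU Ux) => y Uy; rewrite (modular_formE oU FU)//; exists U.
rewrite (tangent_near _ (near_mf _ s1)) (tangent_near _ (near_mf _ s2)).
rewrite (modular_formE oU FU)//; last by apply: br2_smooth; exists U.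
by rewrite modular_function_br2// [_ - _ - _]addrAC subrr add0r addNr.
Qed.

End closedness.

(** * The modular class *)

Section modular_class.
Context (R : realType) (n : nat) (M : manifold R n) (A : lie_inf M).
Context (U : set M) (F : frames A).
Hypotheses (oU : open U) (FU : is_frames U F).
Local Notation E := (E A).
Implicit Types (x : M) (f : M -> R).

Let tE i : tame (E i) := vbundle_tame (E i).
Let bF i x (Ux : U x) : is_basis (fun k => F (i := i) k x) := @frames_basis _ _ _ _ _ _ FU i x Ux.

(* The connection terms are the traces of [X |-> rho (nabla_X e)] on TM and of
   [e' |-> nabla_{rho e'} e] on E_{-1}, which are equal. *)
Lemma ad_divergence (nabla : forall i, connection (E i)) (e : sec (E 0)) x :
  U x -> smooth_sec_at x e ->
  \sum_(i < (depth A).+1) (-1) ^+ i *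
    divergence (fun k => F (i := i) k x) (fun k => ad nabla e (F (i := i) k) x) =
  modular_function F e x.
Proof.
move=> Ux se; rewrite big_ord_recl /= expr0 mul1r (modular_functionE FU)//.
pose c := tr (fun k => F (i := 0%N) k x) (fun k => anchor (nabla 0%N x (F (i := 0%N) k x) e)).
have TMpart : divergence (fun k => F (i := 0%N) k x) (fun k => ad nabla e (F (i := 0%N) k) x) =
    tr (fun k => F (i := 0%N) k x) (fun k => lie (rho e) (F (i := 0%N) k) x) + c.
  by rewrite (divergenceE (@bF 0%N x Ux)) -(trD (@bF 0%N x Ux)).
have cE : c = tr (fun k => F (i := 1%N) k x) (fun k => nabla 0%N x (anchor (F (i := 1%N) k x)) e).
  have := tr_swap (fun k => nabla 0%N x (F (i := 0%N) k x) e) (fun j => anchor (F (i := 1%N) j x)) (@bF 0%N x Ux) (@bF 1%N x Ux).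
  have -> : (fun k => \sum_j coord (fun k => F (i := 1%N) k x) (nabla 0%N x (F (i := 0%N) k x) e) 0 j *: anchor (F (i := 1%N) j x)) =
      (fun k => anchor (nabla 0%N x (F (i := 0%N) k x) e)).
    apply/funext => k; rewrite [in RHS](coordK (@bF 1%N x Ux) (nabla 0%N x (F (i := 0%N) k x) e)).
    by rewrite (linear_comb _ _ _ (@anchor_linear _ _ _ A x)).
  rewrite /c => ->; congr (tr _ _); apply/funext => j.
  rewrite [in RHS](coordK (@bF 0%N x Ux) (anchor (F (i := 1%N) j x))).
  by rewrite (linear_comb _ _ _ (@nab_linear _ _ _ _ (nabla 0%N) x e se)).
pose d (i : nat) : R := if i == 0%N then c else 0.
have Epart i : divergence (fun k => F (i := i.+1) k x) (fun k => ad nabla e (F (i := i.+1) k) x) =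
    tr (fun k => F (i := i.+1) k x) (fun k => br2 e (F (i := i.+1) k) x) + d i.
  rewrite (divergenceE (@bF i.+1 x Ux)) /d; case: i => [|i] /=.
    by rewrite cE -(trD (@bF 1%N x Ux)).
  by rewrite addr0.
rewrite TMpart -addrA; congr (_ + _).
transitivity (c + \sum_(i < depth A) (-1) ^+ i.+1 * (tr (fun k => F (i := i.+1) k x) (fun k => br2 e (F (i := i.+1) k) x) + d i)).
  by congr (_ + _); apply: eq_bigr => i _; rewrite -Epart.
under eq_bigr => i _ do rewrite mulrDr.
rewrite big_split/= addrCA -[RHS]addr0; congr (_ + _).
(* At depth 0 there is no E_{-1} summand to cancel [c], but [cE] writes [c] as a trace on E_{-1} =
   0. *)
have [d0|d0] := posnP (depth A).
  have r0 : rk (E 0) = 0 by apply: (@rk_depth _ _ _ A); rewrite d0.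
  rewrite big1 => [|i _]; last by have := ltn_ord i; rewrite [X in (_ < X)%N]d0.
  by rewrite cE /tr big1 ?addr0// => -[k kr] _; exfalso; move: kr; rewrite [rk _]r0.
rewrite (bigD1 (Ordinal d0))//= expr1 mulN1r big1 ?addr0 ?subrr// => i i0.
by rewrite /d ifF ?mulr0//; apply/negbTE; apply: contra i0 => /eqP h; apply/eqP/val_inj.
Qed.

Lemma is_form1_sub (w : form1 A) : is_form1 setT w -> is_form1 U w.
Proof. by move=> [wl ws]; split=> [x _|V e oV _ se]; [exact: wl|exact: ws]. Qed.

Lemma global_section i x (s : sec (E i)) : smooth_sec_at x s ->
  exists2 t : sec (E i), smooth_sec setT t & \forall y \near x, s y = t y.
Proof.
move=> [V [oV Vx] ss]; have [phi [W [[_ oW phi1] Wx sphi _]]] := @extension _ _ _ A _ _ oV Vx.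
exists (fun y => phi y *: s y).
  have := sphi _ (gsmooth_incl oV ss) i; apply: (tame_eq (tE i)); first exact: openT.
  by move=> y _; rewrite /gscale inclE.
by apply: filterS (nbhs_open oW Wx) => y /phi1 ->; rewrite scale1r.
Qed.

(** Closedness over [M] is a condition on global sections only, so a section over [U] is first
    replaced by a global one with the same germ at [x]. *)
Lemma Qclosed_sub (w : form1 A) : Qclosed setT w -> Qclosed U w.
Proof.
move=> [w1 w2]; split=> [e se x Ux|e1 e2 s1 s2 x Ux].
  have sex : smooth_sec_at x e by exists U.
  have [e' se' ee'] := global_section sex.
  by rewrite (first_order_near (tE 1) (@l1_tensorial _ _ _ A x 0) sex ee') w1.
have [s1x s2x] : smooth_sec_at x e1 /\ smooth_sec_at x e2 by split; exists U.
have [t1 st1 e1t] := global_section s1x; have [t2 st2 e2t] := global_section s2x.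
have s1x' : smooth_sec_at x t1 by exists setT => //; split=> //; exact: openT.
have near_w (e t : sec (E 0)) : (\forall y \near x, e y = t y) ->
    \forall y \near x, w y (e y) = w y (t y).
  by move=> et; apply: filterS et => y ->.
have := w2 t1 t2 st1 st2 x I.
rewrite -(tangent_near _ (near_w _ _ e1t)) -(tangent_near _ (near_w _ _ e2t)).
rewrite /rho -(nbhs_singleton e1t) -(nbhs_singleton e2t).
suff -> : br2 t1 t2 x = br2 e1 e2 x by [].
rewrite -(first_order_near (tE 0) (br2_first_order 0 s1x') s2x e2t).
rewrite (br2_antisym s1x' s2x) (br2_antisym s1x s2x); congr (- _).
by rewrite (first_order_near (tE 0) (br2_first_order 0 s2x) s1x e1t).
Qed.

Lemma ber_form_modular (nabla : forall i, connection (E i)) p (b : forall x, bases A x -> R)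
    (w : form1 A) : (0 < p)%N -> ber_generator p b -> ber_form nabla p b w ->
  exists2 g, smooth U g & forall x, U x -> forall v : fib (E 0) x,
    modular_form F v = p%:R^-1 * w x v + Q0 g v.
Proof.
move=> p0 [_ bN0 bs] bw; pose h x := b x (frames_at F x).
have p0' : p%:R != 0 :> R by rewrite pnatr_eq0 -lt0n.
have h0 x : U x -> h x != 0 by move=> Ux; apply: bN0 => i; exact: (@bF i x Ux).
have sh : smooth U h by exact: bs.
have h2 x : U x -> 0 < h x * h x by move=> Ux; rewrite -expr2 exprn_even_gt0//= h0.
have shh : smooth U (fun y => h y * h y) by exact: smooth_mul.
(* This is p^-1 log |h|, written with a square because the sign of [h] may change from one component
   of [U] to another; its derivative along v is (v h) / (p h). *)
pose g y := (2 * p%:R)^-1 * ln (h y * h y).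
have sln : smooth U (fun y => ln (h y * h y)) by exact: smooth_ln.
have sg : smooth U g by apply: smooth_mul => //; exact: smooth_cst.
exists g => // x Ux v.
have [hx shx sshx] : [/\ h x != 0, smooth_at x h & smooth_at x (fun y => h y * h y)].
  by split; [exact: h0|exists U..].
(* [ber_form] is stated for sections: [v] is extended over [U] with constant coefficients in the
   frame. *)
pose e : sec (E 0) := fun y => \sum_k coord (fun k => F (i := 1%N) k x) v 0 k *: F (i := 1%N) k y.
have ex : e x = v by rewrite /e -(coordK (@bF 1%N x Ux)).
have se : smooth_sec U e.
  have : smooth_sec U (fun y => \sum_(k <- index_enum _) coord (fun k => F (i := 1%N) k x) v 0 k *: F (i := 1%N) k y).
    elim: (index_enum _) => [|k r IH].
      by apply: (tame_eq (tE 0)) (tame_zero (tE 0) oU) => // y _; rewrite big_nil.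
    have sk : smooth_sec U (F (i := 1%N) k) by have [] := FU 1%N.
    apply: (tame_eq (tE 0)) (tame_comb (tE 0) oU (smooth_cst U _) sk IH) => // y _.
    by rewrite big_cons.
  by [].
have sex : smooth_sec_at x e by exists U.
rewrite -ex (modular_formE oU FU)//.
have := bw U F e oU FU se x Ux.
rewrite /nabla_ber ad_divergence// -/(h x) -[fun y => b y _]/h.
have -> : Q0 g (e x) = - (p%:R^-1 * (rho e x h * (h x)^-1)).
  rewrite /Q0 tangent_scale; last by exists U.
  rewrite (tangent_ln _ (@bF 0%N x Ux) sshx); last by apply: filterS (nbhs_open oU Ux).
  rewrite tangent_mul// -/(rho e x); congr (- _); set r := rho e x h.
  by field; rewrite hx p0'.
move=> E1; have -> : w x (e x) = (rho e x h + p%:R * modular_function F e x * h x) * (h x)^-1.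
  by rewrite E1 mulfK.
by field; rewrite hx p0'.
Qed.

Lemma modular_form_class (nabla : forall i, connection (E i)) (eta : form1 A) :
  modular_class nabla eta -> same_class U (modular_form F) eta.
Proof.
(* The two branches of the definition become p = 1 and p = 2, the factor one half being 1/p. *)
move=> mc; suff [p [b [w [p0 gb bw [[f1 c1] _ [f sf fE]]]]]] :
    exists p b w, [/\ (0 < p)%N, ber_generator p b, ber_form nabla p b w &
      same_class setT eta (fun x v => p%:R^-1 * w x v)].
  have [g sg gE] := ber_form_modular p0 gb bw.
  split; [split|split|].
  - exact: modular_form_is_form1.
  - exact: modular_form_closed.
  - exact: is_form1_sub.
  - exact: Qclosed_sub.
  have sf' : smooth U f by apply: smooth_sub sf.
  (* Both cocycles are compared with p^-1 w: the modular form differs from it by [Q0 g], and [eta]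
     by [Q0 f]. *)
  exists (fun y => g y + -1 * f y).
    by apply: smooth_add => //; apply: smooth_mul => //; exact: smooth_cst.
  move=> x Ux v; rewrite gE// fE// /Q0 tangent_add; [|by exists U|]; last first.
    by apply: smooth_at_mul; [exact: smooth_at_cst|exists U].
  by rewrite tangent_scale; [ring|exists U].
move: mc; rewrite /modular_class /=; case: ifP => _ [b [w [gb bw sc]]].
  exists 1%N, b, w; split=> //; rewrite invr1.
  have -> : (fun (x : M) v => 1 * w x v) = w => //.
  by apply: functional_extensionality_dep => x; apply/funext => v; rewrite mul1r.
by exists 2%N, b, w.
Qed.

End modular_class.

Theorem proposition4p5 (R : realType) (n : nat) (M : manifold R n)
  (A : lie_inf M) (U : set M) (F : frames A) :
  open U -> is_frames U F ->
  exists w : form1 A,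
    [/\ modular_cocycle U F w,
        Qclosed U w &
        forall (nabla : forall i, connection (E A i)) (eta : form1 A),
          modular_class nabla eta -> same_class U w eta].
Proof.
move=> oU FU; exists (modular_form F); split.
- exact: modular_form_cocycle.
- exact: modular_form_closed.
- by move=> nabla eta; exact: modular_form_class.
Qed.
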